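(* Let $\mathbb{K}$ be any field. Up to isomorphism, there are precisely 26 one-dimensional simplicial complexes $\Delta$ (without loops, i.e. every element of the ground set $[n]$ is a vertex) with $T^2(\Delta)=0$. Viewed as graphs on the vertex set $[n]$, with $ij$ denoting the edge $\{i,j\}$, they are the following. $n=2$: (1) $12$. $n=3$: (2) $12$ (an edge and an isolated vertex); (3) $12,13$; (4) $12,13,23$. $n=4$: (5) $12,13,14$; (6) $12,23,14$; (7) $12,23,34,14$; (8) $12,24,34,14$; (9) $12,23,34,14,24$; (10) $12,23,34,14,24,13$. $n=5$: (11) $12,23,35,15,45$; (12) $12,23,35,15,45,34$; (13) $12,23,35,15,45,34,14$; (14) $12,23,35,15,14,34$; (15) $12,23,34,45,15$. $n=6$: (16) $12,23,34,45,56,16,36,15$; (17) $12,23,34,45,56,16,36,15,24$; (18) $12,23,45,16,36,15,24$; (19) $12,23,45,56,36,15,24$; (20) $12,23,45,16,46,15,24,35$; (21) $12,23,45,16,36,46,15,24,35$. $n=7$: (22) $12,23,34,45,56,16,17,37,57$; (23) $12,23,34,45,56,16,17,47,25$. $n=8$: (24) $12,23,34,14,56,67,78,58,15,26,37,48$; (25) $12,24,34,13,56,67,78,58,15,26,37,48$; (26) $56,67,47,48,58,34,15,26,13,23$. In particular, the maximal possible number of vertices of a one-dimensional simplicial complex with $T^2=0$ is eight, and if such a complex has a leaf (a vertex contained in exactly one edge), then it has at most five vertices.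
   Context: A simplicial complex on $[n]=\{1,\dots,n\}$ is a family $\Delta\subseteq 2^{[n]}$ closed under taking subsets; it is one-dimensional if its largest faces have exactly two elements. A one-dimensional complex with all $\{i\}\in\Delta$ is the same as a simple graph on $[n]$ with at least one edge. $T^2(\Delta)$ is the second cotangent cohomology module of the Stanley-Reisner ring $S/I_\Delta$, where $S=\mathbb{K}[x_1,\dots,x_n]$ and $I=I_\Delta=\langle\prod_{i\in F}x_i : F\subseteq[n],\ F\notin\Delta\rangle$. Explicitly: let $m$ be the number of minimal monomial generators of $I$, let $d:S^m\to S$ be the $S$-linear map sending the canonical basis to these generators, $\operatorname{Syz}(I)=\ker d$, and $\operatorname{Kosz}(I)\subseteq\operatorname{Syz}(I)$ the submodule generated by all $d(f)g-d(g)f$ with $f,g\in S^m$. The quotient $\operatorname{Syz}(I)/\operatorname{Kosz}(I)$ is an $S/I$-module, and $T^2(\Delta)$ is the cokernel of the induced (restriction) map $\operatorname{Hom}_S(S^m,S/I)\to\operatorname{Hom}_{S/I}(\operatorname{Syz}(I)/\operatorname{Kosz}(I),S/I)$. *)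

(* Defs.v *)
From HB Require Import structures.
From mathcomp Require Import all_boot all_order all_algebra.
From mathcomp Require Import generic_quotient ring_quotient.
From mathcomp Require Import boolp.
From mathcomp Require Import mpoly.

Set Implicit Arguments.
Unset Strict Implicit.
Unset Printing Implicit Defensive.

Import GRing.Theory.
Local Open Scope ring_scope.
Local Open Scope quotient_scope.

Section Submodules.
Variables (R : pzRingType) (V : lmodType R).

Record submodule := Submodule {
  submem :> V -> bool;
  submem_closed : GRing.submod_closed submem
}.

HB.instance Definition _ (N : submodule) :=
  GRing.isSubmodClosed.Build R V (submem N)
    (GRing.submod_closed_semi (submem_closed N)).

Section Carrier.
Variable N : submodule.

Record submod := Submod { submod_val : V; submod_valP : submod_val \in submem N }.

HB.instance Definition _ := [isSub for submod_val].
HB.instance Definition _ := [Choice of submod by <:].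
HB.instance Definition _ := [SubChoice_isSubLmodule of submod by <:].

(* Elaboration does not find this structure from [submem N] by itself. *)
Let N_zmod := GRing.ZmodClosed.clone V (submem N) _.

Definition quotmod := Quotient.quot N_zmod.
HB.instance Definition _ := GRing.Zmodule.on quotmod.

Definition quotmod_pi (x : V) : quotmod := \pi_(Quotient.quot N_zmod) x.
Definition quotmod_repr (x : quotmod) : V := repr x.

Lemma quotmod_reprK : cancel quotmod_repr quotmod_pi.
Proof. by move=> x; rewrite /quotmod_pi /quotmod_repr reprK. Qed.

Lemma quotmod_eqP (x y : V) :
  reflect (quotmod_pi x = quotmod_pi y) (x - y \in submem N).
Proof. by rewrite [_ \in _](Quotient.idealrBE N_zmod); apply: eqP. Qed.

Definition quotmod_scale (a : R) (x : quotmod) : quotmod :=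
  quotmod_pi (a *: quotmod_repr x).

Lemma quotmod_piD : {morph quotmod_pi : x y / x + y}.
Proof. exact: (raddfD \pi_(Quotient.quot N_zmod)). Qed.

Lemma quotmod_piZ a x : quotmod_pi (a *: x) = quotmod_scale a (quotmod_pi x).
Proof.
apply/quotmod_eqP; rewrite -scalerBr; apply: rpredZ.
by apply/quotmod_eqP; rewrite quotmod_reprK.
Qed.

Lemma quotmod_scaleA a b x :
  quotmod_scale a (quotmod_scale b x) = quotmod_scale (a * b) x.
Proof. by rewrite -[x]quotmod_reprK -!quotmod_piZ scalerA. Qed.

Lemma quotmod_scale1 : left_id 1 quotmod_scale.
Proof. by move=> x; rewrite -[x]quotmod_reprK -quotmod_piZ scale1r. Qed.

Lemma quotmod_scaleDr : right_distributive quotmod_scale +%R.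
Proof.
move=> a x y; rewrite -[x]quotmod_reprK -[y]quotmod_reprK.
by rewrite -quotmod_piD -!quotmod_piZ scalerDr quotmod_piD.
Qed.

Lemma quotmod_scaleDl x : {morph quotmod_scale^~ x : a b / a + b}.
Proof.
by move=> a b /=; rewrite -[x]quotmod_reprK -!quotmod_piZ scalerDl quotmod_piD.
Qed.

HB.instance Definition _ := GRing.Zmodule_isLmodule.Build R quotmod
  quotmod_scaleA quotmod_scale1 quotmod_scaleDr quotmod_scaleDl.

Lemma quotmod_pi_linear : linear quotmod_pi.
Proof. by move=> a x y; rewrite quotmod_piD quotmod_piZ. Qed.

HB.instance Definition _ :=
  GRing.isLinear.Build R V quotmod *:%R quotmod_pi quotmod_pi_linear.

End Carrier.

Section Span.
Variable P : V -> Prop.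

Definition in_submod_span (v : V) : bool :=
  `[< exists (k : nat) (a : 'I_k -> R) (u : 'I_k -> V),
        (forall i, P (u i)) /\ v = \sum_(i < k) a i *: u i >].

Lemma in_submod_span_closed : GRing.submod_closed in_submod_span.
Proof.
split.
  apply/asboolP; exists 0, (fun _ => 0), (fun _ => 0).
  by split=> [[]|]; rewrite ?big_ord0.
move=> c u v /asboolP[k [a [x [Px ->]]]] /asboolP[l [b [y [Py ->]]]].
apply/asboolP; exists (k + l)%N.
exists (fun i => match split i with inl j => c * a j | inr j => b j end).
exists (fun i => match split i with inl j => x j | inr j => y j end).
split=> [i|]; first by case: (split i).
rewrite big_split_ord /= scaler_sumr; congr (_ + _); apply: eq_bigr => i _.
  by rewrite (unsplitK (inl i)) scalerA.
by rewrite (unsplitK (inr i)).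
Qed.

Definition submod_span := Submodule in_submod_span_closed.

End Span.
End Submodules.


Section Hom.
Variables (R : comPzRingType) (U V : lmodType R).
Local Notation hom := {linear U -> V}.

Lemma hom_eq (f g : hom) : f =1 g -> f = g.
Proof.
case: f g => f [[f1] [f2]] [g [[g1] [g2]]] /= /funext fg.
case: g / fg in g1 g2 *; congr GRing.Linear.Pack; congr GRing.Linear.Class.
  by congr GRing.isNmodMorphism.Axioms_; apply: Prop_irrelevance.
by congr GRing.isScalable.Axioms_; apply: Prop_irrelevance.
Qed.

HB.instance Definition _ := gen_eqMixin hom.
HB.instance Definition _ := gen_choiceMixin hom.

Definition hom_zero : hom := GRing.Linear.clone _ _ _ _ (\0 : U -> V) _.
Definition hom_add (f g : hom) : hom := GRing.Linear.clone _ _ _ _ (f \+ g) _.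
Definition hom_opp (f : hom) : hom := GRing.Linear.clone _ _ _ _ (\- f) _.
Definition hom_scale (a : R) (f : hom) : hom :=
  GRing.Linear.clone _ _ _ _ (a \*: f) _.

Lemma hom_addA : associative hom_add.
Proof. by move=> f g h; apply: hom_eq => x /=; rewrite addrA. Qed.

Lemma hom_addC : commutative hom_add.
Proof. by move=> f g; apply: hom_eq => x /=; rewrite addrC. Qed.

Lemma hom_add0 : left_id hom_zero hom_add.
Proof. by move=> f; apply: hom_eq => x /=; rewrite add0r. Qed.

Lemma hom_addN : left_inverse hom_zero hom_opp hom_add.
Proof. by move=> f; apply: hom_eq => x /=; rewrite addNr. Qed.

HB.instance Definition _ :=
  GRing.isZmodule.Build hom hom_addA hom_addC hom_add0 hom_addN.

Lemma hom_scaleA a b f : hom_scale a (hom_scale b f) = hom_scale (a * b) f.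
Proof. by apply: hom_eq => x /=; rewrite scalerA. Qed.

Lemma hom_scale1 : left_id 1 hom_scale.
Proof. by move=> f; apply: hom_eq => x /=; rewrite scale1r. Qed.

Lemma hom_scaleDr : right_distributive hom_scale +%R.
Proof. by move=> a f g; apply: hom_eq => x /=; rewrite scalerDr. Qed.

Lemma hom_scaleDl f : {morph hom_scale^~ f : a b / a + b}.
Proof. by move=> a b; apply: hom_eq => x /=; rewrite scalerDl. Qed.

HB.instance Definition _ := GRing.Zmodule_isLmodule.Build R hom
  hom_scaleA hom_scale1 hom_scaleDr hom_scaleDl.

End Hom.

Section QuotientScalars.
Variables (R : comNzRingType) (I : idealr R).

(* A copy of R / I carrying its R-module structure, since {ideal_quot I} itself
   is reserved for the ring structure. *)
Definition ideal_quot_mod := {ideal_quot I}.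
HB.instance Definition _ := GRing.Zmodule.on ideal_quot_mod.

Definition iqpi (a : R) : {ideal_quot I} := \pi_({ideal_quot I}) a.

Lemma iqpiD : {morph iqpi : a b / a + b}. Proof. exact: raddfD. Qed.
Lemma iqpiM : {morph iqpi : a b / a * b}. Proof. exact: rmorphM. Qed.
Lemma iqpi1 : iqpi 1 = 1. Proof. exact: rmorph1. Qed.
Lemma iqpi_reprK : cancel (fun a : {ideal_quot I} => repr a) iqpi.
Proof. by move=> a; rewrite /iqpi reprK. Qed.
Lemma iqpi_eqP (a b : R) : reflect (iqpi a = iqpi b) (a - b \in I : bool).
Proof. by rewrite [_ \in _](Quotient.idealrBE I); apply: eqP. Qed.

Definition iqscale (a : R) (x : ideal_quot_mod) : ideal_quot_mod :=
  iqpi a * (x : {ideal_quot I}).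

Lemma iqscaleA a b x : iqscale a (iqscale b x) = iqscale (a * b) x.
Proof. by rewrite /iqscale iqpiM mulrA. Qed.

Lemma iqscale1 : left_id 1 iqscale.
Proof. by move=> x; rewrite /iqscale iqpi1 mul1r. Qed.

Lemma iqscaleDr : right_distributive iqscale +%R.
Proof. by move=> a x y; rewrite /iqscale -mulrDr. Qed.

Lemma iqscaleDl x : {morph iqscale^~ x : a b / a + b}.
Proof. by move=> a b; rewrite /iqscale iqpiD mulrDl. Qed.

HB.instance Definition _ := GRing.Zmodule_isLmodule.Build R ideal_quot_mod
  iqscaleA iqscale1 iqscaleDr iqscaleDl.


Section Annihilated.
Variables (M : lmodType R).

Definition annihilates := forall a : R, iqpi a = 0 -> forall x : M, a *: x = 0.

(* A module M killed by I, regarded as a module over R / I. *)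
Definition over_quot of annihilates : Type := M.

Variable annM : annihilates.
HB.instance Definition _ := GRing.Zmodule.copy (over_quot annM) M.

Definition oqscale (a : {ideal_quot I}) (x : over_quot annM) : over_quot annM :=
  repr a *: (x : M).

Lemma oqscaleE a (x : M) : oqscale (iqpi a) x = a *: x.
Proof.
apply/eqP; rewrite -subr_eq0 -scalerBl annM // /iqpi.
by rewrite raddfB /= [X in X - _]iqpi_reprK subrr.
Qed.

Lemma oqscaleA a b x : oqscale a (oqscale b x) = oqscale (a * b) x.
Proof.
rewrite -[a]iqpi_reprK -[b]iqpi_reprK.
by rewrite -iqpiM !oqscaleE scalerA.
Qed.

Lemma oqscale1 : left_id 1 oqscale.
Proof. by move=> x; rewrite -iqpi1 oqscaleE scale1r. Qed.

Lemma oqscaleDr : right_distributive oqscale +%R.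
Proof. by move=> a x y; rewrite /oqscale scalerDr. Qed.

Lemma oqscaleDl x : {morph oqscale^~ x : a b / a + b}.
Proof.
move=> a b /=; rewrite -[a]iqpi_reprK -[b]iqpi_reprK.
by rewrite -iqpiD !oqscaleE scalerDl.
Qed.

HB.instance Definition _ :=
  GRing.Zmodule_isLmodule.Build {ideal_quot I} (over_quot annM)
    oqscaleA oqscale1 oqscaleDr oqscaleDl.

End Annihilated.
End QuotientScalars.

(* The void family, which has no face at all, is excluded: its Stanley-Reisner
   ring would be 0.  A singleton that is not a face ("loop") is allowed. *)
Record scomplex (n : nat) := SComplex {
  faces :> {set {set 'I_n}};
  faces0 : set0 \in faces;
  faces_sub : forall F G : {set 'I_n}, G \subset F -> F \in faces -> G \in faces
}.

Section Complexes.
Variable n : nat.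
Implicit Type D : scomplex n.

Definition one_dimensional D : Prop := (\max_(F in faces D) #|F|)%N = 2%N.

Definition vertices D : {set 'I_n} := [set i | [set i] \in faces D].

Definition loopless D : Prop := vertices D = [set: 'I_n].

Definition edges D : {set {set 'I_n}} := [set F in faces D | #|F| == 2%N].

Definition has_leaf D : Prop :=
  exists i : 'I_n, #|[set e in edges D | i \in e]| = 1%N.

Definition nonfaces D : {set {set 'I_n}} := ~: faces D.

Definition min_nonfaces D : {set {set 'I_n}} :=
  [set F | minset (fun G => G \in nonfaces D) F].

End Complexes.

Definition isomorphic n n' (D : scomplex n) (D' : scomplex n') : Prop :=
  exists2 f : 'I_n -> 'I_n', bijective f &
    forall F : {set 'I_n}, (f @: F \in faces D') = (F \in faces D).

Section T2.
Variables (K : fieldType) (n : nat) (D : scomplex n).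

Local Notation S := {mpoly K[n]}.

Definition sqfree_monom (F : {set 'I_n}) : S := \prod_(i in F) 'X_i.

Definition sr_ideal : submodule S^o :=
  submod_span (fun p : S^o => exists2 F, F \in nonfaces D & p = sqfree_monom F).

Lemma sqfree_monom_sub (F G : {set 'I_n}) : G \subset F ->
  sqfree_monom F = sqfree_monom (F :\: G) * sqfree_monom G.
Proof.
move=> GF; rewrite /sqfree_monom (big_setID G) /= mulrC.
by rewrite (setIidPr GF).
Qed.

Lemma mem_sr_ideal F : F \in nonfaces D -> sqfree_monom F \in submem sr_ideal.
Proof.
move=> FD; apply/asboolP; exists 1, (fun _ => 1), (fun _ => sqfree_monom F).
by split=> [_|]; [exists F | rewrite big_ord1 scale1r].
Qed.

Lemma sr_ideal_closed : idealr_closed (submem sr_ideal : pred S).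
Proof.
have [c0 cD] := submem_closed sr_ideal; split=> //.
apply/asboolP=> -[k [a [u [Pu]]]] /(congr1 (meval (fun=> 0 : K))).
rewrite rmorph1 raddf_sum big1 => [/eqP|i _]; first by rewrite oner_eq0.
have [F FD ->] := Pu i.
transitivity ((a i * sqfree_monom F : S).@[fun=> 0 : K]); first by [].
rewrite mevalM /sqfree_monom rmorph_prod /=.
have [F0|[j jF]] := set_0Vmem F.
  by move: FD; rewrite inE F0 faces0.
by rewrite (bigD1 j) //= mevalXU mul0r mulr0.
Qed.

HB.instance Definition _ := isIdealr.Build S (submem sr_ideal) sr_ideal_closed.

Local Notation I := (Idealr.clone S (submem sr_ideal) _).

Definition sr_ring := {ideal_quot I}.
Definition sr_mod := ideal_quot_mod I.
Definition sr_pi (p : S) : sr_ring := iqpi I p.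

(* Divisibility of squarefree monomials is inclusion of supports, so the minimal
   monomial generators of I are the monomials of the minimal nonfaces.  The free
   module S^m is the space of row vectors over S, and [dgen] is the map d. *)
Definition ngens := #|min_nonfaces D|.
Local Notation m := ngens.

Definition gen (i : 'I_m) : S := sqfree_monom (enum_val i).

Definition dgen (v : 'rV[S]_m) : S := \sum_i v 0 i * gen i.

Lemma dgen_linear : linear (dgen : _ -> S^o).
Proof.
move=> a u v; rewrite -[RHS]/(a * dgen u + dgen v : S).
rewrite /dgen mulr_sumr -big_split /=.
by apply: eq_bigr => i _; rewrite !mxE mulrDl mulrA.
Qed.

HB.instance Definition _ := GRing.isLinear.Build S 'rV[S]_m S^o *:%R dgen dgen_linear.

Lemma dgen_delta i : dgen (delta_mx 0 i) = gen i.
Proof.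
rewrite /dgen (bigD1 i) //= big1 => [|j jG]; first by rewrite mxE !eqxx mul1r addr0.
by rewrite mxE (negPf jG) andbF mul0r.
Qed.

Lemma dgenZ a v : dgen (a *: v) = a * dgen v.
Proof. exact: (linearZZ (dgen : {linear _ -> S^o})). Qed.

Lemma syz_closed : GRing.submod_closed (fun v => dgen v == 0).
Proof.
split=> [|a u v]; rewrite !unfold_in /=; first by rewrite raddf0.
move=> /eqP u0 /eqP v0; apply/eqP; rewrite [LHS]dgen_linear.
by rewrite u0 v0 scaler0 addr0.
Qed.

Definition Syz : submodule 'rV[S]_m := Submodule syz_closed.

Definition Kosz : submodule (submod Syz) :=
  submod_span (fun z : submod Syz =>
    exists f g : 'rV[S]_m, \val z = dgen f *: g - dgen g *: f).

Lemma dgen_sr_ideal v : dgen v \in submem sr_ideal.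
Proof.
apply: rpred_sum => i _; apply: (rpredZ (v 0 i)); apply: mem_sr_ideal.
by have := enum_valP i; rewrite inE => /minsetp.
Qed.

Lemma sr_idealP p : p \in submem sr_ideal -> exists v, p = dgen v.
Proof.
move=> /asboolP [k [a [u [Pu ->]]]].
have gP i : exists v, u i = dgen v.
  have [F FD ->] := Pu i; have [G Gmin GF] := minset_exists FD.
  have Gm : G \in min_nonfaces D by rewrite inE.
  exists (sqfree_monom (F :\: G) *: delta_mx 0 (enum_rank_in Gm G)).
  rewrite dgenZ dgen_delta /gen enum_rankK_in //; exact: sqfree_monom_sub.
have [w uw] := choice gP; exists (\sum_i a i *: w i).
rewrite (linear_sum (dgen : {linear _ -> S^o})).
by apply: eq_bigr => i _; rewrite uw [RHS]dgenZ.
Qed.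

Lemma sr_pi_eq0 p : (sr_pi p = 0) <-> p \in submem sr_ideal.
Proof.
have <- : sr_pi 0 = 0 by exact: raddf0.
by rewrite -[p in p \in _]subr0; split=> /iqpi_eqP.
Qed.

Lemma Syz_Kosz_ann : annihilates I (quotmod Kosz).
Proof.
move=> a /sr_pi_eq0 /sr_idealP [v ->] x; rewrite -[x]quotmod_reprK -linearZ.
rewrite -[RHS](linear0 (quotmod_pi Kosz)).
apply/quotmod_eqP; rewrite subr0.
set z := quotmod_repr x; apply/asboolP.
exists 1, (fun _ => 1), (fun _ => dgen v *: z).
split=> [_|]; last by rewrite big_ord1 scale1r.
exists v, (\val z); have /eqP z0 := valP z.
by rewrite z0 scale0r subr0 linearZ.
Qed.

(* Syz(I)/Kosz(I) as an S/I-module. *)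
Definition Syz_Kosz := over_quot Syz_Kosz_ann.

Lemma hom_Kosz (psi : {linear 'rV[S]_m -> sr_mod}) (z : submod Syz) :
  z \in submem Kosz -> psi (\val z) = 0.
Proof.
move=> /asboolP [k [a [u [Pu ->]]]].
rewrite !linear_sum big1 // => i _; rewrite !linearZ /=.
have [f [g ->]] := Pu i; rewrite linearB !linearZ /=.
have dv0 v (x : sr_mod) : dgen v *: x = 0.
  have v0 : sr_pi (dgen v) = 0 by apply/sr_pi_eq0/dgen_sr_ideal.
  transitivity (sr_pi (dgen v) * (x : sr_ring)); first by [].
  by rewrite v0; apply: mul0r.
by rewrite !dv0 addr0 scaler0.
Qed.

(* The map induced by psi on Syz(I)/Kosz(I); it is characterised by [restr_funE]. *)
Definition restr_fun (psi : {linear 'rV[S]_m -> sr_mod}) (x : Syz_Kosz) :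
  sr_ring^o := psi (\val (quotmod_repr (x : quotmod Kosz))).

Lemma restr_funE psi (z : submod Syz) :
  restr_fun psi (quotmod_pi Kosz z) = psi (\val z).
Proof.
apply/eqP; rewrite -subr_eq0; apply/eqP.
rewrite /restr_fun -[LHS](raddfB psi) -raddfB; apply: hom_Kosz.
by apply/quotmod_eqP; rewrite quotmod_reprK.
Qed.

Lemma restr_linear psi : linear (restr_fun psi).
Proof.
move=> a x y; rewrite -[a]iqpi_reprK.
rewrite -[x](@quotmod_reprK _ _ Kosz) -[y](@quotmod_reprK _ _ Kosz).
set p := repr a; set u := quotmod_repr _; set v := quotmod_repr _.
have -> : iqpi I p *: (quotmod_pi Kosz u : Syz_Kosz) =
    quotmod_pi Kosz (p *: u) :> Syz_Kosz.
  by rewrite [LHS]oqscaleE linearZ.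
have -> : (quotmod_pi Kosz (p *: u) : Syz_Kosz) + quotmod_pi Kosz v =
    quotmod_pi Kosz (p *: u + v) :> Syz_Kosz by rewrite linearD.
by rewrite !restr_funE !linearP.
Qed.

HB.instance Definition _ psi :=
  GRing.isLinear.Build sr_ring Syz_Kosz sr_ring^o *:%R (restr_fun psi)
    (restr_linear psi).

Definition restr (psi : {linear 'rV[S]_m -> sr_mod}) :
  {linear Syz_Kosz -> sr_ring^o} := GRing.Linear.clone _ _ _ _ (restr_fun psi) _.

Definition in_restr_image (phi : {linear Syz_Kosz -> sr_ring^o}) : bool :=
  `[< exists psi, phi = restr psi >].

Lemma restr_image_closed : GRing.submod_closed in_restr_image.
Proof.
split.
  apply/asboolP; exists 0; apply: hom_eq => x; exact: esym.
move=> a f g /asboolP [p ->] /asboolP [q ->]; apply/asboolP.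
exists (repr a *: p + q); apply: hom_eq => x /=.
rewrite -[in LHS](iqpi_reprK a); exact: erefl.
Qed.

Definition T2 := quotmod (Submodule restr_image_closed).

Definition T2_vanishes : Prop := forall t : T2, t = 0.

End T2.

Section Graphs.
Variables (n : nat) (E : seq (nat * nat)).

(* Vertex labels run from 1 to n, so the label of i : 'I_n is i.+1. *)
Definition edge_set (e : nat * nat) : {set 'I_n} :=
  [set i : 'I_n | (i.+1 == e.1) || (i.+1 == e.2)].

Definition graph_faces : {set {set 'I_n}} :=
  [set F : {set 'I_n} | (#|F| <= 1)%N || has (fun e => F == edge_set e) E].

Lemma card_edge_set e : (#|edge_set e| <= 2)%N.
Proof.
have le1 (a : nat) : (#|[set i : 'I_n | i.+1 == a]| <= 1)%N.
  apply/card_le1P => i; rewrite inE => /eqP ia j; rewrite !inE -ia.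
  by rewrite eqSS.
rewrite (_ : edge_set e =
  [set i : 'I_n | i.+1 == e.1] :|: [set i : 'I_n | i.+1 == e.2]).
  by rewrite (leq_trans (leq_card_setU _ _)) // (leq_add (le1 _) (le1 _)).
by apply/setP => i; rewrite !inE.
Qed.

Lemma graph_faces0 : set0 \in graph_faces.
Proof. by rewrite inE cards0. Qed.

Lemma graph_faces_sub (F G : {set 'I_n}) :
  G \subset F -> F \in graph_faces -> G \in graph_faces.
Proof.
move=> GF; rewrite !inE => /orP[F1|/hasP[e eE /eqP FE]].
  by rewrite (leq_trans (subset_leq_card GF) F1).
have [GE|GnF] := eqVneq G F.
  by apply/orP; right; apply/hasP; exists e; rewrite // GE FE.
have : G \proper F by rewrite properEneq GnF.
move=> /proper_card; rewrite FE => GF1; rewrite -ltnS.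
by rewrite (leq_trans GF1 (card_edge_set e)).
Qed.

Definition graph_complex : scomplex n := SComplex graph_faces0 graph_faces_sub.

End Graphs.

Local Open Scope nat_scope.

(* Pairs (number of vertices, list of edges). *)
Definition listed_graphs : 26.-tuple (nat * seq (nat * nat)) := [tuple
  (2, [:: (1, 2)]);
  (3, [:: (1, 2)]);
  (3, [:: (1, 2); (1, 3)]);
  (3, [:: (1, 2); (1, 3); (2, 3)]);
  (4, [:: (1, 2); (1, 3); (1, 4)]);
  (4, [:: (1, 2); (2, 3); (1, 4)]);
  (4, [:: (1, 2); (2, 3); (3, 4); (1, 4)]);
  (4, [:: (1, 2); (2, 4); (3, 4); (1, 4)]);
  (4, [:: (1, 2); (2, 3); (3, 4); (1, 4); (2, 4)]);
  (4, [:: (1, 2); (2, 3); (3, 4); (1, 4); (2, 4); (1, 3)]);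
  (5, [:: (1, 2); (2, 3); (3, 5); (1, 5); (4, 5)]);
  (5, [:: (1, 2); (2, 3); (3, 5); (1, 5); (4, 5); (3, 4)]);
  (5, [:: (1, 2); (2, 3); (3, 5); (1, 5); (4, 5); (3, 4); (1, 4)]);
  (5, [:: (1, 2); (2, 3); (3, 5); (1, 5); (1, 4); (3, 4)]);
  (5, [:: (1, 2); (2, 3); (3, 4); (4, 5); (1, 5)]);
  (6, [:: (1, 2); (2, 3); (3, 4); (4, 5); (5, 6); (1, 6); (3, 6); (1, 5)]);
  (6, [:: (1, 2); (2, 3); (3, 4); (4, 5); (5, 6); (1, 6); (3, 6); (1, 5);
     (2, 4)]);
  (6, [:: (1, 2); (2, 3); (4, 5); (1, 6); (3, 6); (1, 5); (2, 4)]);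
  (6, [:: (1, 2); (2, 3); (4, 5); (5, 6); (3, 6); (1, 5); (2, 4)]);
  (6, [:: (1, 2); (2, 3); (4, 5); (1, 6); (4, 6); (1, 5); (2, 4); (3, 5)]);
  (6, [:: (1, 2); (2, 3); (4, 5); (1, 6); (3, 6); (4, 6); (1, 5); (2, 4);
     (3, 5)]);
  (7, [:: (1, 2); (2, 3); (3, 4); (4, 5); (5, 6); (1, 6); (1, 7); (3, 7);
     (5, 7)]);
  (7, [:: (1, 2); (2, 3); (3, 4); (4, 5); (5, 6); (1, 6); (1, 7); (4, 7);
     (2, 5)]);
  (8, [:: (1, 2); (2, 3); (3, 4); (1, 4); (5, 6); (6, 7); (7, 8); (5, 8);
     (1, 5); (2, 6); (3, 7); (4, 8)]);
  (8, [:: (1, 2); (2, 4); (3, 4); (1, 3); (5, 6); (6, 7); (7, 8); (5, 8);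
     (1, 5); (2, 6); (3, 7); (4, 8)]);
  (8, [:: (5, 6); (6, 7); (4, 7); (4, 8); (5, 8); (3, 4); (1, 5); (2, 6);
     (1, 3); (2, 3)])
].

Definition listed_complex (k : 'I_26) : scomplex (tnth listed_graphs k).1 :=
  graph_complex (tnth listed_graphs k).1 (tnth listed_graphs k).2.

(* Main.v *)
(* The module T2 is graded by Z^n.  In a degree a - b with b squarefree and a, b
   disjoint, a homomorphism on Syz/Kosz amounts to functions theta(h, -), modulo
   constants, on the minimal nonfaces inside the union of h and b, where h runs over
   the faces containing a and avoiding b, compatible with inclusions of faces; it is a
   restriction from S^m iff theta can be chosen independent of h.  Hence T2 = 0 iff
   every such cocycle is a coboundary, whatever the field.

   For a graph this means: every vertex has at most three neighbours; the
   non-neighbours of every vertex induce a forest; and for every nonadjacent pair or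
   triangle b, the faces h outside b for which the union of h and b contains a nonface
   other than b are connected under inclusion.  If there are at least seven vertices,
   these conditions force minimum degree two, and counting edges in the forest of
   non-neighbours of v shows that at most 2 deg(v) - 2 of them have degree three.
   Uncovering the graph one neighbourhood at a time and pruning by these conditions is
   a finite search, which ends in the listed graphs only. *)

Require Import Defs.
From mathcomp Require Import all_boot all_order all_algebra.
From HB Require Import structures.
From mathcomp Require Import generic_quotient ring_quotient.
From mathcomp Require Import boolp mpoly zify.

Set Implicit Arguments.
Unset Strict Implicit.
Unset Printing Implicit Defensive.

Import GRing.Theory.

(** * Coefficients in the Stanley-Reisner ring *)

(** A Taylor syzygy of two squarefree generators lives in a squarefree multidegree, so the negative
    part of the degree of any coefficient of its image is a set; this is why a squarefree [b]
    suffices. The positive part can be any monomial, but only its support enters the cocycle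
    condition. Potentials are chosen separately in each degree, and the obstacle is that they have
    to add up to polynomials: the finitely many Taylor syzygies involved give a degree bound beyond
    which every coefficient vanishes.

    For necessity, acyclicity takes the form of an inequality for the degree sum on a set of
    non-neighbours. It comes from a rank argument over the field: the potentials of the single edges
    form a right inverse of the incidence matrix with one vertex deleted, so no cycle has to be
    constructed.

    In the search, dense subgraphs and closed sets of vertices are proposed by simple routines and
    then verified; the soundness proof uses the verification alone. Exhausted fuel counts as
    failure, so the computed value [true] vouches for the whole search. *)

Section Monomials.
Local Open Scope ring_scope.
Variables (K : fieldType) (n : nat).
Local Notation S := {mpoly K[n]}.
Implicit Types (m e : 'X_{1..n}) (F G h : {set 'I_n}) (p : S).

Definition msupport m : {set 'I_n} := [set i | m i != 0%N].

Lemma mesym1E F i : mesym1 F i = (i \in F) :> nat.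
Proof. by rewrite mnmE. Qed.

Lemma lem_mesym1 F m : (mesym1 F <= m)%MM = (F \subset msupport m).
Proof.
apply/mnm_lepP/subsetP => le i => [iF|]; last rewrite mesym1E.
  by have := le i; rewrite mesym1E iF inE lt0n.
by case: (boolP (i \in F)) => // /le; rewrite inE lt0n.
Qed.

Lemma msupport_mesym1 F : msupport (mesym1 F) = F.
Proof. by apply/setP => i; rewrite inE mesym1E; case: (i \in F). Qed.

Lemma msupportD m e : msupport (m + e)%MM = msupport m :|: msupport e.
Proof. by apply/setP => i; rewrite !inE mnmDE addn_eq0 negb_and. Qed.

Lemma sqfree_monomE F : sqfree_monom K F = 'X_[mesym1 F].
Proof.
rewrite mpolyXE_id /sqfree_monom [LHS]big_mkcond /=.
by apply: eq_bigr => i _; rewrite mesym1E; case: (i \in F); rewrite ?expr1 ?expr0.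
Qed.

Lemma mcoeff_mulX p e m :
  ('X_[e] * p)@_m = if (e <= m)%MM then p@_(m - e) else 0.
Proof.
rewrite mulrC; case: ifPn => [le_em|nle].
  by have := mcoeffMX p e (m - e)%MM; rewrite addmC submK.
apply/eqP; rewrite mcoeff_eq0 (perm_mem (msuppMX p e)).
by apply: contra nle => /mapP [m' _ ->]; apply: lem_addr.
Qed.

Lemma mpolyM_expand p q : p * q = \sum_(e <- msupp p) p@_e *: ('X_[e] * q).
Proof.
by rewrite {1}[p]mpolyE mulr_suml; apply: eq_bigr => e _; rewrite scalerAl.
Qed.

(** Both constructions of homomorphisms below prescribe coefficients; a degree bound is what makes
    them polynomials. *)
Lemma mcoeff_truncated (E : 'X_{1..n} -> K) k m :
  (forall e, (k <= mdeg e)%N -> E e = 0) ->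
  (\sum_(e : 'X_{1..n < k}) E e *: 'X_[e])@_m = E m.
Proof.
move=> E0; have [lt_m|ge_m] := ltnP (mdeg m) k; first exact: mcoeff_mpoly.
rewrite E0 // raddf_sum big1 // => -[d d_lt] _.
rewrite /= mcoeffZ mcoeffX; case: eqP => [dm|]; last by rewrite mulr0.
by move: d_lt; rewrite dm ltnNge ge_m.
Qed.

End Monomials.

Section StanleyReisner.
Local Open Scope ring_scope.
Variables (K : fieldType) (n : nat) (D : scomplex n).
Local Notation S := {mpoly K[n]}.
Local Notation m := (ngens D).
Implicit Types (F G h : {set 'I_n}) (p q : S).

Definition face_monom (e : 'X_{1..n}) := msupport e \in faces D.

Lemma min_nonface_sub F : F \in nonfaces D ->
  exists2 G, G \in min_nonfaces D & G \subset F.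
Proof.
by move=> FD; have [G Gm GF] := minset_exists FD; exists G; rewrite ?inE.
Qed.

Lemma min_nonfaceP F : F \in min_nonfaces D -> F \notin faces D.
Proof. by rewrite inE => /minsetp; rewrite inE. Qed.

(** A monomial ideal is tested coefficient by coefficient, and ['X_[e]] is a multiple of a generator
    as soon as the support of [e] is a nonface. *)
Lemma sr_idealE p : reflect (forall e, face_monom e -> p@_e = 0)
  (p \in submem (sr_ideal K D)).
Proof.
apply: (iffP idP) => [/asboolP [k [a [u [Pu ->]]]] e De | Hp].
  rewrite raddf_sum big1 //= => i _; have [F FD ->] := Pu i.
  rewrite -[_ *: _]/(a i * sqfree_monom K F) mulrC sqfree_monomE mcoeff_mulX.
  rewrite lem_mesym1; case: ifP => // Fe; move: FD; rewrite inE => /negP [].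
  exact: faces_sub Fe De.
rewrite [p]mpolyE big_seq; apply: rpred_sum => e; rewrite mcoeff_msupp => pe.
have De : msupport e \in nonfaces D by rewrite !inE; apply: contra_neqN pe => /Hp.
have -> : p@_e *: 'X_[e] =
    (p@_e *: 'X_[e - mesym1 (msupport e)]) *: (sqfree_monom K (msupport e) : S^o).
  rewrite -[RHS]/((p@_e *: 'X_[_]) * _) sqfree_monomE -scalerAl -mpolyXD.
  by rewrite submK // lem_mesym1.
by apply: rpredZ; apply: mem_sr_ideal.
Qed.

Lemma sr_pi_eqP p q :
  sr_pi D p = sr_pi D q <-> forall e, face_monom e -> p@_e = q@_e.
Proof.
split=> [/iqpi_eqP /sr_idealE pq e /pq /eqP|pq].
  by rewrite mcoeffB subr_eq0 => /eqP.
by apply/iqpi_eqP/sr_idealE => e /pq; rewrite mcoeffB => ->; rewrite subrr.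
Qed.

(* Coefficients on face monomials do not depend on the representative. *)
Definition sr_coef (x : sr_mod K D) e : K := (repr (x : sr_ring K D))@_e.

Lemma sr_coef_pi p e : face_monom e -> sr_coef (sr_pi D p) e = p@_e.
Proof.
move=> De; rewrite /sr_coef; have : sr_pi D (repr (sr_pi D p)) = sr_pi D p.
  exact: iqpi_reprK.
by move/sr_pi_eqP; apply.
Qed.

Lemma sr_coef_inj (x y : sr_mod K D) :
  (forall e, face_monom e -> sr_coef x e = sr_coef y e) -> x = y.
Proof.
move=> xy; rewrite -[x](iqpi_reprK) -[y](iqpi_reprK); exact/sr_pi_eqP.
Qed.

Lemma sr_coefB (x y : sr_mod K D) e : face_monom e ->
  sr_coef (x - y) e = sr_coef x e - sr_coef y e.
Proof.
move=> De; rewrite -[x](iqpi_reprK) -[y](iqpi_reprK).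
have -> : iqpi _ (repr (x : sr_ring K D)) - iqpi _ (repr (y : sr_ring K D)) =
   sr_pi D (repr (x : sr_ring K D) - repr (y : sr_ring K D)) :> sr_mod K D.
  by rewrite /sr_pi /iqpi raddfB.
by rewrite !sr_coef_pi // mcoeffB.
Qed.

Lemma sr_coefZX (x : sr_mod K D) e' e : face_monom e ->
  sr_coef ('X_[e'] *: x) e = if (e' <= e)%MM then sr_coef x (e - e') else 0.
Proof.
move=> De; rewrite -[x](iqpi_reprK).
have -> : 'X_[e'] *: (iqpi _ (repr (x : sr_ring K D)) : sr_mod K D) =
   sr_pi D ('X_[e'] * repr (x : sr_ring K D)) :> sr_mod K D.
  by rewrite /sr_pi iqpiM.
rewrite sr_coef_pi // mcoeff_mulX; case: ifP => // le_ee.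
rewrite sr_coef_pi // /face_monom; apply: faces_sub De.
by apply/subsetP => i; rewrite !inE mnmBE; apply: contraNN => /eqP ->.
Qed.

End StanleyReisner.

(** * Cocycles in degree a - b *)

Section Cocycles.
Local Open Scope ring_scope.
Variables (K : fieldType) (n : nat) (D : scomplex n).
Implicit Types (a b F G h : {set 'I_n}).

(* For a homomorphism of degree a - b on Syz(I)/Kosz(I), [theta h F - theta h G] is
   the coefficient with support [h] of the image of the Taylor syzygy of [F] and [G]
   in multidegree h :|: b, so only the class of [theta h] modulo constants matters.
   The Koszul relations allow one to normalise [theta h F] to 0 unless b \subset F. *)
Definition t2_cocycle a b (theta : {set 'I_n} -> {set 'I_n} -> K) : Prop :=
  (forall h F, ~~ (b \subset F) -> theta h F = 0) /\
  forall h h', a \subset h -> h \subset h' -> h' \in faces D ->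
    [disjoint h' & b] ->
    exists c, forall F, F \in min_nonfaces D -> F \subset h :|: b ->
      theta h' F = theta h F + c.

(** [psi F] is the coefficient of the image of the generator of [F] under a map of degree a - b on
    S^m. It vanishes unless [b \subset F], as that image would otherwise have a negative exponent.
    Differences are compared because [theta h] matters modulo constants. *)
Definition t2_coboundary a b (theta : {set 'I_n} -> {set 'I_n} -> K) : Prop :=
  exists psi : {set 'I_n} -> K,
    (forall F, ~~ (b \subset F) -> psi F = 0) /\
    forall h, a \subset h -> h \in faces D -> [disjoint h & b] ->
      forall F G, F \in min_nonfaces D -> G \in min_nonfaces D ->
        F \subset h :|: b -> G \subset h :|: b ->
        theta h F - theta h G = psi F - psi G.

End Cocycles.

(** * Taylor syzygies and linear maps on Syz/Kosz *)

Section Taylor.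
Local Open Scope ring_scope.
Variables (K : fieldType) (n : nat) (D : scomplex n).
Local Notation S := {mpoly K[n]}.
Local Notation m := (ngens D).
Implicit Types (a b F G h : {set 'I_n}) (e : 'X_{1..n}) (i j : 'I_m).

Definition gen_set i : {set 'I_n} := enum_val i.

Lemma gen_set_min i : gen_set i \in min_nonfaces D.
Proof. exact: enum_valP. Qed.

Lemma gen_setP F : F \in min_nonfaces D -> exists i, gen_set i = F.
Proof. by move=> Fm; exists (enum_rank_in Fm F); rewrite /gen_set enum_rankK_in. Qed.

Lemma genE i : gen K i = 'X_[mesym1 (gen_set i)].
Proof. exact: sqfree_monomE. Qed.

(** If [e] is the least common multiple of the two generators, this is their Taylor syzygy; for
    larger [e] it is the monomial multiple in multidegree [e]. *)
Definition taylor e i j : 'rV[S]_m :=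
  'X_[e - mesym1 (gen_set i)] *: delta_mx 0 i
  - 'X_[e - mesym1 (gen_set j)] *: delta_mx 0 j.

Lemma taylor_syz e i j : (mesym1 (gen_set i) <= e)%MM ->
  (mesym1 (gen_set j) <= e)%MM -> taylor e i j \in submem (Syz K D).
Proof.
move=> le_ie le_je; rewrite unfold_in /= /taylor.
rewrite (raddfB (@dgen K n D : {linear _ -> S^o})) /= !dgenZ !dgen_delta !genE.
by rewrite -!mpolyXD !submK // subrr.
Qed.

Lemma dgen_coef (v : 'rV[S]_m) e :
  (dgen v)@_e = \sum_i (if (mesym1 (gen_set i) <= e)%MM
                        then (v 0 i)@_(e - mesym1 (gen_set i)) else 0).
Proof.
rewrite raddf_sum; apply: eq_bigr => i _.
by rewrite /= genE mulrC mcoeff_mulX.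
Qed.

Lemma Syz_hom_descends (eta : submod (Syz K D) -> sr_mod K D) :
  linear eta -> (forall z, z \in submem (Kosz K D) -> eta z = 0) ->
  exists phi : {linear Syz_Kosz K D -> (sr_ring K D)^o},
    forall z, phi (quotmod_pi (Kosz K D) z) = eta z.
Proof.
move=> eta_lin etaK; pose lin_eta := GRing.isLinear.Build _ _ _ _ eta eta_lin.
pose etaL : {linear submod (Syz K D) -> sr_mod K D} := HB.pack eta lin_eta.
pose f (x : Syz_Kosz K D) : (sr_ring K D)^o :=
  eta (quotmod_repr (x : quotmod (Kosz K D))).
have fE z : f (quotmod_pi (Kosz K D) z) = eta z.
  apply/eqP; rewrite -subr_eq0; apply/eqP.
  rewrite /f -[LHS](raddfB etaL); apply: etaK.
  by apply/quotmod_eqP; rewrite quotmod_reprK.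
have f_lin : linear f.
  move=> c x y; rewrite -[c]iqpi_reprK.
  rewrite -[x](@quotmod_reprK _ _ (Kosz K D)) -[y](@quotmod_reprK _ _ (Kosz K D)).
  set p := repr c; set u := quotmod_repr _; set v := quotmod_repr _.
  have -> : iqpi _ p *: (quotmod_pi (Kosz K D) u : Syz_Kosz K D) =
      quotmod_pi (Kosz K D) (p *: u) :> Syz_Kosz K D.
    by rewrite [LHS]oqscaleE linearZ.
  have -> : (quotmod_pi (Kosz K D) (p *: u) : Syz_Kosz K D) + quotmod_pi _ v =
      quotmod_pi (Kosz K D) (p *: u + v) :> Syz_Kosz K D by rewrite linearD.
  rewrite !fE; exact: eta_lin.
pose lin_f := GRing.isLinear.Build _ _ _ _ f f_lin.
by exists (HB.pack f lin_f : {linear Syz_Kosz K D -> (sr_ring K D)^o}) => z; apply: fE.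
Qed.

Lemma T2_vanishesP : T2_vanishes K D <->
  forall phi : {linear Syz_Kosz K D -> (sr_ring K D)^o},
    exists psi, phi = restr psi.
Proof.
set N := Submodule (restr_image_closed K D).
split=> [T0 phi | T0 t].
  have : quotmod_pi N phi = quotmod_pi N 0 by rewrite linear0; apply: T0.
  by move=> /quotmod_eqP; rewrite subr0 => /asboolP.
rewrite -[t](@quotmod_reprK _ _ N) -(linear0 (quotmod_pi N)).
by apply/quotmod_eqP; rewrite subr0; apply/asboolP; apply: T0.
Qed.
End Taylor.

(** * From cocycles to homomorphisms *)

Section CocycleHom.
Local Open Scope ring_scope.
Variables (K : fieldType) (n : nat) (D : scomplex n).
Local Notation S := {mpoly K[n]}.
Local Notation m := (ngens D).
Variables (a b : {set 'I_n}) (theta : {set 'I_n} -> {set 'I_n} -> K).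
Hypothesis ab : [disjoint a & b].
Hypothesis theta_cocycle : t2_cocycle D a b theta.
Implicit Types (F G h : {set 'I_n}) (e d : 'X_{1..n}) (i j : 'I_m) (u v : 'rV[S]_m).

(* The degree of the map is [a - b]: on a generator with [b] contained in [F], the
   exponent of [F] changes to [shift F]. *)
Definition shift F : 'X_{1..n} := (mesym1 a + mesym1 (F :\: b))%MM.

(** The intended coefficient of ['X_[e]] in the image of [v]. The formula makes sense on the whole
    free module, but the face at which [theta] is evaluated depends on [e], so compatibility with
    multiplication by monomials is special to syzygies. *)
Definition theta_coef v e : K :=
  \sum_i (if (b \subset gen_set i) && (shift (gen_set i) <= e)%MM
          then theta (msupport e :\: b) (gen_set i) * (v 0 i)@_(e - shift (gen_set i))
          else 0).

Definition theta_bound v : nat :=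
  (\sum_i (msize (v 0%R i) + mdeg (shift (gen_set i))))%N.

Definition theta_poly v : S :=
  \sum_(e : 'X_{1..n < theta_bound v}) theta_coef v e *: 'X_[e].

Lemma theta_polyE v e : (theta_poly v)@_e = theta_coef v e.
Proof.
apply: (@mcoeff_truncated _ _ (theta_coef v)) => {}e ge_e.
rewrite /theta_coef big1 // => i _; case: ifP => // /andP [_ le_e].
rewrite [X in _ * X](_ : _ = 0) ?mulr0 //; apply/eqP; rewrite mcoeff_eq0.
apply: msize_mdeg_ge; rewrite -(leq_add2r (mdeg (shift (gen_set i)))).
rewrite -mdegD submK //; apply: leq_trans ge_e.
by rewrite /theta_bound (bigD1 i) //= leq_addr.
Qed.

Lemma theta_coefD u v e : theta_coef (u + v) e = theta_coef u e + theta_coef v e.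
Proof.
rewrite /theta_coef -big_split /=; apply: eq_bigr => i _.
by case: ifP => _; rewrite ?addr0 // mxE mcoeffD mulrDr.
Qed.

Lemma theta_coefB u v e : theta_coef (u - v) e = theta_coef u e - theta_coef v e.
Proof. by apply/eqP; rewrite eq_sym subr_eq -theta_coefD subrK. Qed.

Lemma theta_coef0 e : theta_coef 0 e = 0.
Proof. by rewrite /theta_coef big1 // => i _; rewrite mxE mcoeff0 mulr0 if_same. Qed.

Lemma theta_coefZK (c : K) d v e :
  theta_coef ((c *: 'X_[d]) *: v) e = c * theta_coef ('X_[d] *: v) e.
Proof.
rewrite /theta_coef mulr_sumr; apply: eq_bigr => i _.
case: ifP => _; last by rewrite mulr0.
by rewrite !mxE -scalerAl mcoeffZ mulrCA.
Qed.

Lemma theta_coef_ideal (p : S) v e : face_monom D e ->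
  p \in submem (sr_ideal K D) -> theta_coef (p *: v) e = 0.
Proof.
move=> De pI; rewrite /theta_coef big1 // => i _; case: ifP => // _.
have pvI : p * v 0 i \in submem (sr_ideal K D).
  by rewrite mulrC; apply: (rpredZ (v 0 i)).
rewrite mxE (sr_idealE D _ pvI) ?mulr0 //; apply: faces_sub De.
by apply/subsetP => k; rewrite !inE mnmBE; apply: contraNN => /eqP ->.
Qed.

(** Multiplying by ['X_[d]] may enlarge the face at which [theta] is evaluated. The cocycle
    condition then shifts all values by one constant, and this constant multiplies a coefficient of
    [dgen v], which is 0. *)
Lemma theta_coef_syz v d e : dgen v = 0 -> face_monom D e ->
  theta_coef ('X_[d] *: v) e = if (d <= e)%MM then theta_coef v (e - d) else 0.
Proof.
move=> dv0 De; rewrite /theta_coef; case: ifP => le_de; last first.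
  apply: big1 => i _; case: ifP => // /andP [_ le_e]; rewrite mxE mcoeff_mulX.
  case: ifP => [le_d|]; last by rewrite mulr0.
  by rewrite (lepm_trans le_d (lem_subr _ _)) in le_de.
set e' := (e - d)%MM; have eE : e = (e' + d)%MM by rewrite /e' submK.
clearbody e'.
pose h' := msupport e :\: b; pose h := msupport e' :\: b.
(* If [a] does not divide the target exponent, no generator contributes to either side. *)
have [ae'|nae'] := boolP (mesym1 a <= e')%MM; last first.
  rewrite !big1 // => i _; case: ifP => // /andP [_ le_e].
    by rewrite (lepm_trans (lem_addr _ _) le_e) in nae'.
  rewrite mxE mcoeff_mulX; case: ifP => [le_d|]; last by rewrite mulr0.
  case/negP: nae'; apply/mnm_lepP => k.
  move/mnm_lepP/(_ k): le_d; move/mnm_lepP/(_ k): le_e.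
  by rewrite eE /shift !mnmBE !mnmDE; lia.
have [_ /(_ h h')] := theta_cocycle.
have -> : a \subset h.
  rewrite subsetD ab andbT; move: ae'; by rewrite lem_mesym1.
have -> : h \subset h'.
  by apply: setSD; rewrite eE msupportD subsetUl.
have -> : h' \in faces D by apply: faces_sub De; apply: subsetDl.
have -> : [disjoint h' & b] by rewrite disjoints_subset; apply: subsetDr.
move=> /(_ isT isT isT isT) [c hc].
(* The multidegree that a map of degree a - b sends to [e']: the entries of [v] in play are those
   contributing to [dgen v] at [e2]. *)
pose e2 := (e' - mesym1 a + mesym1 b)%MM.
have shiftE (i : 'I_m) : b \subset gen_set i ->
    (shift (gen_set i) <= e')%MM = (mesym1 (gen_set i) <= e2)%MM /\
    (e' - shift (gen_set i))%MM = (e2 - mesym1 (gen_set i))%MM.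
  move=> bi;
    have key k : (shift (gen_set i) k + mesym1 b k = mesym1 (gen_set i) k + mesym1 a k)%N.
    rewrite mnmDE !mesym1E inE; move/subsetP/(_ k): bi.
    by case: (k \in b) => [/(_ isT) ->|_]; rewrite ?addn0 //= addnC.
  have {}ae' k : (mesym1 a k <= e' k)%N by move/mnm_lepP: ae'.
  split; last first.
    by apply/mnmP => k; move: (key k) (ae' k); rewrite /e2 !mnmE; lia.
  apply/mnm_lepP/mnm_lepP => le_i k; move: (key k) (ae' k) (le_i k).
    by rewrite /e2 mnmDE mnmBE; lia.
  by rewrite /e2 mnmDE mnmBE; lia.
have e2h : msupport e2 \subset h :|: b.
  rewrite /e2 msupportD msupport_mesym1 setUC subUset subsetUr /=.
  apply/subsetP => k; rewrite !inE mnmBE; lia.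
transitivity (theta_coef v e' + c * (dgen v)@_e2); last by rewrite dv0 mcoeff0 mulr0 addr0.
rewrite dgen_coef mulr_sumr -big_split /=; apply: eq_bigr => i _.
have hi := hc _ (gen_set_min i).
have [bi|nbi] /= := boolP (b \subset gen_set i); last first.
  case: ifP => [le_i|]; last by rewrite mulr0 add0r.
  (* A generator that divides ['X_[e2]] and misses part of [b] has value 0 over both faces, which
     pins the constant. *)
  have ->: c = 0.
    have [th0 _] := theta_cocycle.
    have := hi (subset_trans _ e2h); rewrite -lem_mesym1 => /(_ le_i).
    by rewrite !th0 // add0r.
  by rewrite mul0r add0r.
have [-> ->] := shiftE i bi.
rewrite mxE mcoeff_mulX.
have [le_i|nle_i] := boolP (_ <= e2)%MM; last first.
  rewrite mulr0 addr0; case: ifP => // le_e; case: ifP => [le_d|]; last by rewrite mulr0.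
  case/negP: nle_i; rewrite -(shiftE i bi).1.
  apply/mnm_lepP => k; move/mnm_lepP/(_ k): le_d; move/mnm_lepP/(_ k): le_e.
  by rewrite eE !mnmBE !mnmDE; lia.
have le_s : (shift (gen_set i) <= e')%MM by rewrite (shiftE i bi).1.
have -> : (shift (gen_set i) <= e)%MM by rewrite (lepm_trans le_s) // eE lem_addr.
have -> : (e - shift (gen_set i) - d)%MM = (e2 - mesym1 (gen_set i))%MM.
  by rewrite -(shiftE i bi).2 eE; apply/mnmP => k; rewrite !mnmBE mnmDE; lia.
have -> : (d <= e - shift (gen_set i))%MM.
  by apply/mnm_lepP => k; move/mnm_lepP/(_ k): le_s; rewrite eE mnmBE mnmDE; lia.
rewrite -/h' -/h hi ?mulrDl //; apply: subset_trans e2h.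
by rewrite -lem_mesym1.
Qed.

Lemma theta_coef_syzZ (p : S) v e : dgen v = 0 -> face_monom D e ->
  theta_coef (p *: v) e = (p * theta_poly v)@_e.
Proof.
move=> dv0 De; rewrite {1}[p]mpolyE scaler_suml mpolyM_expand raddf_sum /=.
rewrite (big_morph (theta_coef ^~ e) (fun u v => theta_coefD u v e) (theta_coef0 e)).
apply: eq_bigr => d _; rewrite theta_coefZK mcoeffZ theta_coef_syz //.
by rewrite mcoeff_mulX theta_polyE.
Qed.

Definition theta_hom (z : submod (Syz K D)) : sr_mod K D :=
  sr_pi D (theta_poly (\val z)).

Lemma theta_hom_linear : linear theta_hom.
Proof.
move=> c u v.
transitivity (sr_pi D (c * theta_poly (\val u) + theta_poly (\val v)) : sr_mod K D).
  apply/sr_pi_eqP => e De; rewrite theta_polyE mcoeffD theta_polyE.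
  have -> : \val (c *: u + v) = c *: \val u + \val v by [].
  rewrite theta_coefD theta_coef_syzZ //.
  by apply/eqP; exact: (valP u).
by rewrite /sr_pi iqpiD iqpiM.
Qed.

Lemma theta_hom_Kosz z : z \in submem (Kosz K D) -> theta_hom z = 0.
Proof.
pose th : {linear submod (Syz K D) -> sr_mod K D} :=
  HB.pack theta_hom (GRing.isLinear.Build _ _ _ _ theta_hom theta_hom_linear).
move=> /asboolP [k [c [u [Pu ->]]]]; rewrite -[LHS]/(th _) linear_sum big1 // => i _.
rewrite linearZ /= [X in _ *: X](_ : _ = 0) ?scaler0 //.
have [f [g fg]] := Pu i; apply/sr_pi_eq0/sr_idealE => e De.
rewrite theta_polyE fg -scalerN theta_coefD.
by rewrite !theta_coef_ideal ?addr0 //; apply: dgen_sr_ideal.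
Qed.

(** The homomorphism and its extension are compared on the Taylor syzygy of [F] and [G] in
    multidegree [h :|: b], at the exponent h + a, whose support is [h]. The extension contributes
    its coefficients at [shift F] and [shift G]. *)
Lemma theta_coboundary : T2_vanishes K D -> t2_coboundary D a b theta.
Proof.
move=> /T2_vanishesP T0.
have [phi phiE] := Syz_hom_descends theta_hom_linear theta_hom_Kosz.
have [psi phi_psi] := T0 phi.
pose idx F : option 'I_m := [pick i | gen_set i == F].
exists (fun F => if b \subset F then
  if idx F is Some i then sr_coef (psi (delta_mx 0 i)) (shift F) else 0 else 0).
split=> [F /negPf ->//|h ah hD hb F G Fm Gm Fh Gh].
have idxE H : H \in min_nonfaces D -> exists2 i, idx H = Some i & gen_set i = H.
  move=> /gen_setP [i iH]; rewrite /idx; case: pickP => [j /eqP jH|/(_ i)].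
    by exists j.
  by rewrite iH eqxx.
have [i -> iF] := idxE F Fm; have [j -> jG] := idxE G Gm.
subst F G; pose e := mesym1 (h :|: b); pose e' := (mesym1 h + mesym1 a)%MM.
have e'D : face_monom D e'.
  by rewrite /face_monom msupportD !msupport_mesym1 (setUidPl ah).
have ltK (k : 'I_m) : gen_set k \subset h :|: b -> (mesym1 (gen_set k) <= e)%MM.
  by rewrite lem_mesym1 msupport_mesym1.
pose z : submod (Syz K D) := Submod (taylor_syz K (ltK i Fh) (ltK j Gh)).
have /(congr1 (fun x : sr_mod K D => sr_coef x e')) : theta_hom z = psi (\val z).
  by rewrite -phiE phi_psi /= restr_funE.
rewrite sr_coef_pi // theta_polyE [\val z]/= /taylor.
have e'b : msupport e' :\: b = h.
  rewrite msupportD !msupport_mesym1 (setUidPl ah).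
  by apply/setDidPl.
have hbk k : (k \in h) && (k \in b) = false.
  by have := disjointFr hb => /(_ k); case: (k \in h) => // ->.
have abk k : (k \in a) && (k \in b) = false.
  by have := disjointFr ab => /(_ k); case: (k \in a) => // ->.
have le_cond (k : 'I_m) : gen_set k \subset h :|: b ->
    (e - mesym1 (gen_set k) <= e')%MM = (b \subset gen_set k) /\
    (b \subset gen_set k -> (shift (gen_set k) <= e')%MM /\
    (e' - (e - mesym1 (gen_set k)) = shift (gen_set k))%MM /\
    (e' - shift (gen_set k) = e - mesym1 (gen_set k))%MM).
  move=> sub; split.
    apply/mnm_lepP/subsetP => [le x xb|bk x].
      move: (le x); rewrite /e /e' mnmBE mnmDE !mesym1E inE xb orbT.
      move: (hbk x) (abk x); rewrite xb !andbT => -> ->.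
      by case: (x \in gen_set k).
    rewrite /e /e' mnmBE mnmDE !mesym1E inE; move: (bk x).
    case: (x \in b) => [/(_ isT) ->|_]; first by rewrite orbT.
    by rewrite orbF; case: (x \in h); case: (x \in a); case: (x \in gen_set k).
  move=> /subsetP bk; move/subsetP: sub => sub.
  have key x : [/\ e x = (x \in h) || (x \in b), e' x = (x \in h) + (x \in a),
      shift (gen_set k) x = (x \in a) + ((x \in gen_set k) && ~~ (x \in b))
      & mesym1 (gen_set k) x = (x \in gen_set k)]%N.
    by rewrite /e /e' /shift !mnmDE !mesym1E !inE; split=> //; rewrite andbC.
  have bk' x : (x \in b) ==> (x \in gen_set k) by apply/implyP/bk.
  have sub' x : (x \in gen_set k) ==> (x \in h) || (x \in b).
    by apply/implyP => /sub; rewrite inE.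
  split; [apply/mnm_lepP => x|split; apply/mnmP => x; rewrite !mnmBE];
  have [E1 E2 E3 E4] := key x; rewrite ?E1 ?E2 ?E3 ?E4; move: (bk' x) (sub' x) (hbk x) (abk x);
  by case: (x \in h); case: (x \in b); case: (x \in a); case: (x \in gen_set k).
have thE (k : 'I_m) : gen_set k \subset h :|: b ->
    theta_coef ('X_[e - mesym1 (gen_set k)] *: delta_mx 0 k) e' =
    theta h (gen_set k).
  move=> sub; have [th0 _] := theta_cocycle.
  rewrite /theta_coef (bigD1 k) //= big1 ?addr0 => [|l lk]; last first.
    by case: ifP => // _; rewrite !mxE (negPf lk) mulr0 mcoeff0 mulr0.
  have [_] := le_cond k sub.
  have [bk /(_ isT) [-> [_ ->]]|nbk _] := boolP (b \subset _); last by rewrite /= th0.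
  by rewrite /= !mxE !eqxx mulr1 mcoeffX eqxx mulr1 e'b.
have psiE : forall l : 'I_m, gen_set l \subset h :|: b ->
    sr_coef (psi ('X_[e - mesym1 (gen_set l)] *: delta_mx 0 l)) e' =
    if b \subset gen_set l then sr_coef (psi (delta_mx 0 l)) (shift (gen_set l)) else 0.
  move=> l sub; rewrite linearZ sr_coefZX //.
  by have [-> ] := le_cond l sub; case: ifP => // _ /(_ isT) [_ [-> _]].
by rewrite theta_coefB !thE // (linearB psi) sr_coefB // !psiE.
Qed.

End CocycleHom.

(** * From homomorphisms to cocycles *)

Section TaylorCalculus.
Local Open Scope ring_scope.
Variables (K : fieldType) (n : nat) (D : scomplex n).
Local Notation S := {mpoly K[n]}.
Local Notation m := (ngens D).
Implicit Types (F G h : {set 'I_n}) (e d : 'X_{1..n}) (i j k : 'I_m) (u v : 'rV[S]_m).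
Local Notation s i := (mesym1 (gen_set i)).

Lemma taylor_add e i j k : taylor K e i j + taylor K e j k = taylor K e i k.
Proof. by rewrite /taylor addrA subrK. Qed.

Lemma taylorD e d i j : (s i <= e)%MM -> (s j <= e)%MM ->
  taylor K (e + d) i j = 'X_[d] *: taylor K e i j.
Proof.
move=> le_i le_j; rewrite /taylor scalerBr !scalerA -!mpolyXD.
by congr ('X_[_] *: _ - 'X_[_] *: _); rewrite addmC addmBA.
Qed.

Lemma taylor_koszul i j : taylor K (s i + s j) i j =
  dgen (delta_mx 0 j) *: delta_mx 0 i - dgen (delta_mx 0 i) *: delta_mx 0 j.
Proof.
rewrite /taylor !dgen_delta !genE; congr ('X_[_] *: _ - 'X_[_] *: _).
  by rewrite addmC addmK.
by rewrite addmK.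
Qed.

(* Syz(I) is graded by Z^n, and in each multidegree its elements are
   K-combinations of multiples of the Taylor syzygies. *)
Lemma syz_ind (P : 'rV[S]_m -> Prop) :
  P 0 -> (forall u v, P u -> P v -> P (u + v)) ->
  (forall (p : S) i j, P (p *: taylor K (mesym1 (gen_set i :|: gen_set j)) i j)) ->
  forall v, dgen v = 0 -> P v.
Proof.
move=> P0 PD PT v dv0.
(* The coefficient of ['X_[c]] in [v 0 i * gen i], so that [w c] is the part of [v] in multidegree
   [c]. *)
pose coef c i : K := if (s i <= c)%MM then (v 0%R i)@_(c - s i) else 0.
pose w c := \sum_i (coef c i *: 'X_[c - s i] : S) *: delta_mx 0 i : 'rV[S]_m.
pose N := (\sum_i (msize (v 0%R i) + mdeg (s i)))%N.
have coef0 c i : (N <= mdeg c)%N -> coef c i = 0.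
  move=> Nc; rewrite /coef; case: ifP => // le_i.
  apply/eqP; rewrite mcoeff_eq0; apply: msize_mdeg_ge.
  rewrite -(leq_add2r (mdeg (s i))) -mdegD submK //.
  by apply: leq_trans Nc; rewrite /N (bigD1 i) //= leq_addr.
have -> : v = \sum_(c : 'X_{1..n < N}) w c.
  apply/rowP => i; rewrite summxE; apply/mpolyP => d.
  have wE c : w c 0 i = coef c i *: 'X_[c - s i].
    rewrite summxE (bigD1 i) //= big1 => [|j ji]; last first.
      by rewrite !mxE eq_sym (negPf ji) andbF mulr0.
    by rewrite !mxE !eqxx mulr1 addr0.
  rewrite raddf_sum /=.
  have coefE c : (w c 0 i)@_d = (d + s i == c)%MM%:R * (v 0 i)@_d.
    rewrite wE mcoeffZ mcoeffX /coef.
    have [<-|ne] := eqVneq (d + s i)%MM c.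
      by rewrite lem_addl addmK eqxx mulr1 mul1r.
    rewrite mul0r; case: ifP => [le|]; last by rewrite mul0r.
    by case: eqP => [E|]; [move: ne; rewrite -E submK // eqxx | rewrite mulr0].
  have [lt|ge] := ltnP (mdeg (d + s i)) N; last first.
    rewrite [LHS](_ : _ = coef (d + s i)%MM i); last by rewrite /coef lem_addl addmK.
    rewrite coef0 // big1 // => -[c /= lt_c] _; rewrite coefE; case: eqP => [E|].
      by move: lt_c; rewrite -E ltnNge ge.
    by rewrite mul0r.
  rewrite (bigD1 (BMultinom lt)) //= coefE eqxx mul1r big1 ?addr0 // => c.
  by rewrite eq_sym -val_eqE /= coefE => /negPf ->; rewrite mul0r.
apply: (big_ind P) => // -[c /= _] _.
have sum0 : \sum_i coef c i = 0.
  by have := dgen_coef v c; rewrite dv0 mcoeff0 => /esym.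
have [i0 le0|none] := pickP (fun i => s i <= c)%MM; last first.
  rewrite /w big1 // => i _; rewrite /coef none scale0r.
  by rewrite scale0r.
(* The coefficients in one multidegree add up to 0. Subtracting their total at the fixed position
   [i0] changes nothing and turns every term into a multiple of a Taylor syzygy. *)
have -> : w c = \sum_i (coef c i *: 'X_[c - mesym1 (gen_set i :|: gen_set i0)]) *:
    taylor K (mesym1 (gen_set i :|: gen_set i0)) i i0.
  transitivity (w c - \sum_i (coef c i *: 'X_[c - s i0] : S) *: delta_mx 0 i0).
    rewrite [X in _ - X](_ : _ = 0) ?subr0 // -scaler_suml.
    by rewrite -[X in X *: _]scaler_suml sum0 !scale0r.
  rewrite -sumrB; apply: eq_bigr => i _.
  have [le_i|nle] := boolP (s i <= c)%MM; last first.
    by rewrite /coef (negPf nle) !scale0r subrr.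
  have le_u : (mesym1 (gen_set i :|: gen_set i0) <= c)%MM.
    by move: le_i le0; rewrite !lem_mesym1 subUset => -> ->.
  have le_l : (s i <= mesym1 (gen_set i :|: gen_set i0))%MM.
    by rewrite lem_mesym1 msupport_mesym1 subsetUl.
  have le_r : (s i0 <= mesym1 (gen_set i :|: gen_set i0))%MM.
    by rewrite lem_mesym1 msupport_mesym1 subsetUr.
  rewrite /taylor scalerBr !scalerA -!scalerAl -!mpolyXD.
  by congr ((_ *: 'X_[_]) *: _ - (_ *: 'X_[_]) *: _); rewrite addmBA // submK.
by apply: (big_ind P) => // i _; apply: PT.
Qed.
End TaylorCalculus.

(** * The cocycle of a homomorphism in each degree, and its extension to S^m *)

Section HomCocycle.
Local Open Scope ring_scope.
Variables (K : fieldType) (n : nat) (D : scomplex n).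
Local Notation S := {mpoly K[n]}.
Local Notation m := (ngens D).
Implicit Types (F G h b : {set 'I_n}) (e d A : 'X_{1..n}) (i j k : 'I_m) (u v : 'rV[S]_m).
Local Notation s i := (mesym1 (gen_set i)).

Variable L : 'rV[S]_m -> sr_mod K D.
Hypothesis LD : forall u v, dgen u = 0 -> dgen v = 0 -> L (u + v) = L u + L v.
Hypothesis LZ : forall p v, dgen v = 0 -> L (p *: v) = p *: L v.
Hypothesis L_Kosz : forall f g, L (dgen f *: g - dgen g *: f) = 0.

(** For [h] disjoint from [b], the exponent A + h differs from the multidegree [h :|: b] by A - b.
    So for varying [h] these are coefficients of one homogeneous component of [L]. *)
Definition syz_coef A b h i j : K :=
  sr_coef (L (taylor K (mesym1 (h :|: b)) i j)) (A + mesym1 h)%MM.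

Definition admissible A b h :=
  [/\ msupport A \subset h, h \in faces D & [disjoint h & b]].

Lemma taylor_dgen e i j : (s i <= e)%MM -> (s j <= e)%MM ->
  dgen (taylor K e i j) = 0.
Proof. by move=> le_i le_j; apply/eqP; exact: (taylor_syz K le_i le_j). Qed.

Lemma gen_le_mesym1 F i : (s i <= mesym1 F)%MM = (gen_set i \subset F).
Proof. by rewrite lem_mesym1 msupport_mesym1. Qed.

Lemma admissible_face A b h : admissible A b h -> face_monom D (A + mesym1 h)%MM.
Proof.
by case=> Ah hD _; rewrite /face_monom msupportD msupport_mesym1 (setUidPr Ah).
Qed.

Lemma syz_coef_add A b h i j k : admissible A b h -> gen_set i \subset h :|: b ->
  gen_set j \subset h :|: b -> gen_set k \subset h :|: b ->
  syz_coef A b h i k = syz_coef A b h i j + syz_coef A b h j k.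
Proof.
move=> adm; rewrite -!gen_le_mesym1 => le_i le_j le_k.
have -> : syz_coef A b h i j = syz_coef A b h i k - syz_coef A b h j k; last by rewrite subrK.
rewrite /syz_coef -sr_coefB; last exact: admissible_face adm.
rewrite -(taylor_add K _ i j k) LD ?addrK //; exact: taylor_dgen.
Qed.

(** Passing from [h] to [h'] multiplies the Taylor syzygy and the exponent by the same monomial. *)
Lemma syz_coef_mono A b h h' i j : admissible A b h -> admissible A b h' ->
  h \subset h' -> gen_set i \subset h :|: b -> gen_set j \subset h :|: b ->
  syz_coef A b h' i j = syz_coef A b h i j.
Proof.
move=> adm adm' hh'; rewrite -!gen_le_mesym1 => le_i le_j.
have [_ _ h'b] := adm'.
have hb x : (x \in h') && (x \in b) = false.
  by case: (boolP (x \in h')) => // /(disjointFr h'b).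
have hh x : (x \in h) ==> (x \in h') by apply/implyP/(subsetP hh').
rewrite /syz_coef (_ : mesym1 (h' :|: b) = mesym1 (h :|: b) + mesym1 (h' :\: h))%MM; last first.
  apply/mnmP => x; rewrite mnmDE !mesym1E !inE; move: (hb x) (hh x).
  by case: (x \in h); case: (x \in h'); case: (x \in b).
rewrite taylorD // LZ; last exact: taylor_dgen.
rewrite sr_coefZX; last exact: admissible_face adm'.
have -> : (A + mesym1 h' = A + mesym1 h + mesym1 (h' :\: h))%MM.
  apply/mnmP => x; rewrite !mnmDE !mesym1E !inE; move: (hh x).
  by case: (x \in h); case: (x \in h') => //= _; rewrite ?addn0.
by rewrite lem_addl addmK.
Qed.

(** The Taylor syzygy is a multiple of the variable [x], which does not occur in the exponent where
    the coefficient is read. *)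
Lemma syz_coef_degree A b h i j x : admissible A b h -> gen_set i \subset h :|: b ->
  gen_set j \subset h :|: b -> x \in b -> x \notin gen_set i ->
  x \notin gen_set j -> syz_coef A b h i j = 0.
Proof.
move=> adm hi hj xb xi xj; have [Ah hD hb] := adm.
rewrite /syz_coef (_ : mesym1 (h :|: b) = mesym1 ((h :|: b) :\ x) + U_(x))%MM; last first.
  apply/mnmP => y; rewrite mnmDE mnm1E !mesym1E !inE.
  by have [<-|_] := eqVneq x y; rewrite ?xb ?orbT /= ?addn0.
have le_i : (s i <= mesym1 ((h :|: b) :\ x))%MM by rewrite gen_le_mesym1 subsetD1 hi.
have le_j : (s j <= mesym1 ((h :|: b) :\ x))%MM by rewrite gen_le_mesym1 subsetD1 hj.
rewrite taylorD // LZ; last exact: taylor_dgen.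
rewrite sr_coefZX; last exact: admissible_face adm.
have xh : x \notin h by rewrite (disjointFl hb).
case: ifP => // /mnm_lepP /(_ x); rewrite mnm1E eqxx mnmDE mesym1E (negPf xh) addn0.
move=> Ax; case/negP: xh; apply: (subsetP Ah).
by rewrite inE -lt0n.
Qed.

(* If [h] together with all of [b] except [x] and [y] is a face, a multiple of the
   Taylor syzygy is a Koszul relation; otherwise it is a nonface, and a generator
   inside it links [i] to [j] through the degree argument. *)
Lemma syz_coef_vanish A b h i j : admissible A b h -> gen_set i \subset h :|: b ->
  gen_set j \subset h :|: b -> ~~ (b \subset gen_set i) ->
  ~~ (b \subset gen_set j) -> syz_coef A b h i j = 0.
Proof.
move=> adm hi hj /subsetPn [x xb xi] /subsetPn [y yb yj]; have [Ah hD hb] := adm.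
pose h' := h :|: b :\: [set x; y].
have [h'D|h'D] := boolP (h' \in faces D); last first.
  have [|G /gen_setP [k <-] kh'] := @min_nonface_sub _ D h'; first by rewrite inE.
  have kh : gen_set k \subset h :|: b.
    by apply: subset_trans kh' _; apply: setUS; apply: subsetDl.
  have nk z : z \in b -> z \in [set x; y] -> z \notin gen_set k.
    move=> zb zxy; apply/negP => /(subsetP kh').
    by rewrite in_setU in_setD zxy orbF => /(disjointFr hb); rewrite zb.
  rewrite (syz_coef_add adm hi kh hj) (syz_coef_degree adm hi kh xb) ?nk ?inE ?eqxx //.
  by rewrite (syz_coef_degree adm kh hj yb) ?nk ?inE ?eqxx ?orbT ?addr0.
have le_i : (s i <= mesym1 (h :|: b))%MM by rewrite gen_le_mesym1.
have le_j : (s j <= mesym1 (h :|: b))%MM by rewrite gen_le_mesym1.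
have face' : face_monom D (A + mesym1 h + mesym1 h')%MM.
  by rewrite /face_monom !msupportD !msupport_mesym1 (setUidPr Ah) setUA setUid.
have -> : syz_coef A b h i j =
    sr_coef (L (taylor K (mesym1 (h :|: b) + mesym1 h') i j)) (A + mesym1 h + mesym1 h')%MM.
  rewrite taylorD // LZ; last exact: taylor_dgen.
  by rewrite sr_coefZX // lem_addl addmK.
(* A point of both generators needs exponent two. It is neither [x] nor [y], hence lies in [h'] as
   well. *)
have le_ij : (s i + s j <= mesym1 (h :|: b) + mesym1 h')%MM.
  apply/mnm_lepP => z; rewrite !mnmDE !mesym1E !inE.
  have := subsetP hi z; have := subsetP hj z; rewrite !inE.
  have [->|zx] := eqVneq z x; first by rewrite (negPf xi) xb !orbT; case: (x \in gen_set j).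
  have [->|zy] := eqVneq z y; first by rewrite (negPf yj) yb !orbT addn0;
    case: (y \in gen_set i).
  rewrite /=; case: (z \in gen_set i); case: (z \in gen_set j) => //=;
  by [move=> _ /(_ isT) -> | move=> /(_ isT) ->].
rewrite -(submK le_ij) addmC taylorD ?lem_addl ?lem_addr // LZ; last first.
  by apply: taylor_dgen; rewrite ?lem_addl ?lem_addr.
rewrite taylor_koszul L_Kosz scaler0.
have -> : (0 : sr_mod K D) = sr_pi D 0 by rewrite /sr_pi /iqpi raddf0.
by rewrite sr_coef_pi // mcoeff0.
Qed.

Definition gen_idx F : option 'I_m := [pick i | gen_set i == F].

Lemma gen_idxE i : gen_idx (gen_set i) = Some i.
Proof.
rewrite /gen_idx; case: pickP => [j /eqP /enum_val_inj -> //|/(_ i)].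
by rewrite eqxx.
Qed.

(** The reference generator for [coef_theta]. One that does not contain [b] is preferred:
    [syz_coef_vanish] then gives 0 on all generators of this kind, the normalisation demanded of a
    cocycle. *)
Definition base_gen b h : option 'I_m :=
  if [pick i | (gen_set i \subset h :|: b) && ~~ (b \subset gen_set i)] is Some i
  then Some i else [pick i | gen_set i \subset h :|: b].

Variant base_gen_spec b h : option 'I_m -> Prop :=
| BaseGen k of gen_set k \subset h :|: b
    & (forall i, gen_set i \subset h :|: b -> ~~ (b \subset gen_set i) ->
       ~~ (b \subset gen_set k)) : base_gen_spec b h (Some k)
| NoBaseGen of (forall i, (gen_set i \subset h :|: b) = false) : base_gen_spec b h None.

Lemma base_genP b h : base_gen_spec b h (base_gen b h).
Proof.
rewrite /base_gen; case: pickP => [k /andP [kh bk]|none]; first exact: BaseGen.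
case: pickP => [k kh|none']; last exact: NoBaseGen.
by apply: BaseGen => // i ih bi; have := none i; rewrite ih bi.
Qed.

Definition coef_theta A b h F : K :=
  if b \subset F then
    if gen_idx F is Some i then
      if base_gen b h is Some k then syz_coef A b h i k else 0
    else 0
  else 0.

Lemma coef_thetaE A b h i k : admissible A b h -> gen_set i \subset h :|: b ->
  base_gen b h = Some k -> coef_theta A b h (gen_set i) = syz_coef A b h i k.
Proof.
move=> adm ih; rewrite /coef_theta gen_idxE; case: base_genP => // {}k kh bk [<-].
by case: ifP => // /negbT bi; rewrite syz_coef_vanish // (bk i).
Qed.

Lemma coef_theta_cocycle A b : [disjoint msupport A & b] ->
  t2_cocycle D (msupport A) b (coef_theta A b).
Proof.
move=> Ab; split=> [h F /negPf bF|h h' Ah hh' h'D h'b].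
  by rewrite /coef_theta bF.
have adm' : admissible A b h' by split=> //; apply: subset_trans hh'.
have adm : admissible A b h.
  split=> //; [exact: faces_sub hh' h'D|exact: disjointWl h'b].
have sub_b F : F \subset h :|: b -> F \subset h' :|: b.
  by move=> Fh; apply: subset_trans Fh _; apply: setSU.
case Ek: (base_gen b h) / (base_genP b h) => [k kh _|none]; last first.
  by exists 0 => F /gen_setP [i <-]; rewrite none.
case Ek': (base_gen b h') / (base_genP b h') => [k' kh' _|none]; last first.
  by have := none k; rewrite sub_b.
(* The constant is the change of reference generator from [k] to [k']. *)
exists (syz_coef A b h' k k') => F /gen_setP [i <-] ih.
rewrite (coef_thetaE adm ih Ek) (coef_thetaE adm' (sub_b _ ih) Ek').
rewrite (syz_coef_add adm' (sub_b _ ih) (sub_b _ kh) kh').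
by rewrite (syz_coef_mono adm adm' hh' ih kh).
Qed.

Lemma coef_theta_diff A b h i j : admissible A b h ->
  gen_set i \subset h :|: b -> gen_set j \subset h :|: b ->
  coef_theta A b h (gen_set i) - coef_theta A b h (gen_set j) = syz_coef A b h i j.
Proof.
move=> adm ih jh.
case Ek: (base_gen b h) / (base_genP b h) => [k kh _|none]; last by rewrite none in ih.
rewrite (coef_thetaE adm ih Ek) (coef_thetaE adm jh Ek).
by rewrite (syz_coef_add adm ih jh kh) addrK.
Qed.

Definition taylor_msize h b i j : nat :=
  msize (repr (L (taylor K (mesym1 (h :|: b)) i j) : sr_ring K D)).

(** A crude bound that is uniform in [A]: finitely many Taylor syzygies in multidegrees [h :|: b]
    serve all degrees A - b at once. *)
Definition syz_coef_bound : nat := (\sum_h \sum_b \sum_i \sum_j taylor_msize h b i j)%N.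

Lemma taylor_msize_bound h b i j : (taylor_msize h b i j <= syz_coef_bound)%N.
Proof.
have le_sum (T : finType) (F : T -> nat) x : (F x <= \sum_y F y)%N.
  by rewrite (bigD1 x) //= leq_addr.
apply: leq_trans (le_sum _ (taylor_msize h b i) j) _.
apply: leq_trans (le_sum _ (fun i => \sum_j taylor_msize h b i j)%N i) _.
apply: leq_trans (le_sum _ (fun b => \sum_i \sum_j taylor_msize h b i j)%N b) _.
exact: (le_sum _ (fun h => \sum_b \sum_i \sum_j taylor_msize h b i j)%N h).
Qed.

Lemma syz_coef_large A b h i j : (syz_coef_bound <= mdeg A)%N -> syz_coef A b h i j = 0.
Proof.
move=> leA; apply/eqP; rewrite /syz_coef /sr_coef mcoeff_eq0; apply: msize_mdeg_ge.
rewrite mdegD; apply: leq_trans (leq_addr _ _); apply: leq_trans leA.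
exact: taylor_msize_bound.
Qed.

Hypothesis coboundaries : forall (a b : {set 'I_n})
    (theta : {set 'I_n} -> {set 'I_n} -> K), [disjoint a & b] ->
  t2_cocycle D a b theta -> t2_coboundary D a b theta.

(** Each degree gets its own potential from the coboundary hypothesis. Choosing 0 in all large
    degrees is what later allows the potentials to be assembled into polynomials. *)
Lemma syz_coef_potential : exists Psi : 'X_{1..n} * {set 'I_n} -> {set 'I_n} -> K,
  [/\ forall A b F, ~~ (b \subset F) -> Psi (A, b) F = 0,
      forall A b F, (syz_coef_bound <= mdeg A)%N -> Psi (A, b) F = 0
    & forall A b h i j, [disjoint msupport A & b] -> admissible A b h ->
      gen_set i \subset h :|: b -> gen_set j \subset h :|: b ->
      syz_coef A b h i j = Psi (A, b) (gen_set i) - Psi (A, b) (gen_set j)].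
Proof.
suff /choice [Psi PsiP] : forall Ab : 'X_{1..n} * {set 'I_n},
    exists psi : {set 'I_n} -> K,
    [/\ forall F, ~~ (Ab.2 \subset F) -> psi F = 0,
      forall F, (syz_coef_bound <= mdeg Ab.1)%N -> psi F = 0
    & forall h i j, [disjoint msupport Ab.1 & Ab.2] -> admissible Ab.1 Ab.2 h ->
      gen_set i \subset h :|: Ab.2 -> gen_set j \subset h :|: Ab.2 ->
      syz_coef Ab.1 Ab.2 h i j = psi (gen_set i) - psi (gen_set j)].
  exists Psi; split=> A b; have [H1 H2 H3] := PsiP (A, b);
    [exact: H1 | exact: H2 | exact: H3].
case=> A b /=.
have [large|small] := leqP syz_coef_bound (mdeg A).
  by exists (fun=> 0); split=> // h i j _ _ _ _; rewrite syz_coef_large // subrr.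
have [Ab|nAb] := boolP [disjoint msupport A & b]; last by exists (fun=> 0); split.
have [psi [psi0 psiP]] := coboundaries Ab (coef_theta_cocycle Ab).
exists psi; split=> // h i j _ adm ih jh.
rewrite -coef_theta_diff //; have [Ah hD hb] := adm.
by apply: psiP => //; apply: gen_set_min.
Qed.

Theorem Syz_hom_extends : exists psi : {linear 'rV[S]_m -> sr_mod K D},
  forall v, dgen v = 0 -> L v = psi v.
Proof.
have [Psi [Psi0 PsiN PsiP]] := syz_coef_potential.
(* The summand [n] is there because dividing by a squarefree generator lowers the degree by at most
   [n]. *)
pose N := (syz_coef_bound + n)%N.
(* A map taking generator [i] to a multiple of ['X_[e]] has degree e - s i; the pair consists of the
   positive and the negative part of this degree. *)
pose E i e := Psi ((e - s i)%MM, gen_set i :\: msupport e) (gen_set i).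
pose q i : S := \sum_(e : 'X_{1..n < N}) E i e *: 'X_[e].
have qE i e : (q i)@_e = E i e.
  apply: (@mcoeff_truncated _ _ (E i)) => {}e Ne; apply: PsiN.
  have : (mdeg (s i) <= n)%N.
    by rewrite mdeg_mesym1; apply: leq_trans (max_card _) _; rewrite card_ord.
  have : (mdeg e <= mdeg (e - s i + s i))%N.
    by rewrite !mdegE; apply: leq_sum => x _; rewrite mnmDE mnmBE; lia.
  by move: Ne; rewrite mdegD /N; lia.
pose f v : sr_mod K D := \sum_i v 0 i *: (sr_pi D (q i) : sr_mod K D).
have f_lin : linear f.
  move=> c u v; rewrite /f scaler_sumr -big_split /=.
  by apply: eq_bigr => i _; rewrite !mxE scalerDl scalerA.
pose psi : {linear 'rV[S]_m -> sr_mod K D} :=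
  HB.pack f (GRing.isLinear.Build _ _ _ _ f f_lin).
exists psi => v dv0; suff [] : dgen v = 0 /\ L v = psi v by [].
have d0 : dgen (0 : 'rV[S]_m) = 0.
  by rewrite -(scale0r (0 : 'rV[S]_m)) dgenZ mul0r.
have L0 : L 0 = 0 by rewrite -(scale0r (0 : 'rV[S]_m)) LZ // scale0r.
apply: (syz_ind (P := fun v => dgen v = 0 /\ L v = psi v)) dv0.
- split=> //; rewrite L0; symmetry; exact: (linear0 psi).
- move=> u w [du Lu] [dw Lw]; split; last by rewrite LD // Lu Lw linearD.
  have := dgen_linear 1 u w; rewrite scale1r => ->.
  by rewrite du dw scaler0 addr0.
move=> p i j; set C := gen_set i :|: gen_set j.
have le_i : (s i <= mesym1 C)%MM by rewrite gen_le_mesym1 subsetUl.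
have le_j : (s j <= mesym1 C)%MM by rewrite gen_le_mesym1 subsetUr.
have dT := taylor_dgen le_i le_j.
split; first by rewrite dgenZ dT mulr0.
rewrite LZ // linearZ; congr (_ *: _); apply: sr_coef_inj => e De.
pose A := (e - mesym1 C)%MM; pose h := msupport e; pose b := C :\: h.
have AsubH : msupport A \subset h.
  by apply/subsetP => x; rewrite !inE mnmBE; lia.
have hb : [disjoint h & b] by rewrite disjoint_sym disjoints_subset subsetDr.
have adm : admissible A b h by split.
have Ab : [disjoint msupport A & b] by apply: disjointWl hb.
have CE : h :|: b = C :|: h.
  by apply/setP => x; rewrite /b in_setU in_setD [RHS]in_setU;
    case: (x \in h); rewrite /= ?orbT ?orbF.
have ih : gen_set i \subset h :|: b.
  by rewrite CE; apply: subset_trans (subsetUl _ _) (subsetUl _ _).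
have jh : gen_set j \subset h :|: b.
  by rewrite CE; apply: subset_trans (subsetUr _ _) (subsetUl _ _).
have -> : sr_coef (L (taylor K (mesym1 C) i j)) e = syz_coef A b h i j.
  rewrite /syz_coef (_ : mesym1 (h :|: b) = mesym1 C + mesym1 (h :\: C))%MM; last first.
    apply/mnmP => x; rewrite CE mnmDE !mesym1E !inE.
    by case: (x \in gen_set i); case: (x \in gen_set j); case: (e x != 0)%N.
  have eE : (A + mesym1 h = e + mesym1 (h :\: C))%MM.
    apply/mnmP => x; rewrite !mnmDE mnmBE !mesym1E !inE.
    by case: (x \in gen_set i); case: (x \in gen_set j); case: (e x) => //= y;
      rewrite ?subn1 ?subn0 ?addn1 ?addn0.
  rewrite taylorD // LZ // sr_coefZX; last by apply: admissible_face adm.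
  by rewrite eE lem_addl addmK.
rewrite (PsiP A b) // /taylor (linearB psi) sr_coefB // !linearZ !sr_coefZX //.
have psiE k : psi (delta_mx 0 k) = sr_pi D (q k).
  rewrite /= /f (bigD1 k) //= big1 ?addr0 => [|l lk].
    by rewrite mxE !eqxx scale1r.
  by rewrite mxE (negPf lk) andbF scale0r.
suff key k : gen_set k \subset C -> (if (mesym1 C - s k <= e)%MM then
    sr_coef (psi (delta_mx 0 k)) (e - (mesym1 C - s k)) else 0) = Psi (A, b) (gen_set k).
  by rewrite !key // ?subsetUl ?subsetUr.
move=> kC.
have -> : (mesym1 C - s k <= e)%MM = (b \subset gen_set k).
  apply/mnm_lepP/subsetP => [le x|bk x].
    move=> /setDP [xC]; rewrite inE negbK => /eqP ex; move: (le x).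
    by rewrite ex mnmBE !mesym1E xC; case: (x \in gen_set k).
  rewrite mnmBE !mesym1E; have := bk x; rewrite in_setD.
  case: (x \in C) => //; case: (x \in gen_set k) => //.
  by rewrite andbT inE negbK subn0 lt0n; case: eqP => // _ /(_ isT).
case: ifP => [bk|/negbT /Psi0 -> //]; rewrite psiE sr_coef_pi; last first.
  apply: faces_sub De; apply/subsetP => x; rewrite !inE mnmBE.
  by apply: contraNN => /eqP ->.
rewrite qE /E; congr (Psi (_, _) _).
  rewrite /A; apply/mnmP => x; rewrite !mnmBE !mesym1E.
  move/subsetP/(_ x): kC.
  by case: (x \in gen_set k) => [/(_ isT) ->|_]; rewrite ?subnn ?subn0.
apply/setP => x; move/subsetP/(_ x): kC; move/subsetP/(_ x): bk.
have msE d : (x \in msupport d) = (d x != 0%N) by rewrite inE.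
rewrite !in_setD !msE !mnmBE !mesym1E.
have [xk _ /(_ isT) xC|_] := boolP (x \in gen_set k).
  by rewrite xC subnn subn0.
by rewrite andbF; case: (_ && _) => // /(_ isT).
Qed.

End HomCocycle.

(** * The cocycle criterion for the vanishing of T2 *)

Section T2Cocycles.
Local Open Scope ring_scope.
Variables (K : fieldType) (n : nat) (D : scomplex n).
Local Notation S := {mpoly K[n]}.
Local Notation m := (ngens D).

Theorem T2_vanishes_cocycleP : T2_vanishes K D <->
  forall (a b : {set 'I_n}) (theta : {set 'I_n} -> {set 'I_n} -> K),
    [disjoint a & b] -> t2_cocycle D a b theta -> t2_coboundary D a b theta.
Proof.
split=> [T0 a b theta ab th|cob]; first exact: theta_coboundary ab th T0.
apply/T2_vanishesP => phi.
pose pi z : Syz_Kosz K D := quotmod_pi (Kosz K D) z.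
(* [phi] read as a function on all row vectors, with default value 0 off the syzygies, so that the
   arguments on coefficients can ignore the subtype. *)
pose L (v : 'rV[S]_m) : sr_mod K D :=
  if insub v is Some z then phi (pi z) else 0.
have LE z : L (\val z) = phi (pi z) by rewrite /L valK.
have lift v : dgen v = 0 -> exists z : submod (Syz K D), v = \val z.
  by move=> /eqP dv; exists (Submod (dv : v \in submem (Syz K D))).
have LD u v : dgen u = 0 -> dgen v = 0 -> L (u + v) = L u + L v.
  move=> /lift [x ->] /lift [y ->].
  have -> : \val x + \val y = \val (x + y) by [].
  by rewrite !LE /pi linearD; exact: (linearD phi).
have LZ p v : dgen v = 0 -> L (p *: v) = p *: L v.
  move=> /lift [x ->]; have -> : p *: \val x = \val (p *: x) by [].
  rewrite !LE /pi linearZ.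
  transitivity (phi (iqpi _ p *: (quotmod_pi (Kosz K D) x : Syz_Kosz K D))).
    by congr (phi _); symmetry; exact: oqscaleE.
  exact: (linearZZ phi).
have LK f g : L (dgen f *: g - dgen g *: f) = 0.
  have dfg : dgen (dgen f *: g - dgen g *: f) = 0.
    have := dgen_linear (dgen f) g (- (dgen g *: f)); rewrite -scaleNr dgenZ => ->.
    by rewrite -[_ *: _]/(dgen f * dgen g) mulNr mulrC subrr.
  have [z zE] := lift _ dfg; rewrite zE LE.
  suff -> : pi z = 0 by exact: (linear0 phi).
  rewrite -[RHS](linear0 (quotmod_pi (Kosz K D))); apply/quotmod_eqP.
  rewrite subr0; apply/asboolP; exists 1, (fun=> 1), (fun=> z).
  by split=> [_|]; [exists f, g | rewrite big_ord1 scale1r].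
have [psi psiE] := Syz_hom_extends LD LZ LK cob.
exists psi; apply: hom_eq => x.
rewrite -[x](@quotmod_reprK _ _ (Kosz K D)); set z := quotmod_repr _.
rewrite /= restr_funE -psiE; first by rewrite LE.
by apply/eqP; exact: (valP z).
Qed.

End T2Cocycles.

(** * Necessary conditions on the graph *)

Section Graph.
Variables (n : nat) (D : scomplex n).
Implicit Types (F G h : {set 'I_n}) (u v w x y z : 'I_n).

Definition adj x y : bool := (x != y) && ([set x; y] \in faces D).

Lemma adj_sym x y : adj x y = adj y x.
Proof. by rewrite /adj eq_sym setUC. Qed.

Lemma adj_irr x : adj x x = false.
Proof. by rewrite /adj eqxx. Qed.

Lemma adj_vertexl x y : adj x y -> x \in vertices D.
Proof.
by case/andP => _; rewrite inE; apply: faces_sub; rewrite sub1set !inE eqxx.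
Qed.

Lemma adj_vertexr x y : adj x y -> y \in vertices D.
Proof. by rewrite adj_sym; apply: adj_vertexl. Qed.

Lemma adj_neq x y : adj x y -> x != y.
Proof. by case/andP. Qed.

Lemma adj_face x y : adj x y -> [set x; y] \in faces D.
Proof. by case/andP. Qed.

Lemma min_nonface_proper F G :
  F \in min_nonfaces D -> G \subset F -> G \notin faces D -> G = F.
Proof.
rewrite inE => /minsetP [_ Fmin] GF GD; apply: Fmin => //.
by rewrite inE GD.
Qed.

Lemma min_nonface_crit F : F \notin faces D ->
  (forall x, x \in F -> F :\ x \in faces D) -> F \in min_nonfaces D.
Proof.
move=> FD Fx; rewrite inE; apply/minsetP; split; first by rewrite inE FD.
move=> G; rewrite inE => GD GF; apply/eqP; rewrite eqEsubset GF /=.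
apply: contraR GD => /subsetPn [x xF xG].
by apply: faces_sub (Fx x xF); rewrite subsetD1 GF.
Qed.

Lemma nonedge_min u v : u \in vertices D -> v \in vertices D -> u != v ->
  ~~ adj u v -> [set u; v] \in min_nonfaces D.
Proof.
rewrite [u \in _]inE [v \in _]inE /adj => uD vD -> /= nf.
apply: min_nonface_crit => // x; rewrite !inE => /orP [] /eqP ->.
  by apply: faces_sub vD; apply/subsetP => y; rewrite !inE; case: eqP.
by apply: faces_sub uD; apply/subsetP => y; rewrite !inE orbC; case: eqP.
Qed.

Hypothesis dim1 : forall F, F \in faces D -> #|F| <= 2.

Lemma nonface3 x y z : x != y -> x != z -> y != z ->
  [set x; y; z] \notin faces D.
Proof.
move=> xy xz yz; apply/negP => /dim1; rewrite setUC cardsU1 !inE negb_or.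
by rewrite ![z == _]eq_sym xz yz cards2 xy.
Qed.

Lemma triangle_min u v w : adj u v -> adj u w -> adj v w ->
  [set u; v; w] \in min_nonfaces D.
Proof.
move=> uv uw vw; apply: min_nonface_crit.
  by apply: nonface3; apply: adj_neq.
have sub x y F : adj x y -> F \subset [set x; y] -> F \in faces D.
  by move=> /adj_face xyD /faces_sub; apply.
move=> x; rewrite !inE => /orP [/orP [] |] /eqP ->;
  [apply: sub vw _ | apply: sub uw _ | apply: sub uv _];
  by apply/subsetP => y; rewrite !inE; do 3!case: (y == _).
Qed.

Lemma face_cover h x y : h \in faces D -> x \in h -> y \in h -> x != y ->
  h = [set x; y].
Proof.
move=> /dim1 h2 xh yh xy; apply/eqP; rewrite eq_sym eqEcard cards2 xy h2 andbT.
by apply/subsetP => z; rewrite !inE => /orP [] /eqP ->.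
Qed.

Lemma face_adj h x y : h \in faces D -> x \in h -> y \in h -> x != y -> adj x y.
Proof.
by move=> hD xh yh xy; rewrite /adj xy -(face_cover hD xh yh xy).
Qed.

Lemma face_vertex h x : h \in faces D -> x \in h -> x \in vertices D.
Proof. by move=> hD xh; rewrite inE; apply: faces_sub hD; rewrite sub1set. Qed.

(** Both {y, u} and {y, v} are faces, so a nonface inside the three points must contain [u] and
    [v]. *)
Lemma nonedge_cone_min u v y F : ~~ adj u v -> u != v -> adj y u -> adj y v ->
  F \in min_nonfaces D -> F \subset [set u; v; y] -> F = [set u; v].
Proof.
move=> nuv uv yu yv Fm Fsub; have FD := min_nonfaceP Fm.
have uvD : [set u; v] \notin faces D by move: nuv; rewrite /adj uv.
have miss x y1 : adj y y1 -> F \subset [set u; v; y] :\ x ->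
    [set u; v; y] :\ x = [set y; y1] -> False.
  by move=> /adj_face yD Fs E; case/negP: FD; apply: faces_sub yD; rewrite -E.
have uF : u \in F.
  apply/negPn/negP => nu; apply: (@miss u v) => //; first by rewrite subsetD1 Fsub.
  apply/setP => x; rewrite !inE; have := adj_neq yu; have [-> /negPf|_ _ /=] := eqVneq x u.
    by rewrite eq_sym => ->; rewrite (negPf uv).
  by rewrite orbC.
have vF : v \in F.
  apply/negPn/negP => nu; apply: (@miss v u) => //; first by rewrite subsetD1 Fsub.
  apply/setP => x; rewrite !inE; have := adj_neq yv; have [-> /negPf|_ _ /=] := eqVneq x v.
    by rewrite eq_sym => ->; rewrite eq_sym (negPf uv).
  by rewrite orbF orbC.
apply/esym/(min_nonface_proper Fm) => //.
by apply/subsetP => x; rewrite !inE => /orP [] /eqP ->.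
Qed.

End Graph.

(** * Explicit cocycles obstructing the vanishing of T2 *)

Section Obstructions.
Local Open Scope ring_scope.
Variables (K : fieldType) (n : nat) (D : scomplex n).
Hypothesis T0 : T2_vanishes K D.
Implicit Types (F G h : {set 'I_n}) (u v w x y z : 'I_n).
Local Notation adj := (adj D).

(** The indicator of [g], placed on the single nonface [t], is a cocycle: where [g] changes along an
    inclusion, there is no second minimal nonface to contradict the shift. A coboundary has to agree
    with [psi] on [t] over [h0] and [h1], because [G0] and [G1] do not contain [b] and so have value
    0 on both sides. *)
Lemma T2_separation (a b t : {set 'I_n}) (g : {set 'I_n} -> bool) :
  [disjoint a & b] -> t \in min_nonfaces D -> b \subset t ->
  (forall h h' F, a \subset h -> h \subset h' -> h' \in faces D ->
     [disjoint h' & b] -> g h != g h' -> F \in min_nonfaces D ->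
     F \subset h :|: b -> F = t) ->
  forall h0 h1 G0 G1,
    (forall i : bool, let h := if i then h1 else h0 in
                 let G := if i then G1 else G0 in
      [/\ a \subset h, h \in faces D, [disjoint h & b], t \subset h :|: b
        & [/\ G \in min_nonfaces D, G \subset h :|: b & ~~ (b \subset G)]]) ->
    g h0 = g h1.
Proof.
move=> ab tm bt gP h0 h1 G0 G1 hG.
pose theta h F : K := ((F == t) && g h)%:R.
have th : t2_cocycle D a b theta.
  split=> [h F bF|h h' ah hh' h'D h'b].
    by rewrite /theta; case: eqP => // Ft; rewrite Ft bt in bF.
  (* Where [g] jumps, [t] is the only nonface concerned, and its own jump is the constant. *)
  exists (if g h == g h' then 0 else (g h')%:R - (g h)%:R) => F Fm Fh.
  have [gE|gN] := eqVneq (g h) (g h'); first by rewrite /theta gE addr0.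
  by rewrite /theta (gP h h' F) ?eqxx //= addrC subrK.
have [psi [psi0 psiP]] := (T2_vanishes_cocycleP K D).1 T0 _ _ _ ab th.
have gE (i : bool) : (g (if i then h1 else h0))%:R = psi t.
  have /= [ah hD hb th' [Gm Gh bG]] := hG i.
  have := psiP _ ah hD hb _ _ tm Gm th' Gh.
  rewrite (psi0 _ bG) subr0 /theta eqxx /=; case: eqP => [Gt|_].
    by rewrite Gt bt in bG.
  by rewrite subr0.
have := gE false; rewrite -(gE true).
by case: (g h0); case: (g h1) => //= /eqP; rewrite ?oner_eq0 // eq_sym oner_eq0.
Qed.

Hypothesis dim1 : forall F, F \in faces D -> (#|F| <= 2)%N.

(** With a = {v} and b = {u, w}, the edges {v, x} and {v, y} are related only through {v}, and over
    {v} the one minimal nonface is [t]. Membership of [x] therefore separates the two edges. The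
    required nonfaces not containing [b] lie in {v, x, u} and {v, y, u}. *)
Lemma T2_degree v u w x y : adj v u -> adj v w -> adj v x -> adj v y ->
  uniq [:: u; w; x; y] -> False.
Proof.
move=> vu vw vx vy; rewrite /= !inE !negb_or => /and4P [/and3P [uw ux uy] /andP [wx wy] xy _].
pose t := if adj u w then [set u; v; w] else [set u; w].
have tm : t \in min_nonfaces D.
  rewrite /t; case: ifP => [auw|/negbT nuw].
    by apply: triangle_min => //; rewrite adj_sym.
  by apply: nonedge_min => //; [apply: adj_vertexr vu | apply: adj_vertexr vw].
have ab : [disjoint [set v] & [set u; w]].
  by rewrite disjoints1 !inE (negPf (adj_neq vu)) (negPf (adj_neq vw)).
have bt : [set u; w] \subset t.
  rewrite /t; case: ifP => // _; apply/subsetP => z.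
  by rewrite !inE => /orP [] ->; rewrite ?orbT.
have gP h h' F : [set v] \subset h -> h \subset h' -> h' \in faces D ->
    [disjoint h' & [set u; w]] -> (x \in h) != (x \in h') ->
    F \in min_nonfaces D -> F \subset h :|: [set u; w] -> F = t.
  rewrite sub1set => vh hh' h'D h'b xhh' Fm Fh.
  have xh' : x \in h'.
    apply: contraNT xhh' => xh'; rewrite (negPf xh').
    by have /negPf -> : x \notin h by apply: contra xh' => /(subsetP hh').
  have xh : x \notin h by move: xhh'; rewrite xh'; case: (x \in h).
  have h'E := face_cover dim1 h'D (subsetP hh' _ vh) xh' (adj_neq vx).
  have Fsub : F \subset [set u; w; v].
    apply/subsetP => z /(subsetP Fh); rewrite !inE => /orP [zh|/orP [] ->];
      rewrite ?orbT //.
    have := subsetP hh' z zh; rewrite h'E !inE => /orP [->|/eqP zx]; first by rewrite orbT.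
    by rewrite zx (negPf xh) in zh.
  rewrite /t; case: ifP => [auw|/negbT nuw];
    last exact: (nonedge_cone_min nuw uw vu vw Fm Fsub).
  have tm' : [set u; w; v] \in min_nonfaces D.
    by apply: triangle_min => //; rewrite adj_sym.
  rewrite (min_nonface_proper tm' Fsub (min_nonfaceP Fm)).
  by apply/setP => z; rewrite !inE -!orbA; congr (_ || _); rewrite orbC.
have facts z : adj v z -> u != z -> w != z -> exists G,
    [/\ [set v] \subset [set v; z], [set v; z] \in faces D,
      [disjoint [set v; z] & [set u; w]], t \subset [set v; z] :|: [set u; w]
    & [/\ G \in min_nonfaces D, G \subset [set v; z] :|: [set u; w]
        & ~~ ([set u; w] \subset G)]].
  move=> vz uz wz.
  have [|G Gm Gsub] := @min_nonface_sub _ D [set v; z; u].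
    rewrite inE; apply: (nonface3 dim1); rewrite ?(adj_neq vz) ?(adj_neq vu) //.
    by rewrite eq_sym.
  exists G; split.
  - by rewrite sub1set !inE eqxx.
  - exact: adj_face.
  - rewrite disjoints_subset; apply/subsetP => q; rewrite !inE => /orP [] /eqP ->.
      by rewrite negb_or (adj_neq vu) (adj_neq vw).
    by rewrite negb_or ![z == _]eq_sym uz wz.
  - rewrite /t; case: ifP => _; apply/subsetP => q; rewrite !inE.
      by do 4!case: (q == _).
    by do 4!case: (q == _).
  - split=> //.
      apply: subset_trans Gsub _; apply/subsetP => q; rewrite !inE.
      by do 4!case: (q == _).
    apply/negP => /subsetP /(_ w); rewrite !inE eqxx orbT => /(_ isT) /(subsetP Gsub).
    by rewrite !inE [w == v]eq_sym (negPf (adj_neq vw)) (negPf wz) eq_sym (negPf uw).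
have [G1 G1P] := facts x vx ux wx; have [G0 G0P] := facts y vy uy wy.
have : (x \in [set v; y]) = (x \in [set v; x]).
  by apply: (T2_separation ab tm bt gP (G0 := G0) (G1 := G1)) => -[].
by rewrite !inE eqxx orbT (negPf xy) orbF eq_sym (negPf (adj_neq vx)).
Qed.


(** Here [a] is empty, [t] is [b], and the separating function tells whether a face meets [A]. It
    can only jump from the empty face, or from a single vertex outside [A] to an edge ending in [A];
    in both cases [b] is the only minimal nonface in reach. *)
Lemma T2_nonface_separation (b A : {set 'I_n}) x z : b \in min_nonfaces D ->
  [disjoint A & b] ->
  (forall p q F, p \in A -> adj p q -> q \notin A -> q \notin b ->
     F \in min_nonfaces D -> F \subset b :|: [set q] -> F = b) ->
  x \in A -> x \in vertices D -> z \notin A -> z \in vertices D -> z \notin b ->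
  (forall y, y \in [:: x; z] -> exists2 G, G \in min_nonfaces D &
     G \subset b :|: [set y] /\ ~~ (b \subset G)) -> False.
Proof.
move=> bm Ab closed xA xV zA zV zb outside.
have gP h h' F : set0 \subset h -> h \subset h' -> h' \in faces D ->
    [disjoint h' & b] -> ~~ [disjoint h & A] != ~~ [disjoint h' & A] ->
    F \in min_nonfaces D -> F \subset h :|: b -> F = b.
  move=> _ hh' h'D h'b hA Fm Fh.
  have hA0 : [disjoint h & A].
    by apply: contraNT hA => hA; rewrite hA;
      case: (boolP [disjoint h' & A]) => // /(disjointWl hh'); rewrite (negPf hA).
  have /pred0Pn [p /andP [/= ph' pA]] : ~~ [disjoint h' & A].
    by move: hA; rewrite hA0; case: [disjoint h' & A].
  have [h0|[q qh]] := set_0Vmem h.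
    apply: (min_nonface_proper bm) (min_nonfaceP Fm).
    by move: Fh; rewrite h0 set0U.
  have qA : q \notin A by rewrite (disjointFr hA0).
  have qb : q \notin b by rewrite (disjointFr h'b) // (subsetP hh').
  have pq : p != q by apply: contraNneq qA => <-.
  have h'E := face_cover dim1 h'D ph' (subsetP hh' _ qh) pq.
  apply: (closed p q) => //.
    exact: face_adj h'D ph' (subsetP hh' _ qh) pq.
  apply: subset_trans Fh _; rewrite setUC; apply: setUS.
  apply/subsetP => r rh; rewrite inE; have := subsetP hh' r rh.
  rewrite h'E !inE => /orP [/eqP rp|//].
  by move: rh; rewrite rp (disjointFl hA0).
have [|Gx Gxm [Gx1 Gx2]] := outside x; first by rewrite inE eqxx.
have [|Gz Gzm [Gz1 Gz2]] := outside z; first by rewrite !inE eqxx orbT.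
have xb : x \notin b by rewrite (disjointFr Ab).
have zX (c : {set 'I_n}) : [disjoint set0 & c] by rewrite -setI_eq0 set0I.
have : ~~ [disjoint [set z] & A] = ~~ [disjoint [set x] & A].
  apply: (T2_separation (a := set0) (g := fun h => ~~ [disjoint h & A]) _ bm _ gP
    (G0 := Gz) (G1 := Gx)) => // -[] /=; split; rewrite ?sub0set ?subsetUr //.
  - by move: xV; rewrite inE.
  - by rewrite disjoints1.
  - by split=> //; rewrite setUC.
  - by move: zV; rewrite inE.
  - by rewrite disjoints1.
  - by split=> //; rewrite setUC.
by rewrite !disjoints1 xA (negPf zA).
Qed.

(** Together with a further vertex, the pair contains another minimal nonface unless that vertex is
    adjacent to both [u] and [v]. Hence common neighbours, like [u] and [v] themselves, do not
    connect faces, and edges leaving [A] may end there. *)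
Lemma T2_nonedge u v (A : {set 'I_n}) x z :
  u \in vertices D -> v \in vertices D -> u != v -> ~~ adj u v ->
  u \notin A -> v \notin A ->
  (forall p q, p \in A -> adj p q ->
     [|| q \in A, q == u, q == v | adj q u && adj q v]) ->
  x \in A -> x \in vertices D -> ~~ (adj x u && adj x v) ->
  z \notin A -> z \in vertices D -> z != u -> z != v ->
  ~~ (adj z u && adj z v) -> False.
Proof.
move=> uV vV uv nuv uA vA closed xA xV xC zA zV zu zv zC.
have bm := nonedge_min uV vV uv nuv.
have nface y : y \in vertices D -> ~~ (adj y u && adj y v) -> y != u -> y != v ->
    exists2 G, G \in min_nonfaces D &
    G \subset [set u; v] :|: [set y] /\ ~~ ([set u; v] \subset G).
  move=> yV yC yu yv.
  have aux w w' : w \in vertices D -> ~~ adj y w -> y != w -> y != w' -> w' != w ->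
      [set w; w'] = [set u; v] -> exists2 G, G \in min_nonfaces D &
      G \subset [set u; v] :|: [set y] /\ ~~ ([set u; v] \subset G).
    move=> wV yw nyw nyw' ww' <-; exists [set y; w]; first exact: nonedge_min.
    split; first by apply/subsetP => r; rewrite !inE; do 3!case: (r == _).
    apply/negP => /subsetP /(_ w'); rewrite !inE eqxx orbT => /(_ isT).
    by rewrite (negPf ww') orbF eq_sym (negPf nyw').
  have [ayu|nyu] := boolP (adj y u); last first.
    by apply: (aux u v) => //; rewrite eq_sym.
  by apply: (aux v u) => //; [rewrite ayu in yC | rewrite setUC].
apply: (T2_nonface_separation (b := [set u; v]) (A := A) bm _ _ xA xV zA zV).
- rewrite disjoint_sym disjoints_subset; apply/subsetP => r.
  by rewrite !inE => /orP [] /eqP ->.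
- move=> p q F pA apq qA; rewrite in_set2 negb_or => /andP [qu qv] Fm.
  have := closed p q pA apq; rewrite (negPf qA) (negPf qu) (negPf qv) /= => /andP [au av].
  exact: (nonedge_cone_min nuv uv au av Fm).
- by rewrite !inE negb_or zu.
have xu : x != u by apply: contraNneq uA => <-.
have xv : x != v by apply: contraNneq vA => <-.
by move=> y; rewrite !inE => /orP [] /eqP ->; apply: nface.
Qed.

(** A vertex off the triangle always forms a nonface with two corners, so there is no exception like
    that of common neighbours for a nonadjacent pair. *)
Lemma T2_triangle u v w (A : {set 'I_n}) x z :
  adj u v -> adj u w -> adj v w -> [disjoint A & [set u; v; w]] ->
  (forall p q, p \in A -> adj p q -> (q \in A) || (q \in [set u; v; w])) ->
  x \in A -> x \in vertices D ->
  z \notin A -> z \in vertices D -> z \notin [set u; v; w] -> False.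
Proof.
move=> uv uw vw Ab closed xA xV zA zV zb.
have bm := triangle_min dim1 uv uw vw.
apply: (T2_nonface_separation (b := [set u; v; w]) (A := A) bm Ab _ xA xV zA zV zb).
  move=> p q F pA apq qA qb; have := closed p q pA apq.
  by rewrite (negPf qA) (negPf qb).
have nface y : y \notin [set u; v; w] -> exists2 G, G \in min_nonfaces D &
    G \subset [set u; v; w] :|: [set y] /\ ~~ ([set u; v; w] \subset G).
  rewrite !inE !negb_or -andbA => /and3P [yu yv yw].
  have [|G Gm Gsub] := @min_nonface_sub _ D [set y; u; v].
    by rewrite inE; apply: (nonface3 dim1) => //; apply: adj_neq uv.
  exists G => //; split.
    apply: subset_trans Gsub _; apply/subsetP => r; rewrite !inE.
    by do 4!case: (r == _).
  apply/negP => /subsetP /(_ w); rewrite !inE eqxx orbT => /(_ isT) /(subsetP Gsub).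
  rewrite !inE eq_sym (negPf yw) [w == u]eq_sym [w == v]eq_sym.
  by rewrite (negPf (adj_neq uw)) (negPf (adj_neq vw)).
by move=> y; rewrite !inE => /orP [] /eqP ->; apply: nface => //; rewrite (disjointFr Ab).
Qed.

(** Taking [a] empty and b = {v} turns cocycles into functions on oriented edges between
    non-neighbours of [v]. The indicator of one edge must be a difference of vertex values, which is
    impossible for an edge on a cycle. *)
Lemma T2_edge_potential v (W : {set 'I_n}) x0 x1 : v \in vertices D ->
  W \subset vertices D -> v \notin W -> (forall x, x \in W -> ~~ adj v x) ->
  x0 \in W -> x1 \in W -> adj x0 x1 ->
  exists psi : 'I_n -> K, forall x y, x \in W -> y \in W -> adj x y ->
    psi x - psi y = ((x, y) == (x0, x1))%:R - ((y, x) == (x0, x1))%:R.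
Proof.
move=> vV WV vW Wv x0W x1W a01.
pose theta h F : K := ((F == [set v; x0]) && (h == [set x0; x1]))%:R.
have Wne x : x \in W -> v != x by move=> xW; apply: contraNneq vW => ->.
have vx_min x : x \in W -> [set v; x] \in min_nonfaces D.
  by move=> xW; apply: nonedge_min => //; [apply: (subsetP WV) | apply: Wne | apply: Wv].
have vx_eq x y : x \in W -> y \in W -> ([set v; x] == [set v; y]) = (x == y).
  move=> xW yW; apply/eqP/eqP => [E|-> //].
  have : x \in [set v; y] by rewrite -E !inE eqxx orbT.
  by rewrite !inE eq_sym (negPf (Wne x xW)) => /eqP.
have th : t2_cocycle D set0 [set v] theta.
  split=> [h F vF|h h' _ hh' h'D h'v].
    rewrite /theta; case: eqP => // Fv; case/negP: vF.
    by rewrite Fv sub1set !inE eqxx.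
  (* Among the proper subfaces of {x0, x1} only {x0} sees {v, x0}. Over it this is the sole minimal
     nonface, and its value jumps from 0 to 1. *)
  exists (if h == h' then 0 else (h' == [set x0; x1])%:R * (x0 \in h)%:R) => F Fm Fh.
  have [<-|nhh'] := eqVneq h h'; first by rewrite addr0.
  rewrite /theta; have [h'E|_] := eqVneq h' [set x0; x1]; last first.
    rewrite andbF mul0r addr0; have [hE|] := eqVneq h [set x0; x1]; last by rewrite andbF.
    case/eqP: nhh'; apply/eqP; rewrite eqEcard hh' hE cards2 (adj_neq a01).
    exact: dim1.
  rewrite mul1r andbT -h'E (negPf nhh') andbF add0r; congr (_%:R); congr nat_of_bool.
  have [x0h|x0h] := boolP (x0 \in h).
    apply/eqP; apply: (min_nonface_proper (vx_min _ x0W)) (min_nonfaceP Fm).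
    apply: subset_trans Fh _; rewrite setUC; apply: setUS.
    apply/subsetP => y yh; have := subsetP hh' y yh; rewrite h'E !inE.
    case/orP => // /eqP yx1; case/eqP: nhh'; apply/eqP.
    rewrite eqEsubset hh' h'E; apply/subsetP => r.
    by rewrite !inE => /orP [] /eqP ->; rewrite // -yx1.
  apply/negP => /eqP FE; have : x0 \in F by rewrite FE !inE eqxx orbT.
  by move=> /(subsetP Fh); rewrite !inE (negPf x0h) eq_sym (negPf (Wne _ x0W)).
have ab : [disjoint set0 & [set v]] by rewrite -setI_eq0 set0I.
have [psi [_ psiP]] := (T2_vanishes_cocycleP K D).1 T0 _ _ _ ab th.
exists (fun x => psi [set v; x]) => x y xW yW axy.
have hv : [disjoint [set x; y] & [set v]].
  rewrite disjoint_sym disjoints1 !inE negb_or.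
  by rewrite (Wne _ xW) (Wne _ yW).
rewrite -(psiP _ (sub0set _) (adj_face axy) hv _ _ (vx_min _ xW) (vx_min _ yW)); last 2 first.
- by apply/subsetP => r; rewrite !inE; do 3!case: (r == _).
- by apply/subsetP => r; rewrite !inE; do 3!case: (r == _).
rewrite /theta !vx_eq // !xpair_eqE; congr (_%:R - _%:R); congr nat_of_bool.
  have [->|//] := eqVneq x x0; apply/eqP/eqP => [E|-> //].
  have : x1 \in [set x0; y] by rewrite E !inE eqxx orbT.
  by rewrite !inE [x1 == x0]eq_sym (negPf (adj_neq a01)) => /eqP.
have [->|//] := eqVneq y x0; apply/eqP/eqP => [E|->]; last by rewrite setUC.
have : x1 \in [set x; x0] by rewrite E !inE eqxx orbT.
by rewrite !inE [x1 == x0]eq_sym (negPf (adj_neq a01)) orbF => /eqP.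
Qed.

Definition degree_in (W : {set 'I_n}) x : nat := #|[set y in W | adj x y]|.

(** The sum counts each edge twice, so this says that there are fewer edges than vertices. In this
    form it serves the counting as well as the rejection of a set with all inner degrees at least
    two. *)
Lemma T2_forest v (W : {set 'I_n}) : v \in vertices D ->
  W \subset vertices D -> v \notin W -> (forall x, x \in W -> ~~ adj v x) ->
  W != set0 -> ((\sum_(x in W) degree_in W x) <= 2 * (#|W|).-1)%N.
Proof.
move=> vV WV vW Wv /set0Pn [w0 w0W].
pose Edge := [set e : 'I_n * 'I_n | [&& e.1 \in W, e.2 \in W, adj e.1 e.2 & (e.1 < e.2)%N]].
pose swap (e : 'I_n * 'I_n) := (e.2, e.1).
have swapK : involutive swap by case.
have le_edges : (\sum_(x in W) degree_in W x <= 2 * #|Edge|)%N.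
  have -> : (\sum_(x in W) degree_in W x =
      #|[set e : 'I_n * 'I_n | [&& e.1 \in W, e.2 \in W & adj e.1 e.2]]|)%N.
    rewrite -sum1dep_card (eq_bigl (fun e : 'I_n * 'I_n =>
      (e.1 \in W) && ((e.2 \in W) && adj e.1 e.2))) //.
    rewrite -(pair_big_dep (fun x => x \in W) (fun x y => (y \in W) && adj x y) (fun _ _ =>
      1%N)) /=.
    by apply: eq_bigr => x _; rewrite /degree_in -sum1dep_card.
  rewrite mul2n -addnn -{2}(card_imset Edge (inv_inj swapK)).
  apply: leq_trans (leq_card_setU _ _); apply: subset_leq_card.
  apply/subsetP => -[x y]; rewrite !inE /= => /and3P [xW yW axy]; rewrite xW yW axy /=.
  case: (ltngtP x y) => //= [lt|/val_inj xy]; last by rewrite xy adj_irr in axy.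
  by apply/imsetP; exists (y, x); rewrite // !inE /= xW yW adj_sym axy.
apply: leq_trans le_edges _; rewrite leq_mul2l /=.
have -> : (#|W|.-1 = #|W :\ w0|)%N by rewrite (cardsD1 w0) w0W.
(* The potentials of the single edges are dual to the coboundaries of the vertices
   other than [w0], which bounds the number of edges by a rank. *)
have /choice [Psi PsiP] (k : 'I_#|Edge|) : exists psi : 'I_n -> K,
    forall x y, x \in W -> y \in W -> adj x y ->
    psi x - psi y = ((x, y) == enum_val k)%:R - ((y, x) == enum_val k)%:R.
  have := enum_valP k; case: (enum_val k) => x0 x1; rewrite inE => /= /and4P [x0W x1W a01 _].
  exact: T2_edge_potential vV WV vW Wv x0W x1W a01.
pose M := \matrix_(k < #|Edge|, j < #|W :\ w0|)
  ((enum_val j == (enum_val k).1)%:R - (enum_val j == (enum_val k).2)%:R : K).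
pose N := \matrix_(j < #|W :\ w0|, k < #|Edge|) (Psi k (enum_val j) - Psi k w0).
apply: (@mulmx1_min K _ _ M N); apply/matrixP => k l; rewrite !mxE.
pose f w := Psi l w - Psi l w0.
have sumE y : y \in W -> \sum_(w in W :\ w0) (w == y)%:R * f w = f y.
  move=> yW; have [->|yw0] := eqVneq y w0.
    rewrite {2}/f subrr big1 // => w; rewrite !inE => /andP [/negPf -> _].
    by rewrite mul0r.
  rewrite (bigD1 y) ?inE ?yw0 //= eqxx mul1r big1 ?addr0 // => w /andP [_ /negPf ->].
  by rewrite mul0r.
have := enum_valP k; have := enum_valP l; rewrite [enum_val k \in _]inE.
move=> lE /and4P [k1 k2 ak ltk].
transitivity (f (enum_val k).1 - f (enum_val k).2).
  rewrite -!sumE // -sumrB [RHS]big_enum_val; apply: eq_bigr => j _.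
  by rewrite !mxE mulrBl.
rewrite /f opprB addrA subrK PsiP // -surjective_pairing.
rewrite (inj_eq enum_val_inj).
have [Esw|_] := ((enum_val k).2, (enum_val k).1) =P enum_val l; last by rewrite subr0.
by move: lE; rewrite -Esw inE /= => /and4P [_ _ _]; rewrite ltnNge ltnW.
Qed.

End Obstructions.

(** * Sufficient conditions on the graph *)

Section Vanishing.
Local Open Scope ring_scope.
Variables (K : fieldType) (n : nat) (D : scomplex n).
Implicit Types (a b F G H h k : {set 'I_n}) (u v w x y z : 'I_n).
Local Notation adj := (adj D).

(** Such a [G] has value 0 over [h] and over every larger face, so it fixes the constant left open
    by the cocycle condition. *)
Definition has_link b h : Prop :=
  exists2 G, G \in min_nonfaces D & G \subset h :|: b /\ ~~ (b \subset G).

Hypothesis dim1 : forall F, F \in faces D -> (#|F| <= 2)%N.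
Hypothesis all_vertices : forall x, x \in vertices D.
Hypothesis degree3 : forall v u w x y, adj v u -> adj v w -> adj v x -> adj v y ->
  ~~ uniq [:: u; w; x; y].
(** The forest condition as vanishing first cohomology of the graph of non-neighbours. *)
Hypothesis forest : forall v (l : 'I_n -> 'I_n -> K),
  (forall x y, l x y = - l y x) ->
  exists psi : 'I_n -> K, forall x y, x != v -> y != v -> ~~ adj v x -> ~~ adj v y ->
    adj x y -> l x y = psi x - psi y.
Hypothesis linked : forall b (g : {set 'I_n} -> K), b \in min_nonfaces D ->
  (forall h h', h \subset h' -> h' \in faces D -> [disjoint h' & b] ->
     has_link b h -> g h = g h') ->
  forall h h', h \in faces D -> h' \in faces D -> [disjoint h & b] ->
    [disjoint h' & b] -> has_link b h -> has_link b h' -> g h = g h'.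

Lemma cocycle_stable a b theta h h' F : t2_cocycle D a b theta ->
  a \subset h -> h \subset h' -> h' \in faces D -> [disjoint h' & b] ->
  has_link b h -> F \in min_nonfaces D -> F \subset h :|: b ->
  theta h F = theta h' F :> K.
Proof.
move=> [th0 thP] ah hh' h'D h'b [G Gm [Gh bG]] Fm Fh.
have [c cP] := thP h h' ah hh' h'D h'b.
have := cP G Gm Gh; rewrite !(th0 _ _ bG) add0r => c0.
by rewrite (cP F Fm Fh) -c0 addr0.
Qed.

Lemma nonadj_min x y : x != y -> ~~ adj x y -> [set x; y] \in min_nonfaces D.
Proof. by move=> xy; apply: nonedge_min. Qed.

(** [psi F] is read off at any face with a link; the main point is independence of that face. A face
    without a link sees at most one minimal nonface and imposes no condition. *)
Lemma coboundary_large a b theta : (1 < #|b|)%N -> [disjoint a & b] ->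
  t2_cocycle D a b (theta : _ -> _ -> K) -> t2_coboundary D a b theta.
Proof.
move=> /card_gt1P [u [v [ub vb uv]]] ab th; have [th0 _] := th.
pose good F h := [/\ a \subset h, h \in faces D, [disjoint h & b],
  F \subset h :|: b & has_link b h].
have comparable F h h' : F \in min_nonfaces D -> good F h -> good F h' ->
    h \subset h' -> theta h F = theta h' F.
  move=> Fm [ah hD hb Fh lh] [_ h'D h'b _ _] hh'.
  exact: (cocycle_stable th).
have welldef F h h' : F \in min_nonfaces D -> b \subset F ->
    good F h -> good F h' -> theta h F = theta h' F.
  move=> Fm bF gh gh'; have [ah hD hb Fh lh] := gh; have [ah' h'D h'b Fh' lh'] := gh'.
  have [hh'|/subsetPn [y yh yh']] := boolP (h \subset h'); first exact: comparable.
  have [h'h|/subsetPn [y' y'h' y'h]] := boolP (h' \subset h).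
    by symmetry; apply: comparable.
  (* In this one case the two faces may be disjoint, and connectedness is needed. Otherwise they
     share a vertex, from [a] or from [F] outside [b]. *)
  have [/andP [/eqP a0 /eqP Fb]|] := boolP ((a == set0) && (F == b)).
    subst F a.
    apply: (linked Fm (g := fun h => theta h b)) => // k k' kk' k'D k'b lk.
    by apply: (cocycle_stable th) => //; rewrite ?sub0set ?subsetUr.
  rewrite negb_and => aF.
  have [z zh zh'] : exists2 z, z \in h & z \in h'.
    case/orP: aF => [/set0Pn [z za]|Fb].
      by exists z; [apply: (subsetP ah) | apply: (subsetP ah')].
    have /subsetPn [z zF zb] : ~~ (F \subset b).
      by apply: contra Fb => Fb; rewrite eqEsubset Fb.
    exists z; [have := subsetP Fh z zF | have := subsetP Fh' z zF];
      by rewrite inE (negPf zb) orbF.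
  have yz : y != z by apply: contraNneq yh' => ->.
  have y'z : y' != z by apply: contraNneq y'h => ->.
  have hE := face_cover dim1 hD yh zh yz.
  have h'E := face_cover dim1 h'D y'h' zh' y'z.
  have yy' : y != y' by apply: contraNneq yh' => ->.
  have hh'z r : r \in h -> r \in h' -> r = z.
    by rewrite hE !inE => /orP [] /eqP -> //; rewrite (negPf yh').
  have zb : z \notin b by rewrite (disjointFr hb).
  have zsub (k : {set 'I_n}) : z \in k -> [set z] \subset k by rewrite sub1set.
  have [lz|] := pselect (has_link b [set z]).
    have gz : good F [set z].
      split=> //.
      - by apply/subsetP => r ra; rewrite inE (hh'z r) ?(subsetP ah) ?(subsetP ah').
      - exact: faces_sub (zsub h zh) hD.
      - by rewrite disjoints1.
      - apply/subsetP => r rF; have := subsetP Fh r rF; have := subsetP Fh' r rF.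
        by rewrite !inE; case: (r \in b); rewrite ?orbT // !orbF => rh' rh; rewrite (hh'z r).
    by rewrite -(comparable F _ h Fm gz gh (zsub _ zh)) (comparable F _ h' Fm gz gh' (zsub
      _ zh')).
  have zadj w w' : w \in b -> w' \in b -> w' != w -> ~~ adj z w -> has_link b [set z].
    move=> wb w'b ww' nzw; exists [set z; w].
      by apply: nonadj_min => //; apply: contraNneq zb => ->.
    split; first by apply: setUS; rewrite sub1set.
    apply/negP => /subsetP /(_ w' w'b); rewrite !inE (negPf ww') orbF.
    by move=> /eqP w'z; rewrite -w'z w'b in zb.
  (* Without a link at [z] the vertex [z] is adjacent to [u], [v], [y] and [y'], one neighbour too
     many. *)
  move=> nlink.
  have zu : adj z u.
    by apply/negPn/negP => nzu; apply: nlink; apply: (zadj u v) => //; rewrite eq_sym.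
  have zv : adj z v by apply/negPn/negP => nzv; apply: nlink; apply: (zadj v u).
  have zy : adj z y by apply: (face_adj dim1 hD zh yh); rewrite eq_sym.
  have zy' : adj z y' by apply: (face_adj dim1 h'D zh' y'h'); rewrite eq_sym.
  case/negP: (degree3 zu zv zy zy'); rewrite /= !inE !negb_or uv yy' !andbT /=.
  have nb r (k : {set 'I_n}) : r \in k -> [disjoint k & b] -> forall s, s \in b -> s != r.
    by move=> rk kb s sb; apply: contraTneq sb => ->; rewrite (disjointFr kb).
  by rewrite !(nb y h) ?(nb y' h').
have [psi psiP] : exists psi : {set 'I_n} -> K, forall F,
    (~~ (b \subset F) -> psi F = 0) /\
    (F \in min_nonfaces D -> b \subset F -> forall h, good F h -> psi F = theta h F).
  suff /choice [psi psiP] : forall F, exists k : K, (~~ (b \subset F) -> k = 0) /\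
    (F \in min_nonfaces D -> b \subset F -> forall h, good F h -> k = theta h F).
    by exists psi.
  move=> F.
  have [bF|bF] := boolP (b \subset F); last by exists 0.
  have [[h gh]|no] := pselect (exists h, good F h); last first.
    by exists 0; split=> // _ _ h gh; case: no; exists h.
  by exists (theta h F); split=> // Fm _ h' gh'; apply: welldef.
exists psi; split=> [F bF|h ah hD hb F G Fm Gm Fh Gh]; first exact: (psiP F).1.
have [lh|nlh] := pselect (has_link b h).
  have thE H : H \in min_nonfaces D -> H \subset h :|: b -> theta h H = psi H.
    move=> Hm Hh; have [bH|bH] := boolP (b \subset H); last by rewrite th0 // (psiP H).1.
    by rewrite ((psiP H).2 Hm bH h).
  by rewrite !thE.
(* Two different nonfaces containing [b] would give two points of [h] that form, together with [u],
   a nonface missing [v], and hence a link. *)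
suff -> : F = G by rewrite !subrr.
have sup H : H \in min_nonfaces D -> H \subset h :|: b -> b \subset H.
  by move=> Hm Hh; apply/negPn/negP => bH; apply: nlh; exists H.
have [FG|/subsetPn [x xF xG]] := boolP (F \subset G).
  by apply: (min_nonface_proper Gm) (min_nonfaceP Fm).
have [GF|/subsetPn [y yG yF]] := boolP (G \subset F).
  by symmetry; apply: (min_nonface_proper Fm) (min_nonfaceP Gm).
have bF := sup F Fm Fh; have bG := sup G Gm Gh.
have inh r (H H' : {set 'I_n}) : r \in H -> r \notin H' -> b \subset H' ->
  H \subset h :|: b -> r \in h.
  move=> rH rH' bH' Hh; have := subsetP Hh r rH; rewrite inE.
  by case/orP => // /(subsetP bH'); rewrite (negPf rH').
have xh := inh x F G xF xG bG Fh; have yh := inh y G F yG yF bF Gh.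
case: nlh; have [|H Hm Hsub] := @min_nonface_sub _ D [set x; y; u].
  rewrite inE; apply: (nonface3 dim1).
  - by apply: contraNneq xG => ->.
  - by apply: contraNneq xG => ->; apply: (subsetP bG).
  - by apply: contraNneq yF => ->; apply: (subsetP bF).
exists H => //; split.
  apply: subset_trans Hsub _; apply/subsetP => r.
  by rewrite !inE => /orP [/orP [] |] /eqP ->; rewrite ?xh ?yh ?ub ?orbT.
apply/negP => /subsetP /(_ v vb) /(subsetP Hsub).
rewrite !inE => /orP [/orP [] |] /eqP vE.
- by move: xG; rewrite -vE (subsetP bG).
- by move: yF; rewrite -vE (subsetP bF).
- by rewrite vE eqxx in uv.
Qed.

(** Two distinct minimal nonfaces over [h] must be {v, x} and {v, y} with h = {x, y} an edge between
    non-neighbours of [v]. The condition thus concerns edges only, and the forest supplies the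
    vertex values. *)
Lemma coboundary_vertex a v theta : [disjoint a & [set v]] ->
  t2_cocycle D a [set v] (theta : _ -> _ -> K) -> t2_coboundary D a [set v] theta.
Proof.
move=> av th; have [th0 _] := th.
(* Edges that do not contain [a] get the default 0, which keeps [l] antisymmetric. *)
pose l x y := if a \subset [set x; y] then
  theta [set x; y] [set v; x] - theta [set x; y] [set v; y] else 0.
have lN x y : l x y = - l y x.
  by rewrite /l [in RHS]setUC; case: ifP; rewrite ?opprB ?oppr0.
have [psi psiP] := forest v lN.
pose psi' F := if v \in F then if [pick x in F :\ v] is Some x then psi x else 0 else 0.
exists psi'; split=> [F|h ah hD hv F G Fm Gm Fh Gh].
  by rewrite sub1set /psi' => /negPf ->.
have [->|FG] := eqVneq F G; first by rewrite !subrr.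
have vh : v \notin h by rewrite -disjoints1 disjoint_sym.
have form (H H' : {set 'I_n}) : H \in min_nonfaces D -> H \subset h :|: [set v] ->
    H' \in min_nonfaces D -> H' \subset h :|: [set v] -> H' != H ->
    exists x, [/\ x \in h, ~~ adj v x & H = [set v; x]].
  move=> Hm Hh H'm H'h HH'.
  have vH : v \in H.
    apply/negPn/negP => vH; case/negP: (min_nonfaceP Hm); apply: faces_sub hD.
    apply/subsetP => r rH; have := subsetP Hh r rH; rewrite !inE => /orP [//|/eqP rv].
    by rewrite -rv rH in vH.
  have [/existsP [x /and3P [xH xv nvx]]|/existsPn none] :=
      boolP [exists x, [&& x \in H, x != v & ~~ adj v x]].
    have xh : x \in h by have := subsetP Hh x xH; rewrite !inE (negPf xv) orbF.
    exists x; split=> //; symmetry; apply: (min_nonface_proper Hm).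
      by apply/subsetP => r; rewrite !inE => /orP [] /eqP ->.
    by apply/min_nonfaceP/nonadj_min; rewrite // eq_sym.
  have Hh' x : x \in H -> x != v -> (x \in h) * adj v x.
    move=> xH xv; have := subsetP Hh x xH; rewrite !inE (negPf xv) orbF => xh.
    by have := none x; rewrite xH xv /= negbK.
  (* Otherwise [H] contains [v] and two points of [h], that is all of [h :|: [set v]], and [H'] lies
     inside it. *)
  case/eqP: HH'; apply: (min_nonface_proper Hm) (min_nonfaceP H'm).
  have vD := all_vertices v; rewrite inE in vD.
  have [x xH xv] : exists2 x, x \in H & x != v.
    have /subsetPn [x xH xv] : ~~ (H \subset [set v]).
      by apply: contra (min_nonfaceP Hm) => Hv; apply: faces_sub vD.
    by exists x => //; move: xv; rewrite inE.
  have [y yH /andP [yv yx]] : exists2 y, y \in H & (y != v) && (y != x).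
    have /subsetPn [y yH yvx] : ~~ (H \subset [set v; x]).
      apply: contra (min_nonfaceP Hm) => Hv; apply: faces_sub Hv _.
      by apply: adj_face; rewrite (Hh' x).
    by exists y => //; move: yvx; rewrite !inE negb_or.
  apply: subset_trans H'h _.
  rewrite (face_cover dim1 hD (Hh' x xH xv).1 (Hh' y yH yv).1) 1?eq_sym //.
  by apply/subsetP => r; rewrite !inE => /orP [/orP [] |] /eqP ->.
have [|x [xh nvx FE]] := form F G Fm Fh Gm Gh; first by rewrite eq_sym.
have [|y [yh nvy GE]] := form G F Gm Gh Fm Fh; first by [].
have xy : x != y by apply: contraNneq FG => xy; rewrite FE GE xy.
have hE := face_cover dim1 hD xh yh xy.
have xv : x != v by apply: contraNneq vh => <-.
have yv : y != v by apply: contraNneq vh => <-.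
have psiE z : z != v -> psi' [set v; z] = psi z.
  move=> zv; rewrite /psi' !inE eqxx; case: pickP => [r|/(_ z)].
    by rewrite !inE => /andP [/negPf -> /= /eqP ->].
  by rewrite !inE eqxx zv orbT.
rewrite FE GE !psiE // -psiP //; last exact: face_adj hD xh yh xy.
by rewrite /l -hE ah.
Qed.

Theorem T2_vanishes_graph : T2_vanishes K D.
Proof.
apply/T2_vanishes_cocycleP => a b theta ab th.
have [b0|] := posnP #|b|.
  exists (fun=> 0); split=> // h ah hD hb F G Fm Gm Fh.
  case/negP: (min_nonfaceP Fm); apply: faces_sub hD.
  by move: Fh; rewrite (cards0_eq b0) setU0.
rewrite leq_eqVlt => /orP [/eqP/esym/eqP/cards1P [v bv]|b2]; last exact: coboundary_large.
by rewrite bv in ab th *; apply: coboundary_vertex.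
Qed.

End Vanishing.

(** * Exhaustive search over graph tables *)

(* [vm_compute] evaluates both arguments of a boolean connective, so everything the
   search runs is written with conditionals, which short-circuit. *)
Fixpoint memn (x : nat) (s : seq nat) : bool :=
  if s is y :: s' then if eqn x y then true else memn x s' else false.

Fixpoint hasn (a : nat -> bool) (s : seq nat) : bool :=
  if s is x :: s' then if a x then true else hasn a s' else false.

Fixpoint alln (a : nat -> bool) (s : seq nat) : bool :=
  if s is x :: s' then if a x then alln a s' else false else true.

Lemma memnE x s : memn x s = (x \in s).
Proof. by elim: s => //= y s ->; rewrite inE -eqnE; case: eqn. Qed.

Lemma hasnE a s : hasn a s = has a s.
Proof. by elim: s => //= x s ->; case: (a x). Qed.

Lemma allnE a s : alln a s = all a s.
Proof. by elim: s => //= x s ->; case: (a x). Qed.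

Definition graph_table := seq (seq nat).

Definition neighbours (t : graph_table) (i : nat) : seq nat := nth [::] t i.

Definition add_edge (t : graph_table) (i j : nat) : graph_table :=
  let t1 := set_nth [::] t i (j :: neighbours t i) in
  set_nth [::] t1 j (i :: neighbours t1 j).

Definition labelled_edge (E : seq (nat * nat)) (i j : nat) : bool :=
  ((i.+1, j.+1) \in E) || ((j.+1, i.+1) \in E).

Definition graph_of (k : nat) (E : seq (nat * nat)) : graph_table :=
  [seq [seq j <- iota 0 k | labelled_edge E i j] | i <- iota 0 k].

Definition listed_tables : seq graph_table :=
  [seq graph_of ge.1 ge.2 | ge <- listed_graphs].

(** Backtracking: [m] lists the images chosen so far for the vertices 0, 1, ... of [t]. *)
Fixpoint iso_ext (fuel : nat) (t u : graph_table) (m : seq nat) : bool :=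
  if size m == size t then true
  else if fuel is f.+1 then
    hasn (fun y =>
      if memn y m then false
      else if alln (fun i => memn i (neighbours t (size m)) ==
                             memn (nth 0 m i) (neighbours u y)) (iota 0 (size m))
      then iso_ext f t u (rcons m y) else false) (iota 0 (size t))
  else false.

Definition isob (t u : graph_table) : bool :=
  if size t == size u then iso_ext (size t) t u [::] else false.

Definition is_listed (tabs : seq graph_table) (u : graph_table) : bool :=
  has (fun t => isob t u) tabs.

(** * Pruning tests on partially known graphs *)

Section Checks.
Variables (p : nat) (t : graph_table).
Let k := size t.
Let nb := neighbours t.

(** Deleting vertices with at most one neighbour exposes a cycle if there is one. [bad_cycle] checks
    the degrees in the result again, and soundness is drawn from that check. *)
Fixpoint two_core (fuel : nat) (W : seq nat) : seq nat :=
  if fuel is f.+1 then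
    let W' := [seq x <- W | 1 < size [seq y <- nb x | memn y W]] in
    if size W' == size W then W else two_core f W'
  else W.

(** Proposes the closed set for the connectivity conditions; [closed_nonedge] and [closed_triangle]
    verify it. *)
Fixpoint component (fuel : nat) (avoid A todo : seq nat) : seq nat :=
  if fuel is f.+1 then
    if todo is a :: todo' then
      let new := [seq q <- nb a | if memn q avoid then false else ~~ memn q A] in
      component f avoid (new ++ A) (new ++ todo')
    else A
  else A.

Definition non_neighbours v : seq nat :=
  [seq x <- iota 0 k | if eqn x v then false else ~~ memn x (nb v)].

(** The table may underestimate the degree of an incomplete [x]; this can only make the test miss a
    contradiction. *)
Definition bad_degree v : bool :=
  if 6 < k then
    if size (nb v) < 2 then true
    else 2 * size (nb v) - 2 < size [seq x <- non_neighbours v | 2 < size (nb x)]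
  else false.

Definition bad_cycle v : bool :=
  let W := two_core k (non_neighbours v) in
  if W is [::] then false
  else alln (fun x => 1 < size [seq y <- nb x | memn y W]) W.

(** Absence from [nb v] proves nonadjacency only for a complete [v], that is below [p]; the callers
    guarantee this for [u]. *)
Definition not_common u v x : bool :=
  if memn x (nb u) then if v < p then ~~ memn x (nb v) else false else true.

(** Members of [A] must be complete, since an edge not yet recorded could leave [A]. Recorded edges
    are final, so a recorded common neighbour can be trusted. *)
Definition closed_nonedge u v (A : seq nat) : bool :=
  alln (fun a => if a < p then
       if memn a [:: u; v] then false else
       alln (fun q => if memn q A then true else if memn q [:: u; v] then true
                      else if memn q (nb u) then memn q (nb v) else false) (nb a)
     else false) A.

Definition bad_nonedge u v : bool :=
  if memn v (u :: nb u) then false else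
  let avoid := u :: v :: [seq q <- nb u | memn q (nb v)] in
  hasn (fun w => if not_common u v w then if memn w avoid then false else
    let A := component k avoid [:: w] [:: w] in
    if closed_nonedge u v A then
      if memn w A then hasn (fun z => if not_common u v z
                       then ~~ memn z (u :: v :: A) else false) (iota 0 k)
      else false
    else false else false) (iota 0 p).

Definition closed_triangle b (A : seq nat) : bool :=
  alln (fun a => if a < p then if memn a b then false else
      alln (fun q => if memn q A then true else memn q b) (nb a) else false) A.

Definition bad_triangle u : bool :=
  hasn (fun v => hasn (fun w => if memn w (nb v) then
    let b := [:: u; v; w] in
    hasn (fun x =>
      let A := component k b [:: x] [:: x] in
      if closed_triangle b A then
        if memn x A then hasn (fun z => ~~ memn z (b ++ A)) (iota 0 k) else false
      else false) (iota 0 p)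
    else false) (nb u)) (nb u).

Definition bad : bool :=
  if hasn bad_degree (iota 0 p) then true
  else if hasn bad_cycle (iota 0 p) then true
  else if hasn (fun u => hasn (bad_nonedge u) (iota 0 k)) (iota 0 p) then true
  else hasn bad_triangle (iota 0 p).

End Checks.

(* In the table [t] the vertices below [p] have all their neighbours; vertex [p] is
   known to be adjacent to exactly the recorded ones among those below [q].  The
   search branches on the edge between [p] and [q], then on a further, new neighbour of
   [p]; once [p] is complete, the table is pruned by [bad].  A table without incomplete
   vertices is a union of components: either it is the whole graph, or there is a
   further vertex, which starts a new component. *)
Fixpoint search (tabs : seq graph_table) (fuel p q : nat) (t : graph_table) : bool :=
  if fuel is f.+1 then
    if q < size t then
      if search tabs f p q.+1 t then
        if memn q (neighbours t p) then true
        else if 2 < size (neighbours t p) then true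
        else if 2 < size (neighbours t q) then true
        else search tabs f p q.+1 (add_edge t p q)
      else false
    else
      if (if 2 < size (neighbours t p) then true
          else search tabs f p (size t).+1 (add_edge (rcons t [::]) p (size t)))
      then
        if bad p.+1 t then true
        else if p.+1 < size t then search tabs f p.+1 p.+2 t
        else if is_listed tabs t
             then search tabs f p.+1 (size t).+1 (rcons t [::])
             else false
      else false
  else false.

(** The start is a single edge, present in every one-dimensional complex. The fuel 400 bounds the
    depth of the recursion; running out would give [false]. *)
Lemma search_initial : search listed_tables 400 0 1 [:: [:: 1]; [:: 0]].
Proof. by vm_cast_no_check (erefl true). Qed.

(** * Soundness of the search *)

Section Isomorphism.

Definition partial_iso (t u : graph_table) (m : seq nat) : Prop :=
  [/\ uniq m, size m <= size t, {in m, forall y, y < size t} &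
      forall i j, i < j < size m ->
        (i \in neighbours t j) = (nth 0 m i \in neighbours u (nth 0 m j))].

Lemma iso_extP f t u m : iso_ext f t u m -> partial_iso t u m ->
  exists2 M, partial_iso t u M & size M = size t.
Proof.
elim: f m => [|f IH] m /=; case: ifP => [/eqP sm _ pm|sm] //; try by exists m.
rewrite hasnE => /hasP [y]; rewrite mem_iota add0n => /andP [_ yt].
rewrite memnE; case: ifP => // ym; rewrite allnE; case: ifP => // /allP adj_m.
move=> /IH ext [um lem mt mE]; apply: ext; split.
- by rewrite rcons_uniq ym um.
- by rewrite size_rcons ltn_neqAle sm lem.
- by move=> z; rewrite mem_rcons inE => /orP [/eqP ->|/mt].
move=> i j; rewrite size_rcons !nth_rcons => /andP [ij].
rewrite ltnS leq_eqVlt => /orP [/eqP jm|jm]; last first.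
  by rewrite jm (ltn_trans ij jm); apply: mE; rewrite ij.
rewrite jm ltnn eqxx -jm ij; have := adj_m i; rewrite mem_iota -jm ij !memnE.
by move=> /(_ isT) /eqP.
Qed.

(** The backtracking can follow [M] from any of its prefixes. This completeness serves to tell the
    listed graphs apart, while the search relies on [iso_extP]. *)
Lemma iso_ext_complete t u M k : partial_iso t u M -> size M = size t ->
  k <= size t -> iso_ext k t u (take (size t - k) M).
Proof.
move=> [uM _ Mt ME] sM; elim: k => [|k IH] kt.
  by rewrite subn0 /= -sM take_size eqxx.
have lt : size t - k.+1 < size M by rewrite sM; lia.
have st : size (take (size t - k.+1) M) = size t - k.+1 by rewrite size_takel // ltnW.
rewrite /= st; case: ifP => // _; rewrite hasnE; apply/hasP.
exists (nth 0 M (size t - k.+1)); first by rewrite mem_iota /= Mt // mem_nth.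
rewrite memnE; case: ifP => [|_].
  have := take_uniq (size t - k.+1).+1 uM; rewrite (take_nth 0 lt) rcons_uniq.
  by move=> /andP [/negPf ->].
rewrite allnE; case: ifP => [_|/allPn [i]].
  rewrite -take_nth // (_ : (size t - k.+1).+1 = size t - k); last by lia.
  by apply: IH; lia.
rewrite mem_iota /= => it; rewrite !memnE nth_take // ME ?eqxx //.
by rewrite it.
Qed.

End Isomorphism.

Lemma size_uniq_le_card (T : finType) (l : seq T) (A : {set T}) :
  uniq l -> {subset l <= A} -> size l <= #|A|.
Proof.
by move=> /card_uniqP <- lA; apply: subset_leq_card; apply/subsetP.
Qed.

Lemma card_le_size (T : finType) (l : seq T) (A : {set T}) :
  {subset A <= l} -> #|A| <= size l.
Proof.
by move=> Al; apply: leq_trans (card_size l); apply: subset_leq_card; apply/subsetP.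
Qed.

Lemma two_core_sub t f W : {subset two_core t f W <= W} /\ (uniq W -> uniq (two_core t f W)).
Proof.
elim: f W => [|f IH] W /=; first by split=> [x|].
set W' := filter _ W; case: ifP => _; first by split=> [x|].
have [sub uq] := IH W'.
split=> [x /sub|uW]; first by rewrite mem_filter => /andP [].
by apply/uq/filter_uniq.
Qed.

Lemma size_add_edge t i j : i < size t -> j < size t -> size (add_edge t i j) = size t.
Proof. by move=> it jt; rewrite /add_edge !size_set_nth !maxnE; lia. Qed.

Lemma neighbours_add_edge t i j l : i != j ->
  neighbours (add_edge t i j) l =
    if l == j then i :: neighbours t j
    else if l == i then j :: neighbours t i else neighbours t l.
Proof.
move=> ij; rewrite /neighbours /add_edge nth_set_nth /= nth_set_nth /=.
by rewrite /neighbours nth_set_nth /= eq_sym [j == i]eq_sym (negPf ij).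
Qed.

Lemma neighbours_rcons t l : neighbours (rcons t [::]) l = neighbours t l.
Proof.
rewrite /neighbours nth_rcons; case: ltngtP => // [gt|->].
  by rewrite nth_default // ltnW.
by rewrite nth_default.
Qed.

(** * Graphs satisfying the necessary conditions *)

Section GoodGraph.
Variables (T : finType) (V : {set T}) (e : rel T).
Hypothesis e_sym : forall x y, e x y = e y x.
Hypothesis e_irr : irreflexive e.
Hypothesis eV : forall x y, e x y -> y \in V.

Definition nbh x : {set T} := [set y | e x y].

Hypothesis degree3 : forall x, #|nbh x| <= 3.
Hypothesis forest : forall v (W : {set T}), v \in V -> W \subset V -> v \notin W ->
  (forall x, x \in W -> ~~ e v x) -> W != set0 ->
  \sum_(x in W) #|[set y in W | e x y]| <= 2 * (#|W|).-1.
Hypothesis nonedge_conn : forall u v (A : {set T}) x z,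
  u \in V -> v \in V -> u != v -> ~~ e u v -> u \notin A -> v \notin A ->
  (forall p q, p \in A -> e p q -> [|| q \in A, q == u, q == v | e q u && e q v]) ->
  x \in A -> x \in V -> ~~ (e x u && e x v) ->
  z \notin A -> z \in V -> z != u -> z != v -> ~~ (e z u && e z v) -> False.
Hypothesis triangle_conn : forall u v w (A : {set T}) x z,
  e u v -> e u w -> e v w -> [disjoint A & [set u; v; w]] ->
  (forall p q, p \in A -> e p q -> (q \in A) || (q \in [set u; v; w])) ->
  x \in A -> x \in V -> z \notin A -> z \in V -> z \notin [set u; v; w] -> False.

Lemma in_nbh x y : (y \in nbh x) = e x y.
Proof. by rewrite inE. Qed.

(** Suppose [w] has no neighbour except possibly [x]. Removing [w], [x] and the at most three
    neighbours of [x] from seven vertices leaves two, [u] and [z]. For the nonadjacent pair [x],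
    [u], the set {w} is then cut off from [z]. *)
Lemma min_degree2 w : 6 < #|V| -> w \in V -> 1 < #|nbh w|.
Proof.
move=> V7 wV; rewrite ltnNge; apply/negP => deg1.
have [x xV [xw Nw]] : exists2 x, x \in V & x != w /\ forall y, e w y -> y = x.
  have [N0|[x xN]] := set_0Vmem (nbh w).
    have /set0Pn [x] : V :\ w != set0.
      by rewrite -card_gt0; move: V7; rewrite (cardsD1 w) wV; lia.
    rewrite !inE => /andP [xw xV]; exists x => //; split=> // y.
    by rewrite -in_nbh N0 inE.
  rewrite in_nbh in xN; exists x; first exact: eV xN.
  split; first by apply: contraTneq xN => ->; rewrite e_irr.
  by move=> y wy; move/card_le1_eqP: deg1 => all_eq; apply: all_eq; rewrite in_nbh.
pose S := V :\: ([set w; x] :|: nbh x).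
have S2 : 1 < #|S|.
  have : #|[set w; x] :|: nbh x| <= 5.
    by rewrite (leq_trans (leq_card_setU _ _)) // cards2 (leq_add (leq_b1 _ : _.+1 <= 2))
      ?degree3.
  have := cardsID ([set w; x] :|: nbh x) V.
  have := subset_leq_card (subsetIr V ([set w; x] :|: nbh x)).
  rewrite -/S; lia.
have /card_gt1P [u [z [uS zS uz]]] := S2.
move: uS zS; rewrite !inE !negb_or -!andbA => /and4P [uw ux nxu uV] /and4P [zw zx nxz zV].
have nwu : ~~ e w u by apply/negP => /Nw uE; rewrite uE eqxx in ux.
apply: (@nonedge_conn x u [set w] w z) => //; rewrite ?inE ?eqxx // 1?eq_sym //.
- by move=> p q; rewrite inE => /eqP -> /Nw ->; rewrite eqxx orbT.
- by rewrite (negPf nwu) andbF.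
- by rewrite e_sym (negPf nxz).
Qed.

(** Sum the degrees over the set [F] of non-neighbours. Edges inside [F] contribute at most 2|F| -
    2, and edges to neighbours of [v] at most 2 deg(v), since each such neighbour spends one of its
    three edges on [v]. On the other side every degree is at least two. *)
Lemma degree3_count v : 6 < #|V| -> v \in V ->
  #|[set x in V | [&& x != v, ~~ e v x & 2 < #|nbh x|]]| <= 2 * #|nbh v| - 2.
Proof.
move=> V7 vV; pose F := V :\: (v |: nbh v).
have inF x : (x \in F) = [&& x \in V, x != v & ~~ e v x].
  by rewrite !inE negb_or andbC.
have F0 : 0 < #|F|.
  have := cardsID (v |: nbh v) V; have := subset_leq_card (subsetIr V (v |: nbh v)).
  have : #|v |: nbh v| <= 4.
    by rewrite cardsU1; have := degree3 v; case: (v \notin nbh v) => /=; lia.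
  rewrite -/F; lia.
have eF : \sum_(x in F) #|[set y in F | e x y]| <= 2 * (#|F|).-1.
  apply: (forest vV); first exact: subsetDl.
  - by rewrite inF eqxx andbF.
  - by move=> x; rewrite inF => /and3P [].
  - by rewrite -card_gt0.
have card_sum (A B : {set T}) : #|A :&: B| = \sum_(y in B) (y \in A).
  rewrite -sum1_card big_mkcond [RHS]big_mkcond; apply: eq_bigr => y _.
  by rewrite inE andbC; case: (y \in B); case: (y \in A).
have cross : \sum_(x in F) #|nbh x :&: nbh v| <= 2 * #|nbh v|.
  have -> : \sum_(x in F) #|nbh x :&: nbh v| = \sum_(y in nbh v) #|nbh y :&: F|.
    under eq_bigr do rewrite card_sum; rewrite exchange_big /=.
    by apply: eq_bigr => y _; rewrite card_sum; apply: eq_bigr => x _; rewrite !in_nbh e_sym.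
  rewrite mulnC -sum_nat_const; apply: leq_sum => y vy.
  have : v \in nbh y by rewrite in_nbh e_sym -in_nbh.
  have := degree3 y; rewrite (cardsD1 v) => d3 yv; rewrite yv in d3.
  have : #|nbh y :&: F| <= #|nbh y :\ v|; last by move: d3; lia.
  apply: subset_leq_card; apply/subsetP => x; rewrite inE inF => /and4P [yx _ xv _].
  by rewrite !inE xv -in_nbh.
have degE x : x \in F -> #|nbh x| = #|[set y in F | e x y]| + #|nbh x :&: nbh v|.
  rewrite inF => /and3P [xV xv nvx].
  rewrite -(cardsID (nbh v) (nbh x)) addnC; congr (_ + _); apply: eq_card => y.
  rewrite !inE negb_or; case exy: (e x y); rewrite ?andbF // !andbT.
  rewrite (eV exy) andbT; case: eqP => //= yv.
  by move: nvx; rewrite -yv e_sym exy.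
have lower : 2 * #|F| + #|[set x in V | [&& x != v, ~~ e v x & 2 < #|nbh x|]]| <=
    \sum_(x in F) #|nbh x|.
  have -> : [set x in V | [&& x != v, ~~ e v x & 2 < #|nbh x|]] =
      [set x | 2 < #|nbh x|] :&: F.
    by apply/setP => x; rewrite !inE negb_or; do !case: (_ \in _);
      do !case: (_ == _) => //=; case: (e v x); rewrite ?andbF ?andbT.
  rewrite card_sum mulnC -sum_nat_const -big_split /=; apply: leq_sum => x.
  rewrite inF => /and3P [xV _ _]; rewrite inE; have := min_degree2 V7 xV.
  by case: ltnP => /=; lia.
have upper : \sum_(x in F) #|nbh x| <= 2 * (#|F|).-1 + 2 * #|nbh v|.
  rewrite (eq_bigr (fun x => #|[set y in F | e x y]| + #|nbh x :&: nbh v|)) //.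
  by rewrite big_split; apply: leq_add.
lia.
Qed.

(** * Partial tables realised in a graph *)

Section States.
Variable x0 : T.
Local Notation S s i := (nth x0 s i).

(** A recorded adjacency is always genuine; a missing one is evidence of nonadjacency only if an
    endpoint lies below [p]. *)
Record realises (p : nat) (t : graph_table) (s : seq T) : Prop := Realises {
  real_uniq : uniq s;
  real_size : size s = size t;
  real_V : {subset s <= V};
  real_nb_uniq : forall i, uniq (neighbours t i);
  real_nb : forall i j, j \in neighbours t i ->
    [/\ i < size t, j < size t, e (S s i) (S s j) & i \in neighbours t j];
  real_full : forall i y, i < p -> e (S s i) y ->
    exists2 j, j \in neighbours t i & y = S s j
}.

Section Bad.
Variables (p : nat) (t : graph_table) (s : seq T).
Hypothesis rl : realises p t s.
Hypothesis p_le : p <= size t.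
Local Notation k := (size t).
Local Notation nb := (neighbours t).

Lemma realises_inj i j : i < k -> j < k -> S s i = S s j -> i = j.
Proof.
case: rl => us ss _ _ _ _ ik jk /eqP.
by rewrite nth_uniq ?ss // => /eqP.
Qed.

Lemma realises_in i : i < k -> S s i \in V.
Proof. by case: rl => us ss sV _ _ _ ik; apply/sV/mem_nth; rewrite ss. Qed.

Lemma realises_adj i j : i < p -> j < k -> e (S s i) (S s j) = (j \in nb i).
Proof.
move=> ip jk; apply/idP/idP => [/(real_full rl ip) [j' j'i jj']|/(real_nb rl) []//].
by have [_ j'k _ _] := real_nb rl j'i; rewrite (realises_inj jk j'k jj').
Qed.

Lemma map_realises_uniq W : uniq W -> {in W, forall i, i < k} ->
  uniq [seq S s i | i <- W].
Proof.
move=> uW Wk; rewrite map_inj_in_uniq // => i j iW jW.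
by apply: realises_inj; apply: Wk.
Qed.

Lemma map_realises_sub i W : uniq W -> {subset W <= nb i} ->
  uniq [seq S s j | j <- W] /\ {subset [seq S s j | j <- W] <= nbh (S s i)}.
Proof.
move=> uW Wi; split.
  by apply: map_realises_uniq => // j /Wi /(real_nb rl) [].
by move=> y /mapP [j /Wi /(real_nb rl) [_ _ eij _] ->]; rewrite in_nbh.
Qed.

Lemma size_nb_le i : size (nb i) <= #|nbh (S s i)|.
Proof.
have [u1 s1] := map_realises_sub (real_nb_uniq rl i) (fun _ => id).
by rewrite -(size_map (fun j => S s j)); apply: size_uniq_le_card.
Qed.

Lemma nbh_sub i : i < p -> {subset nbh (S s i) <= [seq S s j | j <- nb i]}.
Proof.
by move=> ip y; rewrite in_nbh => /(real_full rl ip) [j ji ->]; apply: map_f.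
Qed.

Lemma card_nbh i : i < p -> #|nbh (S s i)| <= size (nb i).
Proof.
by move=> ip; rewrite -(size_map (fun j => S s j)); apply/card_le_size/nbh_sub.
Qed.

Lemma mem_non_neighbours v x : (x \in non_neighbours t v) =
  [&& x < k, x != v & x \notin nb v].
Proof.
rewrite mem_filter mem_iota /= add0n andbC -eqnE memnE.
by case: (eqn x v); case: (x < k).
Qed.

Lemma bad_degreeF v : v < p -> ~~ bad_degree t v.
Proof.
move=> vp; have vk := leq_trans vp p_le; rewrite /bad_degree; case: ifP => // k7.
have V7 : 6 < #|V|.
  apply: leq_trans k7 _; rewrite -(real_size rl); apply: size_uniq_le_card.
    exact: real_uniq rl.
  exact: real_V rl.
have vV := realises_in vk; have := min_degree2 V7 vV; have := card_nbh vp.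
move=> le1 le2; rewrite ltnNge (leq_trans le2 le1) /= -leqNgt.
have := degree3_count V7 vV; have := size_nb_le v.
set W := [seq x <- _ | _]; set X := [set x in V | _] => le3 le4.
suff : size W <= #|X| by move: le4 le3 le1; lia.
have Wk x : x \in W -> [&& x < k, x != v, x \notin nb v & 2 < size (nb x)].
  by rewrite mem_filter mem_non_neighbours => /andP [-> /and3P [-> -> ->]].
rewrite -(size_map (fun j => S s j)); apply: size_uniq_le_card.
  apply: map_realises_uniq; first by rewrite !filter_uniq ?iota_uniq.
  by move=> x /Wk /and4P [].
move=> y /mapP [x /Wk /and4P [xk xv xnv d3] ->]; rewrite !inE realises_in //=.
rewrite realises_adj // xnv (leq_trans d3 (size_nb_le x)) !andbT.
by apply: contraNneq xv => /realises_inj ->.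
Qed.

Lemma bad_cycleF v : v < p -> ~~ bad_cycle t v.
Proof.
move=> vp; have vk := leq_trans vp p_le; rewrite /bad_cycle.
have [sub uq] := two_core_sub t k (non_neighbours t v).
set W := two_core _ _ _ in sub uq *.
have uW : uniq W by apply: uq; rewrite filter_uniq ?iota_uniq.
have Wk x : x \in W -> [&& x < k, x != v & x \notin nb v].
  by move=> /sub; rewrite mem_non_neighbours.
(* From here [W] is any duplicate-free list of non-neighbours; its inner degrees, all at least two,
   add up to more than a forest allows. *)
move: uW Wk {sub uq}; clearbody W; case: W => [//|w0 W0]; set W := w0 :: W0 => uW Wk.
rewrite allnE; apply/negP => /allP Wdeg.
pose X := [set y in [seq S s x | x <- W]].
have uX : uniq [seq S s x | x <- W] by apply: map_realises_uniq => // x /Wk /and3P [].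
have cX : #|X| = size W by rewrite cardsE (card_uniqP uX) size_map.
have inX x : x \in W -> S s x \in X by move=> xW; rewrite inE map_f.
have : \sum_(x in X) #|[set y in X | e x y]| <= 2 * (#|X|).-1.
  apply: (forest (realises_in vk)).
  - by apply/subsetP => y; rewrite inE => /mapP [x /Wk /and3P [xk _ _] ->]; apply: realises_in.
  - rewrite inE; apply/mapP => -[x /Wk /and3P [xk xv _] /realises_inj vx].
    by rewrite vx ?eqxx in xv.
  - move=> y; rewrite inE => /mapP [x /Wk /and3P [xk _ xnv] ->].
    by rewrite realises_adj.
  - by apply/set0Pn; exists (S s w0); apply: inX; rewrite inE eqxx.
apply/negP; rewrite -ltnNge; apply: (@leq_trans (#|X| * 2)).
  by rewrite cX /=; lia.
rewrite -sum_nat_const; apply: leq_sum => y; rewrite inE => /mapP [x xW ->].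
have /= := Wdeg x xW; set Y := [seq y <- _ | _] => dY; apply: leq_trans dY _.
have [uY sY] : uniq [seq S s j | j <- Y] /\ {subset [seq S s j | j <- Y] <= nbh (S s x)}.
  apply: map_realises_sub; first by rewrite filter_uniq // (real_nb_uniq rl).
  by move=> j; rewrite mem_filter => /andP [].
rewrite -(size_map (fun j => S s j)); apply: size_uniq_le_card => // z zY.
rewrite inE -in_nbh sY // andbT; move: zY => /mapP [j].
by rewrite mem_filter memnE => /andP [/inX jX _ ->].
Qed.

Lemma not_commonP u v x : u < p -> v < k -> x < k -> not_common p t u v x ->
  ~~ (e (S s x) (S s u) && e (S s x) (S s v)).
Proof.
move=> up vk xk; rewrite /not_common !memnE negb_and.
case: ifP => [_|/negbT xu _]; last by rewrite e_sym realises_adj ?xu.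
by case: ifP => // vp xv; rewrite [e _ (S s v)]e_sym (realises_adj vp) // xv orbT.
Qed.

Lemma bad_nonedgeF u v : u < p -> v < k -> ~~ bad_nonedge p t u v.
Proof.
move=> up vk; have uk := leq_trans up p_le; rewrite /bad_nonedge memnE inE.
case: ifP => // /negbT; rewrite negb_or => /andP [vu nvu].
rewrite hasnE; apply/hasPn => w; rewrite mem_iota add0n => /andP [_ wp].
have wk := leq_trans wp p_le.
case: ifP => // wC; case: ifP => // _; set A := component _ _ _ _ _.
case: ifP => //; rewrite /closed_nonedge allnE => /allP closedA.
rewrite memnE; case: ifP => // wA; rewrite hasnE; apply/hasPn => z.
rewrite mem_iota add0n => /andP [_ zk]; case: ifP => // zC; rewrite memnE negbK.
rewrite !inE; apply/negPn/negP; rewrite !negb_or => /and3P [zu zv zA].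
have Ap a : a \in A -> [/\ a < p, a != u, a != v & forall q, q \in nb a ->
    [|| q \in A, q == u, q == v | (q \in nb u) && (q \in nb v)]].
  move=> /closedA; case: ifP => // ap; rewrite memnE !inE; case: ifP => // /negbT.
  rewrite negb_or => /andP [au av]; rewrite allnE => /allP nba; split=> //.
  move=> q /nba; rewrite !memnE !inE; case: (q \in A) => //; case: (q == u) => //;
    case: (q == v) => //=.
have inA a : a < k -> (S s a \in [set y in [seq S s x | x <- A]]) = (a \in A).
  move=> ak; rewrite inE; apply/mapP/idP => [[b bA ab]|aA]; last by exists a.
  have [bp _ _ _] := Ap b bA.
  by rewrite (realises_inj ak (leq_trans bp p_le) ab).
have Sneq i j : i < k -> j < k -> i != j -> S s i != S s j.
  by move=> ik jk; apply: contraNneq => /realises_inj ->.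
apply: (@nonedge_conn (S s u) (S s v) [set y in [seq S s x | x <- A]] (S s w) (S s z)).
- exact: realises_in.
- exact: realises_in.
- by apply: Sneq => //; rewrite eq_sym.
- by rewrite realises_adj.
- by rewrite inA //; apply/negP => /Ap [_ /eqP].
- by rewrite inA //; apply/negP => /Ap [_ _ /eqP].
- move=> a q; rewrite inE => /mapP [i iA ->].
  have [ip _ _ nbi] := Ap i iA; move=> /(real_full rl ip) [j ji ->].
  have [_ jk _ _] := real_nb rl ji.
  have := nbi j ji; rewrite inA // => /or4P [->//|/eqP ->|/eqP ->|/andP [ju jv]];
    rewrite ?eqxx ?orbT //.
  have [_ _ euj _] := real_nb rl ju; have [_ _ evj _] := real_nb rl jv.
  by rewrite ![e (S s j) _]e_sym euj evj !orbT.
- by rewrite inA.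
- exact: realises_in.
- exact: not_commonP.
- by rewrite inA.
- exact: realises_in.
- exact: Sneq.
- exact: Sneq.
- exact: not_commonP.
Qed.

Lemma bad_triangleF u : ~~ bad_triangle p t u.
Proof.
rewrite /bad_triangle hasnE; apply/hasPn => v vu; rewrite hasnE; apply/hasPn => w wu.
rewrite memnE; case: ifP => // wv; rewrite hasnE; apply/hasPn => x.
rewrite mem_iota add0n => /andP [_ xp]; have xk := leq_trans xp p_le.
set A := component _ _ _ _ _; case: ifP => //.
rewrite /closed_triangle allnE => /allP closedA.
rewrite memnE; case: ifP => // xA; rewrite hasnE; apply/hasPn => z.
rewrite mem_iota add0n => /andP [_ zk]; rewrite memnE negbK mem_cat.
apply/negPn/negP; rewrite negb_or => /andP [zb zA].
have Ap a : a \in A -> [/\ a < p, a \notin [:: u; v; w] & forall q, q \in nb a ->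
    (q \in A) || (q \in [:: u; v; w])].
  move=> /closedA; case: ifP => // ap; rewrite memnE; case: ifP => // /negbT ab.
  rewrite allnE => /allP nba; split=> // q /nba; rewrite !memnE.
  by case: (q \in A).
have inA a : a < k -> (S s a \in [set y in [seq S s x | x <- A]]) = (a \in A).
  move=> ak; rewrite inE; apply/mapP/idP => [[b bA ab]|aA]; last by exists a.
  have [bp _ _] := Ap b bA.
  by rewrite (realises_inj ak (leq_trans bp p_le) ab).
have [uk vk euv _] := real_nb rl vu; have [_ wk euw _] := real_nb rl wu.
have [_ _ evw _] := real_nb rl wv.
have inb i : i < k -> (S s i \in [set S s u; S s v; S s w]) = (i \in [:: u; v; w]).
  move=> ik; rewrite !inE -!orbA.
  by congr [|| _, _ | _]; apply/eqP/eqP => [|-> //]; apply: realises_inj.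
apply: (@triangle_conn (S s u) (S s v) (S s w) [set y in [seq S s x | x <- A]] (S s x) (S s
  z)) => //.
- rewrite disjoint_subset; apply/subsetP => y; rewrite inE => /mapP [i iA ->].
  by have [ip ib _] := Ap i iA; rewrite inE inb // (leq_trans ip).
- move=> a q; rewrite inE => /mapP [i iA ->].
  have [ip _ nbi] := Ap i iA; move=> /(real_full rl ip) [j ji ->].
  have [_ jk _ _] := real_nb rl ji.
  by rewrite inA // inb //; apply: nbi.
- by rewrite inA.
- exact: realises_in.
- by rewrite inA.
- exact: realises_in.
- by rewrite inb.
Qed.

Lemma badF : ~~ bad p t.
Proof.
rewrite /bad !hasnE; case: ifP => [/hasP [v]|_].
  by rewrite mem_iota => /andP [_ vp] /(negP (bad_degreeF vp)).
case: ifP => [/hasP [v]|_].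
  by rewrite mem_iota => /andP [_ vp] /(negP (bad_cycleF vp)).
case: ifP => [/hasP [u]|_].
  rewrite mem_iota => /andP [_ up]; rewrite hasnE => /hasP [v].
  by rewrite mem_iota => /andP [_ vk] /(negP (bad_nonedgeF up vk)).
by apply/hasPn => u _; apply: bad_triangleF.
Qed.

End Bad.

Lemma realises_add p t s i j : realises p t s -> i < size t -> j < size t ->
  e (S s i) (S s j) -> j \notin neighbours t i -> realises p (add_edge t i j) s.
Proof.
move=> rl it jt eij nij; have ij : i != j by apply: contraTneq eij => ->; rewrite e_irr.
have nji : i \notin neighbours t j by apply: contra nij => /(real_nb rl) [].
split.
- exact: real_uniq rl.
- by rewrite size_add_edge // (real_size rl).
- exact: real_V rl.
- move=> l; rewrite neighbours_add_edge //; case: eqP => [_|_].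
    by rewrite /= nji (real_nb_uniq rl).
  by case: eqP => [_|_]; rewrite /= ?nij (real_nb_uniq rl).
- move=> a b; rewrite size_add_edge // !neighbours_add_edge //.
  have old : b \in neighbours t a -> [/\ a < size t, b < size t, e (S s a) (S s b)
      & a \in (if b == j then i :: neighbours t j
               else if b == i then j :: neighbours t i else neighbours t b)].
    move=> /(real_nb rl) [at_ bt eab ab]; split=> //.
    by case: eqP ab => [->|_]; [rewrite inE => ->; rewrite orbT|case: eqP => [->|//];
      rewrite inE => ->; rewrite orbT].
  have [aj|aj] := eqVneq a j.
    rewrite inE => /orP [/eqP ->|bj]; last by apply: old; rewrite aj.
    by rewrite (negPf ij) eqxx aj inE eqxx e_sym.
  have [ai|ai] := eqVneq a i; last exact: old.
  rewrite inE => /orP [/eqP ->|bi]; last by apply: old; rewrite ai.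
  by rewrite eqxx ai inE eqxx.
move=> l y lp ely; have [b bl ->] := real_full rl lp ely; exists b => //.
rewrite neighbours_add_edge //; case: eqP bl => [->|_]; first by rewrite inE => ->;
  rewrite orbT.
by case: eqP => [->|//]; rewrite inE => ->; rewrite orbT.
Qed.

Lemma realises_rcons p t s y : p <= size t -> realises p t s -> y \in V -> y \notin s ->
  realises p (rcons t [::]) (rcons s y).
Proof.
move=> pt rl yV ys; have ss := real_size rl; split.
- by rewrite rcons_uniq ys (real_uniq rl).
- by rewrite !size_rcons ss.
- by move=> z; rewrite mem_rcons inE => /orP [/eqP ->|/(real_V rl)].
- by move=> i; rewrite neighbours_rcons (real_nb_uniq rl).
- move=> i j; rewrite !neighbours_rcons !size_rcons => /(real_nb rl) [it jt eij ji].
  by rewrite !nth_rcons ss it jt !ltnS (ltnW it) (ltnW jt).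
move=> i z ip; rewrite nth_rcons ss (leq_trans ip pt) => /(real_full rl ip) [j ji ->].
exists j; first by rewrite neighbours_rcons.
by have [_ jt _ _] := real_nb rl ji; rewrite nth_rcons ss jt.
Qed.

Definition listed_copy : Prop :=
  exists2 ge, ge \in (listed_graphs : seq _) & exists s : seq T,
    [/\ size s = ge.1, uniq s, s =i V
      & forall i j, i < j < ge.1 -> e (S s i) (S s j) = labelled_edge ge.2 i j].

Lemma is_listedP t s : realises (size t) t s -> s =i V ->
  is_listed listed_tables t -> listed_copy.
Proof.
move=> rl sV /hasP [_ /mapP [ge gel ->]]; rewrite /isob; case: ifP => // /eqP sz.
move=> /iso_extP []; first by split=> // i j; rewrite ltn0 andbF.
have gs : size (graph_of ge.1 ge.2) = ge.1 by rewrite size_map size_iota.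
rewrite {}gs in sz *; move=> M [uM _ Mk ME] sM; exists ge => //.
exists [seq S s i | i <- M].
have Mk' : {in M, forall y, y < size t} by move=> y /Mk; rewrite -sz size_map size_iota.
have uS := map_realises_uniq rl uM Mk'.
split=> //.
- by rewrite size_map sM.
- have sub : {subset [seq S s i | i <- M] <= s}.
    by move=> y /mapP [i /Mk' it ->]; rewrite mem_nth // (real_size rl).
  have le : size s <= size [seq S s i | i <- M].
    by rewrite size_map sM (real_size rl) sz.
  by have [_ E] := uniq_min_size uS sub le; move=> y; rewrite E sV.
move=> i j /andP [ij jk]; have ik := ltn_trans ij jk.
have Mi l : l < ge.1 -> nth 0 M l < size t by move=> lk; apply/Mk'/mem_nth; rewrite sM.
rewrite !(nth_map 0) ?sM // (realises_adj rl) ?Mi //.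
have -> : (nth 0 M j \in neighbours t (nth 0 M i)) = (nth 0 M i \in neighbours t (nth 0 M j)).
  by apply/idP/idP => /(real_nb rl) [].
rewrite -ME ?ij ?sM //= /neighbours /graph_of (nth_map 0) ?size_iota // nth_iota //.
by rewrite mem_filter mem_iota /= ik andbT /labelled_edge orbC.
Qed.

(** All branches of the run succeeded, so one may follow the branch that the actual graph dictates.
    On it no pruning test can fire, by [badF] and the degree bound, and the fuel cannot run out;
    what remains is the exit through [is_listed]. *)
Lemma search_sound f p q t s : search listed_tables f p q t -> realises p t s ->
  p < size t ->
  (forall j, j < q -> j < size t -> e (S s p) (S s j) -> j \in neighbours t p) ->
  listed_copy.
Proof.
elim: f p q t s => [//|f IH] p q t s /= run rl pt known.
have ss := real_size rl; have us := real_uniq rl.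
(* A neighbour not yet recorded leaves room for at most two recorded ones, so the degree cut-offs do
   not apply on the branch followed. *)
have deg l y : l < size t -> e (S s l) y -> y \notin [seq S s j | j <- neighbours t l] ->
    size (neighbours t l) <= 2.
  move=> lt ely yN.
  have nbs : {in neighbours t l, forall j, j < size t} by move=> j /(real_nb rl) [].
  rewrite -ltnS; apply: leq_trans (degree3 (S s l)).
  rewrite -(size_map (fun j => S s j)) -[_.+1]/(size (y :: _)).
  apply: (@size_uniq_le_card _ (y :: [seq S s j | j <- neighbours t l])).
    by rewrite /= yN; apply: (map_realises_uniq rl); rewrite ?(real_nb_uniq rl).
  move=> z; rewrite inE => /orP [/eqP ->|]; first by rewrite in_nbh.
  by have [_ sub] := map_realises_sub rl (real_nb_uniq rl l) (fun _ => id); apply: sub.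
have notin l j : l < size t -> j < size t -> j \notin neighbours t l ->
    S s j \notin [seq S s i | i <- neighbours t l].
  move=> lt jt; apply: contra => /mapP [i il ji].
  by have [_ it _ _] := real_nb rl il; rewrite (realises_inj rl jt it ji).
have step j : j < q.+1 -> j < size t -> e (S s p) (S s j) ->
    (j == q) || (j \in neighbours t p).
  by rewrite ltnS leq_eqVlt => /orP [-> //|jq] jt ej; rewrite known ?orbT.
move: run; case: (ltnP q (size t)) => [qt|tq].
  case: ifP => // run1; rewrite memnE.
  have [epq|nepq] := boolP (e (S s p) (S s q)); last first.
    move=> _; apply: (IH _ _ _ _ run1 rl pt) => j jq jt ej.
    by case/orP: (step j jq jt ej) => // /eqP jE; rewrite -jE ej in nepq.
  case: ifP => [qp _|/negbT nqp].
    apply: (IH _ _ _ _ run1 rl pt) => j jq jt ej.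
    by case/orP: (step j jq jt ej) => // /eqP ->.
  have npq : p \notin neighbours t q by apply: contra nqp => /(real_nb rl) [].
  have eqp : e (S s q) (S s p) by rewrite e_sym.
  rewrite ltnNge (deg p _ pt epq (notin p q pt qt nqp)) /=.
  rewrite ltnNge (deg q _ qt eqp (notin q p qt pt npq)) /= => run2.
  have pq : p != q by apply: contraTneq epq => ->; rewrite e_irr.
  apply: (IH _ _ _ _ run2 (realises_add rl pt qt epq nqp)).
    by rewrite size_add_edge.
  rewrite size_add_edge // => j jq jt ej; rewrite neighbours_add_edge // (negPf pq) eqxx inE.
  exact: step.
case: ifP => // run1.
have [/existsP [y /andP [epy ys]]|/existsPn none] :=
    boolP [exists y, e (S s p) y && (y \notin s)].
  have yN : y \notin [seq S s j | j <- neighbours t p].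
    apply: contra ys => /mapP [j /(real_nb rl) [_ jt _ _] ->].
    by rewrite mem_nth // ss.
  move=> _; move: run1; rewrite ltnNge (deg p y pt epy yN) /= => run1.
  have rl' := realises_rcons (ltnW pt) rl (eV epy) ys.
  have Sp : S (rcons s y) p = S s p by rewrite nth_rcons ss pt.
  have Sy : S (rcons s y) (size t) = y by rewrite nth_rcons ss ltnn eqxx.
  have npt : size t \notin neighbours (rcons t [::]) p.
    by rewrite neighbours_rcons; apply/negP => /(real_nb rl) [_]; rewrite ltnn.
  have pk : p != size t by rewrite neq_ltn pt.
  have rl2 : realises p (add_edge (rcons t [::]) p (size t)) (rcons s y).
    by apply: realises_add; rewrite ?size_rcons ?ltnS ?(ltnW pt) ?leqnn // Sp Sy.
  have sz2 : size (add_edge (rcons t [::]) p (size t)) = (size t).+1.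
    by rewrite size_add_edge size_rcons ?ltnS ?(ltnW pt).
  apply: (IH _ _ _ _ run1 rl2); rewrite sz2; first by rewrite ltnS ltnW.
  move=> j _; rewrite ltnS leq_eqVlt neighbours_add_edge // (negPf pk) eqxx inE.
  case/orP => [-> //|jt]; rewrite neighbours_rcons Sp nth_rcons ss jt => ej.
  by rewrite known ?orbT // (leq_trans jt tq).
have rl' : realises p.+1 t s.
  split; [exact: us|exact: ss|exact: real_V rl|exact: real_nb_uniq rl|exact: real_nb rl|].
  move=> i y; rewrite ltnS leq_eqVlt => /orP [/eqP ->|ip] ey; last exact: (real_full rl ip ey).
  have ys : y \in s by have := none y; rewrite ey /= negbK.
  have it : index y s < size t by rewrite -ss index_mem.
  exists (index y s); last by rewrite nth_index.
  by apply: known => //; [exact: leq_trans it tq|rewrite nth_index].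
rewrite (negPf (badF rl' pt)).
have full i j : i < p.+1 -> j < size t -> e (S s j) (S s i) -> i \in neighbours t j.
  move=> ip jt; rewrite e_sym => /(real_full rl' ip) [j' j'i jE].
  have [_ j't _ ij'] := real_nb rl j'i.
  by rewrite (realises_inj rl jt j't jE).
case: ltnP => [p1t run2|tp].
  apply: (IH _ _ _ _ run2 rl' p1t) => j; rewrite ltnS leq_eqVlt => /orP [/eqP ->|jp] jt.
    by rewrite e_irr.
  exact: full.
have tE : size t = p.+1 by apply/eqP; rewrite eqn_leq tp pt.
case: ifP => // lt run2.
have [/subsetP Vs|/subsetPn [y yV ys]] := boolP (V \subset s).
  apply: (is_listedP _ _ lt); first by rewrite tE; exact: rl'.
  by move=> y; apply/idP/idP => [/(real_V rl)|/Vs].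
have rl2 := realises_rcons pt rl' yV ys.
apply: (IH _ _ _ _ run2 rl2); first by rewrite size_rcons tE.
move=> j _; rewrite size_rcons ltnS leq_eqVlt neighbours_rcons => /orP [/eqP ->|jt].
  by rewrite !nth_rcons ss -tE ltnn eqxx e_irr.
rewrite !nth_rcons ss jt -tE ltnn eqxx e_sym => ej.
have [j' j'j yE] : exists2 j', j' \in neighbours t j & y = S s j'.
  by apply: (real_full rl') ej; rewrite -tE.
have [_ j't _ _] := real_nb rl j'j.
by case/negP: ys; rewrite yE mem_nth // ss.
Qed.

End States.

Theorem good_graph_listed x y : e x y -> listed_copy x.
Proof.
move=> exy; have xy : x != y by apply: contraTneq exy => ->; rewrite e_irr.
apply: (search_sound (s := [:: x; y]) search_initial); last 2 first.
- by [].
- by case=> //= _ _; rewrite e_irr.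
split=> //.
+ by rewrite /= inE xy.
+ move=> z; rewrite !inE => /orP [] /eqP ->; [|exact: eV exy].
  by apply: (@eV y); rewrite e_sym.
+ by case=> [|[|i]]; rewrite /neighbours //= nth_nil.
case=> [|[|i]] j; rewrite /neighbours /= ?inE ?nth_nil // => /eqP ->; split=> //=.
by rewrite e_sym.
Qed.

End GoodGraph.

(** * Computable certificates for forests and for connected families of faces *)

Section Certificates.
Variable t : graph_table.
Local Notation nb := (neighbours t).

(** Success exhibits an elimination order by vertices with at most one remaining neighbour, the
    witness of a forest. [find] returns the length of [W] if no vertex qualifies. *)
Fixpoint peel (fuel : nat) (W : seq nat) : bool :=
  if fuel is f.+1 then
    let i := find (fun x => size [seq y <- nb x | memn y W] <= 1) W in
    if i < size W then peel f (rem (nth 0 W i) W) else W == [::]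
  else W == [::].

Definition comparable_faces (h h' : seq nat) : bool :=
  all (mem h) h' || all (mem h') h.

Fixpoint grow (fuel : nat) (reached todo : seq (seq nat)) : bool :=
  if fuel is f.+1 then
    let i := find (fun h => has (comparable_faces h) reached) todo in
    if i < size todo then
      grow f (nth [::] todo i :: reached) (rem (nth [::] todo i) todo)
    else todo == [::]
  else todo == [::].

Definition connected_faces (hs : seq (seq nat)) : bool :=
  if hs is h :: hs' then grow (size hs') [:: h] hs' else true.

(** Meant to list the faces off [b] with a link: every edge has one, a vertex [x] if [free x], and
    the empty face has none for a minimal nonface [b]. Edges occur in both orientations, which are
    comparable to each other. *)
Definition linked_faces (b : seq nat) (free : nat -> bool) : seq (seq nat) :=
  [seq [:: x] | x <- iota 0 (size t) & (x \notin b) && free x] ++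
  [seq [:: x; y] | x <- [seq x <- iota 0 (size t) | x \notin b],
                   y <- [seq y <- nb x | y \notin b]].

Definition nonedge_ok u v : bool :=
  (u == v) || (v \in nb u) ||
  connected_faces (linked_faces [:: u; v] (fun x => ~~ ((x \in nb u) && (x \in nb v)))).

Definition triangle_ok u v w : bool :=
  (w \notin nb v) || connected_faces (linked_faces [:: u; v; w] xpredT).

Definition table_ok : bool :=
  let vs := iota 0 (size t) in
  [&& all (fun v => v \notin nb v) vs,
      all (fun v => size (nb v) <= 3) vs,
      all (fun v => peel (size t) (non_neighbours t v)) vs,
      all (fun u => all (nonedge_ok u) vs) vs
    & all (fun u => all (fun v => all (triangle_ok u v) (nb u)) (nb u)) vs].

Hypothesis nb_sym : forall i j, (j \in nb i) = (i \in nb j).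
Hypothesis nb_irr : forall i, i \notin nb i.

(** A potential on the remaining vertices extends over a removed one: at most one edge leads back,
    and its equation determines the new value. *)
Lemma peel_potential (K : zmodType) (l : nat -> nat -> K) f W :
  (forall x y, l x y = - l y x)%R -> uniq W -> peel f W ->
  exists psi : nat -> K, forall x y, x \in W -> y \in W -> y \in nb x ->
    (l x y = psi x - psi y)%R.
Proof.
move=> lN; elim: f W => [|f IH] W uW /=.
  by move=> /eqP ->; exists (fun=> 0%R).
set a := (fun x => _); case: ifP => [aW|_ /eqP ->]; last by exists (fun=> 0%R).
have := nth_find 0 (_ : has a W); rewrite has_find => /(_ aW).
set x := nth 0 W _; rewrite /a => deg1 /(IH _ (rem_uniq _ uW)) [psi psiP].
pose c : K := if [seq y <- nb x | memn y W] is y0 :: _ then (l x y0 + psi y0)%R else 0%R.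
have cE y : y \in W -> y \in nb x -> (l x y = c - psi y)%R.
  move=> yW yx; have : y \in [seq y <- nb x | memn y W] by rewrite mem_filter memnE yW.
  rewrite /c; case: [seq _ <- _ | _] deg1 => [//|y0 [|//]] _.
  by rewrite inE => /eqP ->; rewrite addrK.
exists (fun z => if z == x then c else psi z) => y z yW zW zy.
have [yx|yx] := eqVneq y x.
  rewrite yx in zy *; have [zx|_] := eqVneq z x; last exact: cE.
  by move: zy; rewrite zx (negPf (nb_irr x)).
have [zx|zx] := eqVneq z x.
  by rewrite lN zx (cE y) // ?opprB // nb_sym -zx.
by apply: psiP => //; rewrite mem_rem_uniq // inE ?yx ?zx.
Qed.

Lemma grow_constant (K : eqType) (g : seq nat -> K) c f reached todo :
  (forall h h', h \in reached ++ todo -> h' \in reached ++ todo ->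
     comparable_faces h h' -> g h = g h') ->
  {in reached, forall h, g h = c} -> grow f reached todo ->
  {in todo, forall h, g h = c}.
Proof.
elim: f reached todo => [|f IH] reached todo gP gc /=; first by move=> /eqP -> h.
set a := (fun h => _); case: ifP => [aT|_ /eqP ->]; last by move=> h.
have := nth_find [::] (_ : has a todo); rewrite has_find => /(_ aT).
set h0 := nth [::] todo _; rewrite /a => /hasP [h1 h1r cmp] /IH grown h hT.
have h0T : h0 \in todo by apply: mem_nth.
have sub : {subset (h0 :: reached) ++ rem h0 todo <= reached ++ todo}.
  move=> z; rewrite !mem_cat inE -orbA => /or3P [/eqP ->|->//|/mem_rem ->].
    by rewrite h0T orbT.
  by rewrite orbT.
have g0 : g h0 = c.
  by rewrite (gP h0 h1) ?gc // mem_cat ?h0T ?h1r ?orbT.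
have [->//|hh0] := eqVneq h h0.
apply: grown => [z z' /sub zT /sub z'T|z|]; first exact: gP.
  by rewrite inE => /orP [/eqP ->|/gc].
by move: hT; rewrite (perm_mem (perm_to_rem h0T)) inE (negPf hh0).
Qed.

Lemma connected_facesP (K : eqType) (g : seq nat -> K) hs : connected_faces hs ->
  (forall h h', h \in hs -> h' \in hs -> comparable_faces h h' -> g h = g h') ->
  {in hs &, forall h h', g h = g h'}.
Proof.
case: hs => [//|h0 hs] /= grown gP.
have gc : {in h0 :: hs, forall h, g h = g h0}.
  move=> h; rewrite inE => /orP [/eqP ->//|].
  apply: (grow_constant (g := g) (c := g h0) _ _ grown) => // h1.
  by rewrite inE => /eqP ->.
by move=> h h' /gc -> /gc ->.
Qed.

End Certificates.

Lemma listed_tables_ok : all table_ok listed_tables.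
Proof. by vm_cast_no_check (erefl true). Qed.

Lemma listed_tables_distinct :
  all (fun i => all (fun j => isob (nth [::] listed_tables i) (nth [::] listed_tables j)
                              ==> (i == j)) (iota 0 26)) (iota 0 26).
Proof. by vm_cast_no_check (erefl true). Qed.

Lemma listed_graphs_leaf :
  all (fun ge => (ge.1 <= 5) ||
    all (fun v => 1 < size (neighbours (graph_of ge.1 ge.2) v)) (iota 0 ge.1))
    listed_graphs.
Proof. by vm_cast_no_check (erefl true). Qed.

Lemma listed_graphs_size : all (fun ge => ge.1 <= 8) listed_graphs.
Proof. by []. Qed.

Lemma listed_graphs_edge :
  all (fun ge => has (fun e => [&& e.1 != e.2, 0 < e.1 <= ge.1 & 0 < e.2 <= ge.1]) ge.2)
    listed_graphs.
Proof. by vm_cast_no_check (erefl true). Qed.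

(** * Complexes given by edge lists *)

Section GraphComplex.
Variables (n : nat) (E : seq (nat * nat)).
Local Notation D := (graph_complex n E).
Local Notation t := (graph_of n E).
Local Notation nb := (neighbours t).

Lemma size_graph_of : size t = n.
Proof. by rewrite size_map size_iota. Qed.

Lemma mem_neighbours i j : (j \in nb i) = [&& i < n, j < n & labelled_edge E i j].
Proof.
rewrite /neighbours; case: ltnP => [it|it]; last first.
  by rewrite nth_default // size_graph_of.
by rewrite (nth_map 0) ?size_iota // nth_iota // mem_filter mem_iota /= andbC.
Qed.

Lemma labelled_edge_sym i j : labelled_edge E i j = labelled_edge E j i.
Proof. by rewrite /labelled_edge orbC. Qed.

Lemma neighbours_sym i j : (j \in nb i) = (i \in nb j).
Proof. by rewrite !mem_neighbours labelled_edge_sym; case: (i < n); case: (j < n). Qed.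

Lemma graph_complex_dim (F : {set 'I_n}) : F \in faces D -> #|F| <= 2.
Proof.
rewrite inE => /orP [F1|/hasP [e _ /eqP ->]]; first exact: leq_trans F1 _.
exact: card_edge_set.
Qed.

Lemma graph_complex_vertex (x : 'I_n) : x \in vertices D.
Proof. by rewrite inE inE cards1. Qed.

Lemma graph_complex_adj (x y : 'I_n) : adj D x y = (x != y) && labelled_edge E x y.
Proof.
rewrite /adj inE; case: eqVneq => //= xy; rewrite cards2 xy /=.
apply/hasP/idP => [[e eE /eqP xyE]|].
  have : x \in edge_set n e by rewrite -xyE !inE eqxx.
  have : y \in edge_set n e by rewrite -xyE !inE eqxx orbT.
  rewrite !inE => ye xe.
  have xy' : x.+1 != y.+1 by rewrite eqSS.
  rewrite /labelled_edge; case: e eE {xyE} ye xe => e1 e2 /= eE.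
  case/orP => /eqP y1 /orP [] /eqP x1; rewrite ?x1 ?y1 ?eE ?orbT //;
  by move: xy'; rewrite x1 y1 eqxx.
by case/orP => eE; eexists; eauto; apply/eqP/setP => z; rewrite !inE /= !eqSS // orbC.
Qed.

Lemma graph_complex_nb (x y : 'I_n) : val x \notin nb x -> adj D x y = (val y \in nb x).
Proof.
rewrite graph_complex_adj !mem_neighbours !ltn_ord /= => nxx.
by case: eqVneq => // <-; rewrite (negPf nxx).
Qed.


(** If [F] has no nonadjacent pair it is a clique that is no face, so it has three vertices, and
    these already form a nonface. *)
Lemma min_nonface_cases (F : {set 'I_n}) : F \in min_nonfaces D ->
  (exists u v, [/\ u != v, ~~ adj D u v & F = [set u; v]]) \/
  (exists u v w, [/\ adj D u v, adj D u w, adj D v w & F = [set u; v; w]]).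
Proof.
move=> Fm; have FD := min_nonfaceP Fm.
have [/existsP [u /existsP [v /and4P [uF vF uv nuv]]]|none] :=
    boolP [exists u, exists v, [&& u \in F, v \in F, u != v & ~~ adj D u v]].
  left; exists u, v; split=> //; symmetry; apply: (min_nonface_proper Fm).
    by apply/subsetP => x; rewrite !inE => /orP [] /eqP ->.
  by move: nuv; rewrite /adj uv.
have adjF u v : u \in F -> v \in F -> u != v -> adj D u v.
  move=> uF vF uv; apply: contraNT none => nuv.
  by apply/existsP; exists u; apply/existsP; exists v; rewrite uF vF uv nuv.
have F1 : 1 < #|F|.
  by move: FD; rewrite inE negb_or -ltnNge => /andP [].
have /card_gt1P [u [v [uF vF uv]]] := F1.
have /subsetPn [w wF] : ~~ (F \subset [set u; v]).
  by apply: contra FD => Fuv; apply: faces_sub Fuv _; apply/adj_face/adjF.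
rewrite !inE negb_or => /andP [wu wv]; right; exists u, v, w.
split; rewrite ?adjF // 1?eq_sym //; symmetry; apply: (min_nonface_proper Fm).
  by apply/subsetP => x; rewrite !inE => /orP [/orP [] |] /eqP ->.
by apply: (nonface3 graph_complex_dim); rewrite // eq_sym.
Qed.

Definition set_of_seq (l : seq nat) : {set 'I_n} := [set i | val i \in l].

Lemma set_of_seq1 (x : 'I_n) : set_of_seq [:: val x] = [set x].
Proof. by apply/setP => i; rewrite !inE. Qed.

Lemma set_of_seq2 (x y : 'I_n) : set_of_seq [:: val x; val y] = [set x; y].
Proof. by apply/setP => i; rewrite !inE. Qed.

Section Linked.
Hypothesis irr : forall i, i \notin nb i.
Variables (K : eqType) (b : {set 'I_n}) (bs : seq nat) (free : nat -> bool).
Variable g : {set 'I_n} -> K.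
Hypothesis bsE : forall x : 'I_n, (val x \in bs) = (x \in b).
Hypothesis b_min : b \in min_nonfaces D.
Hypothesis g_stable : forall h h' : {set 'I_n}, h \subset h' -> h' \in faces D ->
  [disjoint h' & b] -> has_link D b h -> g h = g h'.
Hypothesis freeE : forall x : 'I_n, x \notin b -> has_link D b [set x] <-> free x.
Hypothesis edge_link : forall x y : 'I_n, x \notin b -> y \notin b -> adj D x y ->
  has_link D b [set x; y].
Hypothesis ok : connected_faces (linked_faces t bs free).

(** Transfers the connectivity computed on lists of numbers to faces: the listed lists are exactly
    the encodings of the faces off [b] with a link. *)
Lemma linked_constant (h h' : {set 'I_n}) : h \in faces D -> h' \in faces D ->
  [disjoint h & b] -> [disjoint h' & b] -> has_link D b h -> has_link D b h' ->
  g h = g h'.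
Proof.
have listed l : l \in linked_faces t bs free ->
    [/\ set_of_seq l \in faces D, [disjoint set_of_seq l & b]
      & has_link D b (set_of_seq l)].
  rewrite mem_cat => /orP [/mapP [i]|/allpairsPdep [i [j []]]].
    rewrite mem_filter mem_iota size_graph_of => /andP [/andP [ib fi] /andP [_ lt_i]] ->.
    pose x := Ordinal lt_i; rewrite -[i]/(val x) set_of_seq1 in ib fi *.
    rewrite bsE in ib; split=> //=.
    - by have := graph_complex_vertex x; rewrite inE.
    - by rewrite disjoints1.
    - exact/freeE.
  rewrite mem_filter mem_iota size_graph_of => /andP [ib /andP [_ lt_i]].
  rewrite mem_filter => /andP [jb ji] ->.
  have lt_j : j < n by move: ji; rewrite mem_neighbours => /and3P [].
  pose x := Ordinal lt_i; pose y := Ordinal lt_j.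
  rewrite -[i]/(val x) -[j]/(val y) set_of_seq2 in ib jb ji *; rewrite !bsE in ib jb.
  have axy : adj D x y by rewrite graph_complex_nb.
  split=> //=.
  - by have := adj_face axy; rewrite inE.
  - by rewrite disjoint_sym disjoints_subset; apply/subsetP => z zb; rewrite !inE negb_or;
      apply/andP; split; apply: contraTneq zb => ->.
  - exact: edge_link.
have enum h1 : h1 \in faces D -> [disjoint h1 & b] -> has_link D b h1 ->
    exists2 l, l \in linked_faces t bs free & set_of_seq l = h1.
  move=> h1D h1b lk.
  have [h0|[x xh]] := set_0Vmem h1.
    case: lk => G Gm [Gh bG]; case/negP: bG; rewrite h0 set0U in Gh.
    by rewrite (min_nonface_proper b_min Gh (min_nonfaceP Gm)).
  have xb : x \notin b by rewrite (disjointFr h1b).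
  have [h1x|/subsetPn [y yh]] := boolP (h1 \subset [set x]).
    have h1E : h1 = [set x] by apply/eqP; rewrite eqEsubset h1x sub1set.
    exists [:: val x]; last by rewrite set_of_seq1.
    rewrite mem_cat; apply/orP; left; apply/mapP; exists (val x) => //.
    rewrite mem_filter bsE xb mem_iota size_graph_of ltn_ord /= andbT.
    by apply/freeE; rewrite // -h1E.
  rewrite inE => yx; have yb : y \notin b by rewrite (disjointFr h1b).
  have axy : adj D x y by apply: (face_adj graph_complex_dim h1D); rewrite // eq_sym.
  exists [:: val x; val y].
    rewrite mem_cat; apply/orP; right; apply/allpairsPdep; exists (val x), (val y).
    by rewrite !mem_filter !bsE xb yb mem_iota size_graph_of ltn_ord -graph_complex_nb.
  rewrite set_of_seq2 [RHS](face_cover graph_complex_dim h1D xh yh) //.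
  by rewrite eq_sym.
move=> hD h'D hb h'b lh lh'.
have [l lL <-] := enum h hD hb lh; have [l' l'L <-] := enum h' h'D h'b lh'.
apply: (connected_facesP (g := fun l => g (set_of_seq l)) ok) lL l'L.
have sub l1 l2 : all (mem l2) l1 -> set_of_seq l1 \subset set_of_seq l2.
  by move=> /allP l12; apply/subsetP => z; rewrite !inE => /l12.
move=> l1 l2 /listed [D1 b1 k1] /listed [D2 b2 k2] /orP [/sub|/sub] s12.
  by symmetry; apply: g_stable.
exact: g_stable.
Qed.

End Linked.

Theorem table_ok_vanishes (K : fieldType) : table_ok t -> T2_vanishes K D.
Proof.
move=> /and5P []; rewrite size_graph_of => irr_all deg peels nonedges triangles.
have irr i : i \notin nb i.
  have [lt_i|ge_i] := ltnP i n; last by rewrite mem_neighbours ltnNge ge_i.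
  by apply: (allP irr_all); rewrite mem_iota.
have inV (x : 'I_n) : val x \in iota 0 n by rewrite mem_iota /= add0n.
apply: T2_vanishes_graph.
- exact: graph_complex_dim.
- exact: graph_complex_vertex.
- move=> v u w x y vu vw vx vy; apply/negP => us.
  have : size [seq val z | z <- [:: u; w; x; y]] <= size (nb v).
    apply: uniq_leq_size; first by rewrite (map_inj_uniq val_inj).
    move=> z /mapP [z' zi ->]; rewrite -graph_complex_nb //.
    by move: zi; rewrite !inE => /or4P [] /eqP ->.
  by rewrite leqNgt ltnS (allP deg _ (inV v)).
- move=> v l lN; pose o i := insubd v i.
  have [||psi psiP] := @peel_potential t neighbours_sym irr K
      (fun i j => l (o i) (o j)) _ (non_neighbours t v) _ _ (allP peels _ (inV v)).
  + by move=> i j; apply: lN.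
  + by rewrite filter_uniq // iota_uniq.
  have nonnb z : z != v -> ~~ adj D v z -> val z \in non_neighbours t v.
    move=> zv nvz; rewrite mem_filter mem_iota size_graph_of /= ltn_ord andbT memnE.
    rewrite -graph_complex_nb // nvz; case E1: eqn => //.
    by move: zv; rewrite -val_eqE /= -eqnE E1.
  exists (fun x => psi (val x)) => x y xv yv nvx nvy axy.
  rewrite -psiP ?nonnb // /o ?valKd // -graph_complex_nb //.
move=> b g bm gP h h' hD h'D hb h'b lh lh'.
(* Three distinct vertices always contain a minimal nonface, so three points of [c :|: b] that miss
   a point of [b] give a link. *)
have three_link (c : {set 'I_n}) x y z : x != y -> x != z -> y != z ->
    [set x; y; z] \subset c :|: b -> ~~ (b \subset [set x; y; z]) -> has_link D b c.
  move=> xy xz yz sub nb3; have [|G Gm Gs] := @min_nonface_sub _ D [set x; y; z].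
    by rewrite inE; apply: (nonface3 graph_complex_dim).
  exists G => //; split; first exact: subset_trans sub.
  by apply: contra nb3 => /subset_trans; apply.
case: (min_nonface_cases bm) => [[u [v [uv nuv bE]]]|[u [v [w [uv uw vw bE]]]]]; subst b.
  have ok : connected_faces (linked_faces t [:: val u; val v]
      (fun x => ~~ ((x \in nb u) && (x \in nb v)))).
    have := allP (allP nonedges _ (inV u)) _ (inV v).
    by rewrite /nonedge_ok val_eqE (negPf uv) -graph_complex_nb // (negPf nuv).
  apply: (linked_constant irr _ bm gP _ _ ok) => //.
  + by move=> x; rewrite !inE.
  + move=> x; rewrite !inE negb_or => /andP [xu xv].
    have nbE (z : 'I_n) : (val x \in nb z) = adj D x z.
      by rewrite adj_sym graph_complex_nb.
    rewrite !nbE; split.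
      move=> [G Gm [Gs bG]]; apply/negP => /andP [au av]; case/negP: bG.
      rewrite (nonedge_cone_min nuv uv au av Gm) //.
      by apply: subset_trans Gs _; rewrite setUC.
    have aux (a c : 'I_n) : ~~ adj D x a -> x != a -> x != c -> c != a -> [set a;
      c] = [set u; v] ->
        has_link D [set u; v] [set x].
      move=> nxa xa xc ca <-; exists [set x; a].
        by apply: nonedge_min => //; apply: graph_complex_vertex.
      split; first by apply/subsetP => z; rewrite !inE; do 2!case: (z == _).
      apply/negP => /subsetP /(_ c); rewrite !inE eqxx orbT => /(_ isT).
      by rewrite (negPf ca) orbF eq_sym (negPf xc).
    rewrite negb_and => /orP [nxu|nxv].
      by apply: (aux u v) => //; rewrite eq_sym.
    by apply: (aux v u) => //; rewrite setUC.
  move=> x y; rewrite !inE !negb_or => /andP [xu xv] /andP [yu yv] axy.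
  apply: (three_link _ x y u) => //; first exact: adj_neq axy.
    by apply/subsetP => z; rewrite !inE; do 4!case: (z == _).
  apply/negP => /subsetP /(_ v); rewrite !inE eqxx orbT => /(_ isT).
  by rewrite ![v == _]eq_sym (negPf xv) (negPf yv) (negPf uv).
have ok : connected_faces (linked_faces t [:: val u; val v; val w] xpredT).
  have wu : val w \in nb u by rewrite -graph_complex_nb.
  have vu : val v \in nb u by rewrite -graph_complex_nb.
  have := allP (allP (allP triangles _ (inV u)) _ vu) _ wu.
  by rewrite /triangle_ok -graph_complex_nb // vw.
have link1 x : x \notin [set u; v; w] -> has_link D [set u; v; w] [set x].
  rewrite !inE !negb_or -andbA => /and3P [xu xv xw].
  apply: (three_link _ x u v) => //; first exact: adj_neq uv.
    by apply/subsetP => z; rewrite !inE; do 4!case: (z == _).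
  apply/negP => /subsetP /(_ w); rewrite !inE eqxx orbT => /(_ isT).
  by rewrite ![w == _]eq_sym (negPf xw) (negPf (adj_neq uw)) (negPf (adj_neq vw)).
apply: (linked_constant irr _ bm gP _ _ ok) => //.
+ by move=> x; rewrite !inE orbA.
+ by move=> x xb; split=> // _; apply: link1.
move=> x y xb yb axy; have [G Gm [Gs bG]] := link1 x xb.
exists G => //; split=> //; apply: subset_trans Gs _; apply: setSU.
by rewrite sub1set !inE eqxx.
Qed.

End GraphComplex.

(** * The classification and its corollaries *)

Section Classification.

Lemma one_dimensionalP n (D : scomplex n) : one_dimensional D <->
  (forall F, F \in faces D -> #|F| <= 2) /\ exists x y, adj D x y.
Proof.
split=> [D2|[D2 [x [y xy]]]].
  have le2 F : F \in faces D -> #|F| <= 2.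
    by move=> FD; rewrite -[2]D2 (leq_bigmax_cond (F := fun F : {set 'I_n} => #|F|)).
  split=> //; have [/existsP [F /andP [FD /cards2P [x [y [xy FE]]]]]|/existsPn none] :=
      boolP [exists F, (F \in faces D) && (#|F| == 2)].
    by exists x, y; rewrite /adj xy -FE.
  suff : \max_(F in faces D) #|F| <= 1 by rewrite D2.
  apply/bigmax_leqP => F FD; have := none F; rewrite FD /= => F2.
  by rewrite -ltnS ltn_neqAle F2 le2.
apply/eqP; rewrite eqn_leq; apply/andP; split; first exact/bigmax_leqP.
rewrite -[X in X <= _](_ : #|[set x; y]| = 2); last by rewrite cards2 (adj_neq xy).
exact: (leq_bigmax_cond (F := fun F : {set 'I_n} => #|F|)) (adj_face xy).
Qed.

(** Phrased with [vertices D] in place of the ground set, so that it also yields the two bounds on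
    complexes that may have loops. *)
Lemma T2_vanishes_listed (K : fieldType) n (D : scomplex n) :
  one_dimensional D -> T2_vanishes K D ->
  exists x0, listed_copy (vertices D) (adj D) x0.
Proof.
move=> /one_dimensionalP [dim1 [x [y xy]]] T0; exists x.
apply: good_graph_listed xy.
- exact: adj_sym.
- exact: adj_irr.
- exact: adj_vertexr.
- move=> v; rewrite leqNgt; apply/negP => d4.
  have /card_gt0P [u uN] : 0 < #|nbh (adj D) v| by apply: leq_trans d4.
  have : 2 < #|nbh (adj D) v :\ u| by move: d4; rewrite (cardsD1 u) uN.
  move=> /card_gt2P [w [a [b [[]]]]].
  rewrite !inE in uN *; move=> /andP [wu vw] /andP [au va] /andP [bu vb] [wa ab bw].
  apply: (T2_degree T0 dim1 uN vw va vb).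
  by rewrite /= !inE !negb_or ![u == _]eq_sym wu au bu wa [w == b]eq_sym bw ab.
- by move=> v W vV WV vW nW W0; apply: (T2_forest T0 dim1 vV WV vW nW W0).
- exact: (T2_nonedge T0 dim1).
- exact: (T2_triangle T0 dim1).
Qed.

Lemma isomorphism_of_adj n n' (D : scomplex n) (D' : scomplex n') (f : 'I_n -> 'I_n') :
  (forall F, F \in faces D -> #|F| <= 2) -> (forall F, F \in faces D' -> #|F| <= 2) ->
  loopless D -> loopless D' -> bijective f ->
  (forall x y, adj D' (f x) (f y) = adj D x y) -> isomorphic D D'.
Proof.
move=> dim dim' lD lD' bf fadj; have injf := bij_inj bf; exists f => // F.
have vD x : [set x] \in faces D by have := in_setT x; rewrite -lD inE.
have vD' x : [set x] \in faces D' by have := in_setT x; rewrite -lD' inE.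
have cF : #|f @: F| = #|F| by apply: card_imset.
have [F2|F2] := ltnP 2 #|F|.
  have -> : (F \in faces D) = false by apply: contraTF F2 => /dim; rewrite -leqNgt.
  by apply: contraTF F2 => /dim'; rewrite cF -leqNgt.
have [F0|[x xF]] := set_0Vmem F; first by rewrite F0 imset0 !faces0.
have [Fx|/subsetPn [y yF]] := boolP (F \subset [set x]).
  have -> : F = [set x] by apply/eqP; rewrite eqEsubset Fx sub1set.
  by rewrite imset_set1 vD vD'.
rewrite inE => yx; have xy : x != y by rewrite eq_sym.
have -> : F = [set x; y].
  apply/eqP; rewrite eq_sym eqEcard cards2 xy F2 andbT.
  by apply/subsetP => z; rewrite !inE => /orP [] /eqP ->.
have := fadj x y; rewrite /adj (inj_eq injf) xy /= => <-.
by rewrite imsetU !imset_set1.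
Qed.

Lemma isomorphic_adj n n' (D : scomplex n) (D' : scomplex n') :
  isomorphic D D' -> exists2 f : 'I_n -> 'I_n', bijective f &
    forall x y, adj D' (f x) (f y) = adj D x y.
Proof.
case=> f bf fF; exists f => // x y; have := fF [set x; y].
by rewrite /adj imsetU !imset_set1 (inj_eq (bij_inj bf)) => ->.
Qed.

Lemma listed_mem (k : 'I_26) : tnth listed_graphs k \in (listed_graphs : seq _).
Proof. exact: mem_tnth. Qed.

Lemma listed_table (k : 'I_26) :
  graph_of (tnth listed_graphs k).1 (tnth listed_graphs k).2 = nth [::] listed_tables k.
Proof.
rewrite /listed_tables (nth_map (0, [::])) ?size_tuple // -tnth_nth //.
Qed.

Lemma listed_table_ok (k : 'I_26) :
  table_ok (graph_of (tnth listed_graphs k).1 (tnth listed_graphs k).2).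
Proof.
by apply: (allP listed_tables_ok); apply: map_f (listed_mem k).
Qed.

Lemma listed_complex_dim (k : 'I_26) F : F \in faces (listed_complex k) -> #|F| <= 2.
Proof. exact: graph_complex_dim. Qed.

Lemma listed_complex_loopless (k : 'I_26) : loopless (listed_complex k).
Proof. by apply/setP => x; rewrite graph_complex_vertex inE. Qed.

Lemma listed_complex_one_dimensional (k : 'I_26) : one_dimensional (listed_complex k).
Proof.
apply/one_dimensionalP; split; first exact: listed_complex_dim.
have /hasP [[a b] abE] := allP listed_graphs_edge _ (listed_mem k).
rewrite /= => /and3P [ab /andP [a0 an] /andP [b0 bn]].
have lt_pred i m : 0 < i <= m -> i.-1 < m by case: i.
have an' := lt_pred a _ (introT andP (conj a0 an)).
have bn' := lt_pred b _ (introT andP (conj b0 bn)).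
exists (Ordinal an'), (Ordinal bn'); rewrite /listed_complex graph_complex_adj.
rewrite /labelled_edge /= !prednK // abE andbT -val_eqE /=.
by rewrite -eqSS !prednK.
Qed.

Lemma listed_complex_T2 (K : fieldType) (k : 'I_26) : T2_vanishes K (listed_complex k).
Proof. exact/table_ok_vanishes/listed_table_ok. Qed.

Lemma listed_complex_nb (k : 'I_26) (x y : 'I_(tnth listed_graphs k).1) :
  adj (listed_complex k) x y =
  (val y \in neighbours (graph_of (tnth listed_graphs k).1 (tnth listed_graphs k).2) x).
Proof.
apply: graph_complex_nb; have /and5P [irr _ _ _ _] := listed_table_ok k.
by apply: (allP irr); rewrite mem_iota size_graph_of /=.
Qed.

(** The list of values of an isomorphism is a complete [partial_iso], so [isob] accepts the pair; by
    computation it accepts only equal indices. *)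
Lemma listed_complex_distinct (k l : 'I_26) :
  isomorphic (listed_complex k) (listed_complex l) -> k = l.
Proof.
move=> /isomorphic_adj [f bf fadj].
have iso : isob (nth [::] listed_tables k) (nth [::] listed_tables l).
  rewrite -!listed_table /isob !size_graph_of.
  have nn' : (tnth listed_graphs k).1 = (tnth listed_graphs l).1.
    by rewrite -[LHS]card_ord -[RHS]card_ord; apply: bij_eq_card bf.
  rewrite {1}nn' eqxx.
  pose M := [seq val (f x) | x <- enum 'I_(tnth listed_graphs k).1].
  have sM : size M = (tnth listed_graphs k).1 by rewrite size_map size_enum_ord.
  have := @iso_ext_complete (graph_of (tnth listed_graphs k).1 (tnth listed_graphs k).2)
    (graph_of (tnth listed_graphs l).1 (tnth listed_graphs l).2) M (tnth listed_graphs k).1.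
  rewrite size_graph_of subnn take0; apply=> //.
  have nthM (x : 'I_(tnth listed_graphs k).1) : nth 0 M x = val (f x).
    by rewrite (nth_map x) ?size_enum_ord // nth_ord_enum.
  split.
  - rewrite map_inj_uniq ?enum_uniq // => x y /val_inj; exact: bij_inj.
  - by rewrite size_graph_of sM.
  - by move=> i /mapP [x _ ->]; rewrite size_graph_of nn' ltn_ord.
  move=> i j; rewrite sM => /andP [ij jn].
  have := nthM (Ordinal jn); have := nthM (Ordinal (ltn_trans ij jn)) => /= -> ->.
  by rewrite -listed_complex_nb fadj listed_complex_nb.
have := allP (allP listed_tables_distinct k _) l _; rewrite !mem_iota /= !ltn_ord.
by move=> /(_ isT isT); rewrite iso /= => /eqP /val_inj.
Qed.

Lemma listed_copy_isomorphic n (D : scomplex n) x0 :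
  one_dimensional D -> loopless D -> listed_copy (vertices D) (adj D) x0 ->
  exists k : 'I_26, isomorphic D (listed_complex k).
Proof.
move=> /one_dimensionalP [dim _] lD [_ /tnthP [k ->] [s [ss us sV sadj]]]; exists k.
set m := (tnth listed_graphs k).1 in ss sadj.
have sT x : x \in s by rewrite sV lD inE.
have lt_index x : index x s < m by rewrite -ss index_mem.
pose f x : 'I_m := Ordinal (lt_index x).
have bf : bijective f.
  exists (fun i : 'I_m => nth x0 s i) => [x|i]; first by rewrite nth_index.
  by apply: val_inj; rewrite /= index_uniq // ss.
apply: (isomorphism_of_adj dim (@listed_complex_dim k) lD (@listed_complex_loopless k) bf).
move=> x y; rewrite graph_complex_adj (inj_eq (bij_inj bf)) /=.
have [<-|xy] /= := eqVneq x y; first by rewrite adj_irr.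
rewrite -[in RHS](nth_index x0 (sT x)) -[in RHS](nth_index x0 (sT y)).
have : index x s != index y s.
  by apply: contra_neq xy => ixy; rewrite -(nth_index x0 (sT x)) ixy nth_index.
rewrite neq_ltn => /orP [] lt; first by rewrite sadj // lt lt_index.
by rewrite adj_sym sadj ?lt ?lt_index // labelled_edge_sym.
Qed.

Lemma card_listed_copy n (D : scomplex n) x0 : listed_copy (vertices D) (adj D) x0 ->
  #|vertices D| <= 8.
Proof.
case=> ge gel [s [ss us sV _]]; have <- : #|s| = #|vertices D| by apply: eq_card.
by rewrite (card_uniqP us) ss; apply: (allP listed_graphs_size).
Qed.

(** By computation a listed graph on more than five vertices has minimum degree two, and two
    neighbours of [x] give two different edges at [x]. *)
Lemma leaf_listed_copy n (D : scomplex n) x0 : listed_copy (vertices D) (adj D) x0 ->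
  has_leaf D -> #|vertices D| <= 5.
Proof.
case=> ge gel [s [ss us sV sadj]] [x /eqP leaf].
have <- : #|s| = #|vertices D| by apply: eq_card.
rewrite (card_uniqP us) ss; have /orP [//|/allP deg2] := allP listed_graphs_leaf _ gel.
have edgeE y : adj D x y -> [set x; y] \in [set e in edges D | x \in e].
  by move=> xy; rewrite !inE cards2 (adj_neq xy) (adj_face xy) !eqxx.
have xs : x \in s.
  have /card_gt0P [F] : 0 < #|[set e in edges D | x \in e]| by rewrite (eqP leaf).
  by rewrite !inE sV => /andP [/andP [FD _] xF]; apply: face_vertex FD xF.
have adjE j : j < ge.1 -> j != index x s -> adj D x (nth x0 s j) =
    labelled_edge ge.2 (index x s) j.
  move=> jn; have xn : index x s < ge.1 by rewrite -ss index_mem.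
  have -> : adj D x (nth x0 s j) = adj D (nth x0 s (index x s)) (nth x0 s j).
    by rewrite nth_index.
  rewrite neq_ltn => /orP [] lt; last by rewrite sadj // lt.
  by rewrite adj_sym sadj ?lt // labelled_edge_sym.
have xn : index x s < ge.1 by rewrite -ss index_mem.
have := deg2 (index x s); rewrite mem_iota /= xn => /(_ isT).
have [irr _ _ _ _] := and5P (allP listed_tables_ok _ (map_f _ gel)).
have {}irr : index x s \notin neighbours (graph_of ge.1 ge.2) (index x s).
  by apply: (allP irr); rewrite mem_iota size_graph_of.
have uN : uniq (neighbours (graph_of ge.1 ge.2) (index x s)).
  by rewrite /neighbours (nth_map 0) ?size_iota // filter_uniq ?iota_uniq.
have inN j : j \in neighbours (graph_of ge.1 ge.2) (index x s) ->
    j < ge.1 /\ adj D x (nth x0 s j).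
  move=> jN; have jx : j != index x s by apply: contraNneq irr => jE; rewrite -{1}jE.
  move: jN; rewrite mem_neighbours => /and3P [_ jn lj]; split; first exact: jn.
  by rewrite adjE.
case: (neighbours _ _) uN inN => [//|j [//|j' N']] /= /andP [jj' _] inN _.
have [|jn xj] := inN j; first by rewrite inE eqxx.
have [|j'n xj'] := inN j'; first by rewrite !inE eqxx orbT.
have /cards1P [e0 eE] := leaf.
have := edgeE _ xj; have := edgeE _ xj'; rewrite eE !inE => /eqP e1 /eqP e2.
have : nth x0 s j' \in [set x; nth x0 s j] by rewrite e2 -e1 !inE eqxx orbT.
rewrite !inE eq_sym (negPf (adj_neq xj')) /= nth_uniq ?ss // => /eqP jE.
by move: jj'; rewrite jE inE eqxx.
Qed.

End Classification.

Theorem theorem3p9 (K : fieldType) :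
  [/\ (* the listed complexes belong to the class *)
      forall k : 'I_26,
        [/\ one_dimensional (listed_complex k), loopless (listed_complex k)
          & T2_vanishes K (listed_complex k)],
      (* they are pairwise non-isomorphic *)
      forall k l : 'I_26,
        isomorphic (listed_complex k) (listed_complex l) -> k = l
    & (* there are no others *)
      forall (n : nat) (D : scomplex n),
        one_dimensional D -> loopless D -> T2_vanishes K D ->
        exists k : 'I_26, isomorphic D (listed_complex k)]
  /\
  [/\ (* the maximal number of vertices is eight *)
      exists (n : nat) (D : scomplex n),
        [/\ one_dimensional D, T2_vanishes K D & #|vertices D| = 8],
      forall (n : nat) (D : scomplex n),
        one_dimensional D -> T2_vanishes K D -> #|vertices D| <= 8
    & (* a leaf forces at most five vertices *)
      forall (n : nat) (D : scomplex n),
        one_dimensional D -> T2_vanishes K D -> has_leaf D ->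
        #|vertices D| <= 5].
Proof.
split; split.
- move=> k; split; [exact: listed_complex_one_dimensional
    |exact: listed_complex_loopless|exact: listed_complex_T2].
- exact: listed_complex_distinct.
- move=> n D D1 lD T0; have [x0 copy] := T2_vanishes_listed D1 T0.
  exact: listed_copy_isomorphic D1 lD copy.
(* Counting from zero, index 23 is graph (24), the cube. *)
- pose k := @Ordinal 26 23 isT.
  exists (tnth listed_graphs k).1, (listed_complex k); split.
  + exact: listed_complex_one_dimensional.
  + exact: listed_complex_T2.
  + by rewrite (listed_complex_loopless k) cardsT card_ord.
- move=> n D D1 T0; have [x0] := T2_vanishes_listed D1 T0.
  exact: card_listed_copy.
- move=> n D D1 T0; have [x0] := T2_vanishes_listed D1 T0.
  exact: leaf_listed_copy.
Qed.
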